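(* Let $(\Gamma,\mu)$ be a transient random walk on a finitely generated group $\Gamma$ satisfying the moment condition $\sum_{g\in\Gamma}\mu(g)C^{d(g,e)}<\infty$, where $d$ and $C$ are the word metric and the Harnack constant described in the context. Assume that the Poisson boundary of $(\Gamma,\mu)$ is trivial and let $\xi_0\in\partial_m\Gamma$ be the point supporting the harmonic measure. For every real number $\beta\neq0$ there is an affine homeomorphism $\tau\mapsto\omega_\tau$ from the tracial state space $T(C^*_r(\Gamma))$ of $C^*_r(\Gamma)$ onto the simplex of $\beta$-KMS states for the flow $\alpha^{D^\mu}$ on $C(\partial_M\Gamma)\rtimes_r\Gamma$ such that $$\omega_\tau(fU_g)=f(\xi_0)\,\tau(U_g)$$ for all $f\in C(\partial_M\Gamma)$ and all $g\in\Gamma$.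
   Context: A random walk $(\Gamma,\mu)$ consists of a countable discrete group $\Gamma$ with neutral element $e$ and a function $\mu:\Gamma\to[0,1]$ with $\sum_{g}\mu(g)=1$ whose support $\{g:\mu(g)>0\}$ generates $\Gamma$ as a semigroup. Put $\mu_{x,y}=\mu(x^{-1}y)$, and let $\mu^n_{x,y}$ be the entries of the $n$-th power of this matrix ($\mu^0$ is the identity matrix). The walk is transient when $G(x,y)=\sum_{n\ge0}\mu^n_{x,y}<\infty$ for all $x,y\in\Gamma$; then $G>0$. The Martin kernel is $K(g,h)=G(g,h)/G(e,h)$. The Martin compactification is the compact metrizable space containing $\Gamma$ as a dense, open, discrete subset such that every function $h\mapsto K(g,h)$, $g\in\Gamma$, extends continuously to it and such that the extensions separate the points of the complement $\partial_M\Gamma$ of $\Gamma$, which is called the Martin boundary. The extended kernel is also denoted $K:\Gamma\times\partial_M\Gamma\to(0,\infty)$. Left translation of $\Gamma$ on itself extends to an action of $\Gamma$ by homeomorphisms of the compactification, hence of $\partial_M\Gamma$, written $\xi\mapsto g\xi$, and $K(x,g\xi)K(g^{-1},\xi)=K(g^{-1}x,\xi)$. The minimal Martin boundary $\partial_m\Gamma\subseteq\partial_M\Gamma$ is the (Borel) set of $\xi$ for which $g\mapsto K(g,\xi)$ is an extremal point of the convex set of functions $\varphi:\Gamma\to[0,\infty)$ with $\varphi(e)=1$ and $\sum_{s}\mu(s)\varphi(gs)=\varphi(g)$ for all $g\in\Gamma$. Harmonic measure: if $s_1,s_2,\dots$ are independent $\Gamma$-valued random variables with distribution $\mu$, the sequence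 $x_n=s_1s_2\cdots s_n$ converges almost surely in the Martin compactification to a point of $\partial_M\Gamma$; the harmonic measure ${}_e\nu$ is the distribution of this limit. It is concentrated on $\partial_m\Gamma$, and $(\partial_M\Gamma,{}_e\nu)$ is a realization of the Poisson boundary. The Poisson boundary is trivial when ${}_e\nu$ is supported on a single point. Moment condition: $d$ is the word metric on $\Gamma$ coming from a finite symmetric set generating $\Gamma$ as a semigroup, and $C>0$ is a constant such that the Harnack inequality $G(x,z)/G(y,z)\le C^{d(x,y)}$ holds for all $x,y,z\in\Gamma$. In the reduced crossed product $C(\partial_M\Gamma)\rtimes_r\Gamma$, $\{U_g\}_{g\in\Gamma}$ denotes the canonical unitaries, so $(U_gfU_g^* )(\xi)=f(g^{-1}\xi)$; the canonical unitaries of the reduced group $C^*$-algebra $C^*_r(\Gamma)$ are also denoted $U_g$. The flow $\alpha^{D^\mu}$ is the continuous one-parameter group of automorphisms with $\alpha^{D^\mu}_t(fU_g)=fU_gK(g^{-1},\cdot)^{-it}$ for $f\in C(\partial_M\Gamma)$, $g\in\Gamma$, $t\in\mathbb R$. For $\beta\in\mathbb R$, a state $\omega$ is a $\beta$-KMS state for a flow $\alpha$ when $\omega(ab)=\omega(b\,\alpha_{i\beta}(a))$ for all $\alpha$-analytic elements $a,b$. State spaces carry the weak* topology. *)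

(* Defs.v *)
From HB Require Import structures.
From mathcomp Require Import all_boot all_order all_algebra.
From mathcomp Require Import all_classical all_reals all_analysis.
From mathcomp Require Import complex.

Set Implicit Arguments.
Unset Strict Implicit.
Unset Printing Implicit Defensive.

Import Order.TTheory GRing.Theory Num.Theory numFieldNormedType.Exports.

Local Open Scope complex_scope.
Local Open Scope classical_set_scope.
Local Open Scope ring_scope.

Definition generates_as_semigroup (Gam : groupType) (S : set Gam) : Prop :=
  forall g : Gam, exists s : seq Gam,
    [/\ s != [::], (forall x, x \in s -> S x) & g = (\prod_(x <- s) x)%g].

Record random_walk (R : realType) (Gam : groupType) (mu : Gam -> R) : Prop := {
  rw_countable : countable [set: Gam];
  rw_itv : forall g, 0 <= mu g <= 1;
  rw_sum1 : \esum_(g in [set: Gam]) (mu g)%:E = 1%E;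
  rw_generates : generates_as_semigroup [set g | 0 < mu g]
}.

Fixpoint mu_pow (R : realType) (Gam : groupType) (mu : Gam -> R) (n : nat)
    (x y : Gam) : \bar R :=
  if n is m.+1 then
    \esum_(z in [set: Gam]) (mu_pow mu m x z * (mu (z^-1 * y)%g)%:E)%E
  else if x == y then 1%E else 0%E.

Definition green (R : realType) (Gam : groupType) (mu : Gam -> R)
    (x y : Gam) : \bar R :=
  (\sum_(0 <= n <oo) mu_pow mu n x y)%E.

Definition transient (R : realType) (Gam : groupType) (mu : Gam -> R) : Prop :=
  forall x y, (green mu x y < +oo)%E.

Definition greenR (R : realType) (Gam : groupType) (mu : Gam -> R)
    (x y : Gam) : R := fine (green mu x y).

Definition martin_kernel (R : realType) (Gam : groupType) (mu : Gam -> R)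
    (g h : Gam) : R := greenR mu g h / greenR mu 1%g h.

(* The compactification is characterised by these properties only up to a
   [Gam]-equivariant homeomorphism, so it is kept as a structure.  The metric
   of [mc_space] is an arbitrary compatible one. *)

Record martin_compactification (R : realType) (Gam : groupType)
    (mu : Gam -> R) := {
  mc_space :> metricType R;
  mc_emb : Gam -> mc_space;
  mc_compact : compact [set: mc_space];
  mc_emb_inj : injective mc_emb;
  mc_emb_open : forall g, open [set mc_emb g];
  mc_emb_dense : dense (range mc_emb);
  mc_kernel : Gam -> mc_space -> R;
  mc_kernel_continuous : forall g, continuous (mc_kernel g);
  mc_kernelE : forall g h, mc_kernel g (mc_emb h) = martin_kernel mu g h;
  mc_kernel_separates : forall xi eta,
    ~ range mc_emb xi -> ~ range mc_emb eta ->
    (forall g, mc_kernel g xi = mc_kernel g eta) -> xi = eta;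
  mc_act : Gam -> mc_space -> mc_space;
  mc_act_continuous : forall g, continuous (mc_act g);
  mc_act1 : forall xi, mc_act 1%g xi = xi;
  mc_actM : forall g h xi, mc_act (g * h)%g xi = mc_act g (mc_act h xi);
  mc_act_emb : forall g h, mc_act g (mc_emb h) = mc_emb (g * h)%g
}.

Section MartinBoundary.
Context (R : realType) (Gam : groupType) (mu : Gam -> R).
Context (W : martin_compactification mu).

Definition boundary_set : set W := ~` range (@mc_emb _ _ _ W).

Definition boundary : topologicalType := set_type boundary_set.

Definition bd_val (xi : boundary) : W := set_val xi.

Lemma mc_act_boundary (g : Gam) (xi : boundary) :
  mc_act g (bd_val xi) \in boundary_set.
Proof.
apply/mem_set => -[h _ hE].
have /set_mem := valP xi; apply; exists (g^-1 * h)%g => //.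
by rewrite -mc_act_emb hE -mc_actM mulVg mc_act1.
Qed.

Definition bd_act (g : Gam) (xi : boundary) : boundary :=
  exist _ (mc_act g (bd_val xi)) (mc_act_boundary g xi).

Definition bd_kernel (g : Gam) (xi : boundary) : R := mc_kernel g (bd_val xi).

End MartinBoundary.

Definition extreme_points (R : numDomainType) (V : lmodType R) (S : set V) :
    set V :=
  [set v | S v /\ forall (x y : V) (t : R), S x -> S y -> 0 < t < 1 ->
    v = t *: x + (1 - t) *: y -> x = v /\ y = v].

Definition normalized_harmonic (R : realType) (Gam : groupType)
    (mu : Gam -> R) : set (Gam -> R^o) :=
  [set phi | [/\ forall g, 0 <= phi g, phi 1%g = 1 & forall g,
    \esum_(s in [set: Gam]) (mu s * phi (g * s)%g)%:E = (phi g)%:E]].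

Definition minimal_boundary (R : realType) (Gam : groupType) (mu : Gam -> R)
    (W : martin_compactification mu) : set (boundary W) :=
  [set xi | extreme_points (normalized_harmonic mu) (fun g => bd_kernel g xi)].

Definition borel (T : topologicalType) : set (set T) := <<s open >>.
Arguments borel {T}.

Definition mutually_independent (R : realType) (d : measure_display)
    (Om : measurableType d) (P : probability Om R) (T : Type)
    (s : nat -> Om -> T) : Prop :=
  forall (J : seq nat) (B : nat -> set T), uniq J ->
    P (\bigcap_(n in [set` J]) (s n @^-1` B n))
      = (\prod_(n <- J) P (s n @^-1` B n))%E.

Record iid_steps (R : realType) (Gam : groupType) (mu : Gam -> R)
    (d : measure_display) (Om : measurableType d) (P : probability Om R)
    (s : nat -> Om -> Gam) : Prop := {
  steps_measurable : forall n (B : set Gam), measurable (s n @^-1` B);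
  steps_distribution : forall n g, P (s n @^-1` [set g]) = (mu g)%:E;
  steps_independent : mutually_independent P s
}.

(* Only the values of [nu] on Borel sets matter. *)
Definition is_harmonic_measure (R : realType) (Gam : groupType)
    (mu : Gam -> R) (W : martin_compactification mu)
    (nu : set (boundary W) -> \bar R) : Prop :=
  exists (d : measure_display) (Om : measurableType d) (P : probability Om R)
    (s : nat -> Om -> Gam) (X : Om -> boundary W),
  [/\ iid_steps mu P s,
      forall B, borel B -> measurable (X @^-1` B),
      {ae P, forall w,
        (fun n => mc_emb W (\prod_(0 <= k < n) s k w)%g) @ \oo
          --> bd_val (X w)}
    & forall B, borel B -> nu B = P (X @^-1` B)].

Record is_word_metric (Gam : groupType) (S : seq Gam)
    (d : Gam -> Gam -> nat) : Prop := {
  wm_symmetric : forall x, x \in S -> (x^-1)%g \in S;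
  wm_generates : generates_as_semigroup [set` S];
  wm_attained : forall x y, exists s : seq Gam,
    [/\ size s = d x y, {subset s <= S} & (x^-1 * y = \prod_(z <- s) z)%g];
  wm_minimal : forall x y (s : seq Gam), {subset s <= S} ->
    (x^-1 * y = \prod_(z <- s) z)%g -> (d x y <= size s)%N
}.

Definition harnack (R : realType) (Gam : groupType) (mu : Gam -> R)
    (d : Gam -> Gam -> nat) (C : R) : Prop :=
  forall x y z, greenR mu x z / greenR mu y z <= C ^+ d x y.

Definition moment_condition (R : realType) (Gam : groupType) (mu : Gam -> R)
    (d : Gam -> Gam -> nat) (C : R) : Prop :=
  (\esum_(g in [set: Gam]) (mu g * C ^+ d g 1%g)%:E < +oo)%E.

(* Unital C*-algebras.  The multiplication is not inherited from [algType]
   because the hierarchy of the libraries admits no join of rings and normed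
   modules over a distinct field. *)

HB.mixin Record CompleteNormedModule_isCstarAlg (R : realType) A
    of CompleteNormedModule R[i] A := {
  cmul : A -> A -> A;
  cone : A;
  cstar : A -> A;
  cmulA : associative cmul;
  cmul1l : left_id cone cmul;
  cmul1r : right_id cone cmul;
  cmulDl : left_distributive cmul +%R;
  cmulDr : right_distributive cmul +%R;
  cmulZl : forall (z : R[i]) (a b : A), cmul (z *: a) b = z *: cmul a b;
  cmulZr : forall (z : R[i]) (a b : A), cmul a (z *: b) = z *: cmul a b;
  cstarK : involutive cstar;
  cstarD : forall a b : A, cstar (a + b) = cstar a + cstar b;
  cstarZ : forall (z : R[i]) (a : A), cstar (z *: a) = conjc z *: cstar a;
  cstarM : forall a b : A, cstar (cmul a b) = cmul (cstar b) (cstar a);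
  cnormM : forall a b : A, `|cmul a b| <= `|a| * `|b|;
  cnorm_star : forall a : A, `|cmul (cstar a) a| = `|a| ^+ 2
}.

#[short(type="cstarAlgType")]
HB.structure Definition CstarAlg (R : realType) :=
  {A of CompleteNormedModule R[i] A & CompleteNormedModule_isCstarAlg R A}.

Reserved Notation "a ** b" (at level 40, left associativity).
Notation "a ** b" := (cmul a b) : ring_scope.

Section L2.
Context (R : realType) (I : choiceType).

Definition l2norm (psi : I -> R[i]) : \bar R :=
  ((\esum_(i in [set: I])
     (complex.Re (psi i) ^+ 2 + complex.Im (psi i) ^+ 2)%:E) `^ 2^-1)%E.

Definition l2_opnorm (T : (I -> R[i]) -> I -> R[i]) : \bar R :=
  ereal_sup [set l2norm (T psi) | psi in [set psi | (l2norm psi <= 1)%E]].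

End L2.

Section CrossedProduct.
Context (R : realType) (Gam : groupType) (X : topologicalType).
Context (act : Gam -> X -> X).

(* The regular representation on l^2(Gam x X) of the finite sum of the
   f_i U_(g_i), induced from the faithful representation of C(X) on l^2(X) by
   multiplication: f acts by (f psi)(h, x) = f(h x) psi(h, x) and U_g by
   (U_g psi)(h, x) = psi(g^-1 h, x). *)
Definition cp_regular n (f : 'I_n -> X -> R[i]^o) (g : 'I_n -> Gam)
    (psi : Gam * X -> R[i]) (p : Gam * X) : R[i] :=
  \sum_(i < n) f i (act p.1 p.2) * psi (((g i)^-1 * p.1)%g, p.2).

Definition cp_sum (A : cstarAlgType R) (pi : (X -> R[i]^o) -> A)
    (U : Gam -> A) n (f : 'I_n -> X -> R[i]^o) (g : 'I_n -> Gam) : A :=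
  \sum_(i < n) pi (f i) ** U (g i).

(* [pi] is only meaningful on continuous functions. *)
Record reduced_crossed_product (A : cstarAlgType R)
    (pi : (X -> R[i]^o) -> A) (U : Gam -> A) : Prop := {
  cp_piD : forall f1 f2 : X -> R[i]^o, continuous f1 -> continuous f2 ->
    pi (fun x => f1 x + f2 x) = pi f1 + pi f2;
  cp_piZ : forall (z : R[i]) (f : X -> R[i]^o), continuous f ->
    pi (fun x => z * f x) = z *: pi f;
  cp_piM : forall f1 f2 : X -> R[i]^o, continuous f1 -> continuous f2 ->
    pi (fun x => f1 x * f2 x) = pi f1 ** pi f2;
  cp_pi1 : pi (fun=> 1) = cone;
  cp_pi_star : forall f : X -> R[i]^o, continuous f ->
    pi (fun x => conjc (f x)) = cstar (pi f);
  cp_U1 : U 1%g = cone;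
  cp_UM : forall g h, U (g * h)%g = U g ** U h;
  cp_U_star : forall g, cstar (U g) = U (g^-1)%g;
  cp_covariant : forall g (f : X -> R[i]^o), continuous f ->
    U g ** pi f ** cstar (U g) = pi (fun x => f (act (g^-1)%g x));
  cp_norm : forall n (f : 'I_n -> X -> R[i]^o) (g : 'I_n -> Gam),
    (forall i, continuous (f i)) ->
    (complex.Re `|cp_sum pi U f g|)%:E = l2_opnorm (cp_regular f g);
  cp_dense : dense [set a : A |
    exists n (f : 'I_n -> X -> R[i]^o) (g : 'I_n -> Gam),
      (forall i, continuous (f i)) /\ a = cp_sum pi U f g]
}.

End CrossedProduct.

Section ReducedGroup.
Context (R : realType) (Gam : groupType).

Definition group_regular n (c : 'I_n -> R[i]) (g : 'I_n -> Gam)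
    (psi : Gam -> R[i]) (h : Gam) : R[i] :=
  \sum_(i < n) c i * psi ((g i)^-1 * h)%g.

Record reduced_group_algebra (B : cstarAlgType R) (u : Gam -> B) : Prop := {
  rg_u1 : u 1%g = cone;
  rg_uM : forall g h, u (g * h)%g = u g ** u h;
  rg_u_star : forall g, cstar (u g) = u (g^-1)%g;
  rg_norm : forall n (c : 'I_n -> R[i]) (g : 'I_n -> Gam),
    (complex.Re `|\sum_(i < n) c i *: u (g i)|)%:E
      = l2_opnorm (group_regular c g);
  rg_dense : dense [set b : B | exists n (c : 'I_n -> R[i]) (g : 'I_n -> Gam),
    b = \sum_(i < n) c i *: u (g i)]
}.

End ReducedGroup.

Section States.
Context (R : realType) (A : cstarAlgType R).

Definition is_state (omega : A -> R[i]^o) : Prop :=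
  [/\ scalar omega, forall a, 0 <= omega (cstar a ** a) & omega cone = 1].

Definition tracial_states : set {ptws A -> R[i]^o} :=
  [set tau | is_state tau /\ forall a b, tau (a ** b) = tau (b ** a)].

Record is_flow (alpha : R -> A -> A) : Prop := {
  flow_linear : forall t, linear (alpha t);
  flowM : forall t a b, alpha t (a ** b) = alpha t a ** alpha t b;
  flow_star : forall t a, alpha t (cstar a) = cstar (alpha t a);
  flow0 : forall a, alpha 0 a = a;
  flowD : forall s t a, alpha (s + t) a = alpha s (alpha t a);
  flow_continuous : forall a, continuous (alpha ^~ a)
}.

(* [F] is the entire function z |-> alpha_z(a). *)
Definition analytic_extension (alpha : R -> A -> A) (a : A)
    (F : R[i]^o -> A) : Prop :=
  (forall t : R, F t%:C = alpha t a) /\ (forall z, derivable F z 1).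

Definition analytic (alpha : R -> A -> A) (a : A) : Prop :=
  exists F, analytic_extension alpha a F.

Definition kms_states (alpha : R -> A -> A) (beta : R) :
    set {ptws A -> R[i]^o} :=
  [set omega | is_state omega /\ forall a b F, analytic_extension alpha a F ->
    analytic alpha b -> omega (a ** b) = omega (b ** F (0 +i* beta))].

End States.

(* The topology of [{ptws A -> R[i]^o}] induces the weak* topology on sets of
   states. *)
Definition affine_homeomorphism (R : realType) (A B : cstarAlgType R)
    (S : set {ptws A -> R[i]^o}) (T : set {ptws B -> R[i]^o})
    (Phi : {ptws A -> R[i]^o} -> {ptws B -> R[i]^o}) : Prop :=
  [/\ set_bij S T Phi,
      forall (tau1 tau2 : A -> R[i]^o) (t : R), S tau1 -> S tau2 ->
        0 <= t <= 1 -> forall b,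
        Phi (fun a => t%:C * tau1 a + (1 - t)%:C * tau2 a) b
          = t%:C * Phi tau1 b + (1 - t)%:C * Phi tau2 b,
      {within S, continuous Phi}
    & exists Psi : {ptws B -> R[i]^o} -> {ptws A -> R[i]^o},
        (forall tau, S tau -> Psi (Phi tau) = tau)
        /\ {within T, continuous Psi}].

(* k^(-it) for k > 0 *)
Definition pow_Nit (R : realType) (k t : R) : R[i] :=
  cos (t * ln k) -i* sin (t * ln k).

Definition is_martin_flow (R : realType) (Gam : groupType) (mu : Gam -> R)
    (W : martin_compactification mu) (A : cstarAlgType R)
    (pi : (boundary W -> R[i]^o) -> A) (U : Gam -> A)
    (alpha : R -> A -> A) : Prop :=
  is_flow alpha /\
  forall (t : R) (f : boundary W -> R[i]^o) (g : Gam), continuous f ->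
    alpha t (pi f ** U g)
      = pi f ** U g ** pi (fun xi => pow_Nit (bd_kernel (g^-1)%g xi) t).

(* Main.v *)
(* Write K for the Martin kernel.  When the harmonic measure is carried by one
   point xi0, the walk converges to xi0 almost surely, and comparing K(g, .) with
   a bounded Green potential along the walk gives K(g, xi0) = 1 for all g; hence
   xi0 is fixed by the group.

   Let omega be a beta-KMS state.  The KMS condition for U_g and its adjoint reads
   omega(K(g, .)^beta) = 1 for all g.  If beta is not 0 or 1, strict convexity
   or concavity of k |-> k^beta and the mean value property of K(., xi)
   show that omega annihilates nonnegative functions whose only common zero is
   the point where K = 1, that is xi0; if beta = 1, minimality of xi0 says that
   the constant harmonic function 1 is extremal, so
   that omega((K(g, .) - 1)^2) = 0.  By compactness and Cauchy-Schwarz,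
   omega(f a) = f(xi0) omega(a).

   As xi0 is fixed, f U_g |-> f(xi0) U_g extends to a *-homomorphism phi onto the
   reduced group algebra (restrict the regular representation to the fibre over
   xi0), and U_g |-> U_g to a section iota of it.  Then tau |-> tau o phi and
   omega |-> omega o iota are inverse to each other.  The state tau o phi is KMS
   because phi is invariant under the flow: z |-> tau(phi(b F(z))), where
   F(z) is the analytic continuation of alpha_t(a), is entire
   and constant on the real line, hence constant. *)

From mathcomp Require Import all_boot all_order all_algebra.
From mathcomp Require Import all_classical reals topology normedtype.
Import numFieldNormedType.Exports.
Require Import Defs.
From HB Require Import structures.
From mathcomp Require Import all_classical all_reals all_analysis.
From mathcomp Require Import complex.
From mathcomp Require Import ring lra.

Import Order.TTheory GRing.Theory Num.Theory numFieldNormedType.Exports.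

Local Open Scope complex_scope.
Local Open Scope classical_set_scope.
Local Open Scope ring_scope.

Set Implicit Arguments.
Unset Strict Implicit.
Unset Printing Implicit Defensive.

(** * Entire functions vanishing on the real line *)

(** Analytic elements come with an entire extension but no growth bound, so invariance under the
    flow must be carried from the real line to [i beta] by uniqueness alone. The uniqueness theorem
    is built from complex differentiability at each point: Goursat's bisection gives primitives, and
    two primitives give the second derivatives that a maximum principle needs.

    A state is used on functions through finite sums and pointwise inequalities only; no measure
    represents it. The moment condition makes this possible. The Green function [G(., h)] satisfies
    the mean value equation off [h], and the Harnack bound dominates the terms outside a finite set
    of steps by a multiple of the kernel that does not depend on [h]. The equation therefore
    survives the passage of [h] to the boundary, with an error that is uniform there and can be put
    under the state.

    The value 1 of the kernel at [xi0] comes from a potential equal to 1 at both [e] and [g]: its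
    charge, weighted by the Green function, has total mass 1 seen from either point, and the two
    weights differ by the factor [K(g, .)], which is near [K(g, xi0)] where nearly all of the mass
    lies. *)

Section Primitive.
Variable R : realType.
Implicit Types (f : R -> R).

(** The endpoints are unordered because the line integrals below run in both directions. *)
Lemma MVT_sym f (df : R -> R) (a b : R) :
  (forall x : R, x \in `[Num.min a b, Num.max a b] -> is_derive x (1:R) f (df x)) ->
  exists2 c, c \in `[Num.min a b, Num.max a b] & f b - f a = df c * (b - a).
Proof.
wlog: a b / a <= b => [H|ab].
  case: (leP a b) => ab; [have := H a b ab | have := H b a (ltW ab)].
    by rewrite min_l// max_r//.
  rewrite min_l ?(ltW ab)// max_r ?(ltW ab)// => + h => /(_ h)[c cab E].
  by exists c => //; rewrite -opprB E -mulrN opprB.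
rewrite min_l//.
rewrite max_r//.
move=> df1.
have cf : {within `[a, b], continuous f}.
  apply: derivable_within_continuous => x xab.
  by have [] := df1 x xab.
have h x : x \in `]a, b[ -> is_derive x (1:R) f (df x).
  move=> xab; have : x \in `[a, b] by move: xab; rewrite !in_itv/= => /andP[/ltW-> /ltW->].
  exact: df1.
exact: (@MVT_segment R f df a b ab h cf).
Qed.

Lemma is_derive_unique_itv f (a b x y : R) :
  (forall x : R, x \in `]a, b[ -> is_derive x (1:R) f 0) ->
  x \in `]a, b[ -> y \in `]a, b[ -> f x = f y.
Proof.
rewrite !in_itv/= => h /andP[ax xb] /andP[ay yb].
have h' (z : R) : z \in `[Num.min x y, Num.max x y] -> is_derive z (1:R) f 0.
  rewrite in_itv/= => /andP[z1 z2]; have : z \in `]a, b[; last exact: h.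
  rewrite in_itv/= (lt_le_trans _ z1) ?lt_min ?ax ?ay//=.
  by rewrite (le_lt_trans z2)// gt_max xb yb.
have [c _] := MVT_sym h'.
by rewrite mul0r => /subr0_eq ->.
Qed.

Lemma continuous_primitive_itv f (n : R) : 0 < n -> continuous f ->
  exists P : R -> R, P 0 = 0 /\
    forall x : R, x \in `]- n, n[ -> is_derive x (1:R) P (f x).
Proof.
move=> n0 cf.
pose F (x : R) := (\int[@lebesgue_measure R]_(t in `[- n, x]) f t)%R.
have dF (x : R) : x \in `]- n, n[ -> is_derive x (1:R) F (f x).
  rewrite in_itv/= => /andP[nx xn].
  have fi : (@lebesgue_measure R).-integrable `[- n, n] (EFin \o f).
    apply: continuous_compact_integrable; first exact: segment_compact.
    by apply: continuous_subspaceT.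
  have [dF1 dF2] := @continuous_FTC1_closed R f (- n) x n xn fi nx (cf x).
  have dF' : 'D_(1:R) F x = f x by rewrite -derive1E; exact: dF2.
  exact: (DeriveDef dF1 dF').
exists (fun x => F x - F 0); split; first by rewrite subrr.
move=> x xn; have dFx := dF x xn.
have -> : (fun x => F x - F 0) = F - cst (F 0) by [].
have := is_deriveB dFx (is_derive_cst (F 0) x 1).
by rewrite subr0.
Qed.

(** The primitives on the intervals []-n, n[] all vanish at 0, so they agree on overlaps and
    glue. *)
Lemma continuous_primitive f : continuous f ->
  exists P : R -> R, forall x : R, is_derive x (1:R) P (f x).
Proof.
move=> cf.
have [G HG] := choice (fun k : nat => continuous_primitive_itv (ltr0Sn R k) cf).
have G_eq k m (x : R) : (k <= m)%N -> x \in `]- k.+1%:R, k.+1%:R[ -> G k x = G m x.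
  move=> km xk.
  have h (y : R) : y \in `]- k.+1%:R, k.+1%:R[ -> is_derive y (1:R) (G k - G m) 0.
    move=> yk; have ym : y \in `]- m.+1%:R, m.+1%:R[.
      move: yk; rewrite !in_itv/= => /andP[y1 y2].
      have : k.+1%:R <= m.+1%:R :> R by rewrite ler_nat.
      by move=> km'; apply/andP; split; lra.
    have := is_deriveB ((HG k).2 y yk) ((HG m).2 y ym).
    by rewrite subrr.
  have z : (0 : R) \in `]- k.+1%:R, k.+1%:R[.
    by rewrite in_itv/= oppr_lt0 ltr0Sn.
  have := is_derive_unique_itv h xk z.
  by rewrite !fctE (HG k).1 (HG m).1 subrr => /subr0_eq.
pose N (x : R) := Num.truncn `|x|.
have Nx (x : R) : `|x| < (N x).+1%:R by rewrite /N truncnS_gt.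
have inN k (x : R) : `|x| < k.+1%:R -> x \in `]- k.+1%:R, k.+1%:R[.
  by rewrite ltr_norml in_itv/=.
exists (fun x => G (N x) x) => x.
(* Close to [x] the index [N y] may exceed [N x], but by at most one; there the glued function
   coincides with [G (N x).+1]. *)
have HGx := (HG (N x).+1).2 x.
have xN1 : `|x| < (N x).+2%:R by rewrite (lt_trans (Nx x))// ltr_nat.
apply: near_eq_is_derive (HGx (inN _ _ xN1)).
have : \forall y \near x, `|y| < (N x).+2%:R.
  have /cvgr_lt := @norm_continuous _ R^o x.
  by apply.
apply: filterS => y yx.
apply/esym/G_eq; last exact: inN.
rewrite /N -ltnS.
have : (Num.truncn `|y|)%:R < (N x).+2%:R :> R.
  by rewrite (le_lt_trans _ yx)// truncn_le.
by rewrite ltr_nat.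
Qed.

(** The value [cst 0] at discontinuous functions only serves to make the choice total. *)
Definition prim f : R -> R :=
  match pselect (continuous f) with
  | left cf => projT1 (cid (continuous_primitive cf))
  | right _ => cst 0
  end.

Lemma primP f (x : R) : continuous f -> is_derive x (1:R) (prim f) (f x).
Proof.
by rewrite /prim => cf; case: pselect => // cf'; case: cid.
Qed.

(** A signed integral defined as the increment of a primitive, so that additivity in the endpoints
    holds without any hypothesis on [f]. *)
Definition rint f (a b : R) := prim f b - prim f a.

Lemma rint_eq f (P : R -> R) a b : continuous f ->
  (forall x : R, is_derive x (1:R) P (f x)) -> rint f a b = P b - P a.
Proof.
move=> cf dP.
have h (x : R) : is_derive x (1:R) (prim f - P) 0.
  by have := is_deriveB (primP x cf) (dP x); rewrite subrr.
have := is_derive_0_is_cst b a h; rewrite /rint !fctE => /eqP; lra.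
Qed.

Lemma rint_chasles f a b c : rint f a b + rint f b c = rint f a c.
Proof. by rewrite /rint; ring. Qed.

Lemma rintD f g a b : continuous f -> continuous g ->
  rint (fun x => f x + g x) a b = rint f a b + rint g a b.
Proof.
move=> cf cg.
have c (x : R) : is_derive x (1:R) (prim f + prim g) (f x + g x).
  exact: (is_deriveD (primP x cf) (primP x cg)).
rewrite (rint_eq _ _ _ c) ?/rint ?fctE; first ring.
by move=> x; apply: continuousD; [exact: cf|exact: cg].
Qed.

Lemma rint_bound f a b (M : R) : continuous f ->
  (forall x : R, x \in `[Num.min a b, Num.max a b] -> `|f x| <= M) ->
  `|rint f a b| <= M * `|b - a|.
Proof.
move=> cf fM.
have h (x : R) : x \in `[Num.min a b, Num.max a b] ->
    is_derive x (1:R) (prim f) (f x) by move=> _; exact: primP.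
rewrite /rint; have [c cab ->] := MVT_sym h.
by rewrite normrM ler_wpM2r// fM.
Qed.

End Primitive.

(** * Integrals along segments of the complex plane *)

Section ComplexLine.
Variable R : realType.
Local Notation C := R[i].
Local Notation Re := complex.Re.
Local Notation Im := complex.Im.
Local Notation normc := ComplexField.Normc.normc.
Implicit Types (z w : C).

Lemma normc_ge0 z : 0 <= normc z.
Proof. by case: z => a b; rewrite /= sqrtr_ge0. Qed.

Lemma normc_Re z : `|Re z| <= normc z.
Proof.
by case: z => a b /=; rewrite -sqrtr_sqr ler_wsqrtr// lerDl sqr_ge0.
Qed.

Lemma normc_Im z : `|Im z| <= normc z.
Proof.
by case: z => a b /=; rewrite -sqrtr_sqr ler_wsqrtr// lerDr sqr_ge0.
Qed.

Lemma normc_le_ReIm z : normc z <= `|Re z| + `|Im z|.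
Proof.
case: z => a b /=; rewrite -[leRHS]ger0_norm ?addr_ge0// -sqrtr_sqr.
rewrite ler_wsqrtr// sqrrD !real_normK ?num_real//.
by rewrite lerD2r lerDl mulrn_wge0// mulr_ge0.
Qed.

Lemma ler_normcD z w : normc (z + w) <= normc z + normc w.
Proof. exact: le_normcD. Qed.

Lemma normcR (x : R) : normc x%:C = `|x|.
Proof. by rewrite /= expr0n addr0 sqrtr_sqr. Qed.

Lemma normC_normc z : `|z| = (normc z)%:C.
Proof. by case: z. Qed.

(** Quotient-free form of the complex derivative with real epsilon and delta; [w = z] needs no
    separate treatment. *)
Definition cdiff (f : C -> C) z l := forall e : R, 0 < e ->
  exists2 d : R, 0 < d & forall w, normc (w - z) < d ->
    normc (f w - f z - l * (w - z)) <= e * normc (w - z).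

Definition ccont (f : C -> C) z := forall e : R, 0 < e ->
  exists2 d : R, 0 < d & forall w, normc (w - z) < d -> normc (f w - f z) < e.

Lemma cdiff_cont f z l : cdiff f z l -> ccont f z.
Proof.
move=> df e e0; have [d d0 H] := df 1 ltr01.
have n0 : 0 < normc l + 1 by rewrite ltr_wpDl ?normc_ge0.
exists (Num.min d (e / (normc l + 1))); first by rewrite lt_min d0 divr_gt0.
move=> w; rewrite lt_min => /andP[wd we].
have -> : f w - f z = (f w - f z - l * (w - z)) + l * (w - z) by ring.
rewrite (le_lt_trans (ler_normcD _ _))// ComplexField.Normc.normcM.
rewrite (@le_lt_trans _ _ ((normc l + 1) * normc (w - z)))//.
  by have := H w wd; lra.
by rewrite mulrC -ltr_pdivlMr.
Qed.

Definition linec (a b : C) (t : R) : C := a + b * t%:C.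

Lemma ccont_line f a b : (forall z, ccont f z) ->
  continuous (fun t => Re (f (linec a b t))) /\
  continuous (fun t => Im (f (linec a b t))).
Proof.
move=> cf.
have H (t e : R) : 0 < e -> exists2 d : R, 0 < d &
    forall s : R, `|s - t| < d -> normc (f (linec a b s) - f (linec a b t)) < e.
  move=> e0; have [d d0 h] := cf (linec a b t) e e0.
  have n0 : 0 < normc b + 1 by rewrite ltr_wpDl ?normc_ge0.
  exists (d / (normc b + 1)); first by rewrite divr_gt0.
  move=> s; rewrite ltr_pdivlMr// => st; apply: h.
  have -> : linec a b s - linec a b t = b * (s - t)%:C.
    by rewrite /linec rmorphB/=; ring.
  by rewrite ComplexField.Normc.normcM normcR (le_lt_trans _ st)// mulrC ler_wpM2l// lerDl.
split=> t; apply/cvgrPdist_lt => e e0; have [d d0 h] := H t e e0.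
  have nb : \forall s \near t, `|s - t| < d.
    by apply/nbhs_ballP; exists d => // s /=; rewrite /ball/= distrC.
  apply: filterS nb => s /h sd.
  by rewrite distrC -raddfB (le_lt_trans (normc_Re _)).
have nb : \forall s \near t, `|s - t| < d.
  by apply/nbhs_ballP; exists d => // s /=; rewrite /ball/= distrC.
apply: filterS nb => s /h sd.
by rewrite distrC -raddfB (le_lt_trans (normc_Im _)).
Qed.

Definition cint (F : R -> C) (a b : R) : C :=
  rint (fun t => Re (F t)) a b +i* rint (fun t => Im (F t)) a b.

Definition lcont (F : R -> C) :=
  continuous (fun t => Re (F t)) /\ continuous (fun t => Im (F t)).

Lemma cint_chasles F a b c : cint F a b + cint F b c = cint F a c.
Proof. by apply/eqP; rewrite eq_complex /= !rint_chasles !eqxx. Qed.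

Lemma cintxx F a : cint F a a = 0.
Proof. by apply/eqP; rewrite eq_complex /= /rint !subrr !eqxx. Qed.

Lemma cint_sym F a b : cint F a b = - cint F b a.
Proof. by apply/eqP; rewrite -subr_eq0 opprK cint_chasles cintxx. Qed.

Lemma cintD F G a b : lcont F -> lcont G ->
  cint (fun t => F t + G t) a b = cint F a b + cint G a b.
Proof.
move=> [F1 F2] [G1 G2]; apply/eqP; rewrite eq_complex /=.
rewrite -!rintD//; apply/andP; split; apply/eqP; congr (rint _ a b);
  by apply/funext => t; rewrite raddfD.
Qed.

Lemma cint_bound F a b (M : R) : lcont F ->
  (forall x : R, x \in `[Num.min a b, Num.max a b] -> normc (F x) <= M) ->
  normc (cint F a b) <= 2 * M * `|b - a|.
Proof.
move=> [F1 F2] FM; rewrite (le_trans (normc_le_ReIm _))//=.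
rewrite -mulrA mulr_natl mulr2n lerD// rint_bound// => x /FM.
  exact/le_trans/normc_Re.
exact/le_trans/normc_Im.
Qed.

Lemma continuous_affine (u v : R) : continuous (fun t : R => u + v * t).
Proof.
move=> t; apply: continuousD; first exact: cst_continuous.
by apply: continuousM; [exact: cst_continuous|exact: cvg_id].
Qed.

Lemma rint_affine (u v a b : R) :
  rint (fun t => u + v * t) a b = u * (b - a) + v * (b ^+ 2 - a ^+ 2) / 2.
Proof.
have c (x : R) : is_derive x (1:R) (u *: id + (v / 2) *: (id ^+ 2)) (u + v * x).
  have := is_deriveD (is_deriveZ u (is_derive_id x 1))
    (is_deriveZ (v / 2) (is_deriveX 2 (is_derive_id x (1:R)))).
  move/is_derive_eq => H; apply: H.
  by rewrite /GRing.scale/= /GRing.scale/=; field.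
rewrite (rint_eq _ _ _ c).
  by rewrite !fctE /GRing.scale/=; field.
exact: continuous_affine.
Qed.

Lemma cint_affine (u v : C) a b :
  cint (fun t => u + v * t%:C) a b =
  u * (b - a)%:C + v * (b ^+ 2 - a ^+ 2)%:C / 2.
Proof.
have E : 2^-1 = (2^-1 : R)%:C :> C by rewrite fmorphV rmorph_nat.
rewrite E; case: u v => u1 u2 [v1 v2].
apply/eqP; rewrite eq_complex; apply/andP; split; apply/eqP => /=.
  under [X in rint X]eq_fun do rewrite mulr0 subr0.
  by rewrite rint_affine; field.
under [X in rint X]eq_fun do rewrite mulr0 add0r.
by rewrite rint_affine; field.
Qed.
End ComplexLine.

(** * Goursat's theorem for rectangles *)

Section Goursat.
Variable R : realType.
Local Notation C := R[i].
Local Notation Re := complex.Re.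
Local Notation Im := complex.Im.
Local Notation normc := ComplexField.Normc.normc.
Implicit Types (f : C -> C).

Definition hseg f (y a b : R) := cint (fun t => f (linec (0 +i* y) 1 t)) a b.
(** On a vertical side [dz] is [i dt]; the factor [i] is left out here and supplied by [circ]. *)
Definition vseg f (x c d : R) := cint (fun t => f (linec (x%:C) 'i t)) c d.
Definition circ f (a b c d : R) : C :=
  hseg f c a b + 'i * vseg f b c d - hseg f d a b - 'i * vseg f a c d.

Lemma linecH (y t : R) : linec (0 +i* y) 1 t = t +i* y.
Proof. by apply/eqP; rewrite /linec eq_complex /=; apply/andP; split; apply/eqP; ring. Qed.

Lemma linecV (x t : R) : linec (x%:C) 'i t = x +i* t.
Proof.
by apply/eqP; rewrite /linec eq_complex /=; apply/andP; split; apply/eqP; ring.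
Qed.

Lemma circ_split f (a m b c e d : R) :
  circ f a b c d = circ f a m c e + circ f m b c e + circ f a m e d
                   + circ f m b e d.
Proof.
rewrite /circ /hseg /vseg.
rewrite -(cint_chasles _ a m b) -(cint_chasles _ c e d).
rewrite -(cint_chasles _ a m b) -(cint_chasles (fun t => f (linec a%:C _ t)) c e d).
ring.
Qed.

Lemma circD f g (a b c d : R) : (forall z, ccont f z) -> (forall z, ccont g z) ->
  circ (fun z => f z + g z) a b c d = circ f a b c d + circ g a b c d.
Proof.
move=> cf cg; rewrite /circ /hseg /vseg !cintD; first ring;
  by [exact: ccont_line cf|exact: ccont_line cg].
Qed.

(** In Goursat's argument the tangent at the limit point is affine, and this removes it from the
    boundary integral. *)
Lemma circ_affine (A B : C) (a b c d : R) :
  circ (fun z => A + B * z) a b c d = 0.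
Proof.
have i2 : 'i * 'i = -1 :> C by rewrite -expr2 sqr_i.
have H y p q : hseg (fun z => A + B * z) y p q =
    (A + B * (0 +i* y)) * (q - p)%:C + B * (q ^+ 2 - p ^+ 2)%:C / 2.
  rewrite /hseg -cint_affine; congr (cint _ p q).
  by apply/funext => t; rewrite /linec; ring.
have V x p q : vseg (fun z => A + B * z) x p q =
    (A + B * x%:C) * (q - p)%:C + (B * 'i) * (q ^+ 2 - p ^+ 2)%:C / 2.
  rewrite /vseg -cint_affine; congr (cint _ p q).
  by apply/funext => t; rewrite /linec; ring.
have yE (y : R) : 0 +i* y = 'i * y%:C.
  by apply/eqP; rewrite eq_complex /=; apply/andP; split; apply/eqP; ring.
rewrite /circ !H !V !yE !rmorphB /= !rmorphXn /=.
set s := 'i in i2 *.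
have -> : forall p q : C, B * s * (p - q) / 2 = B * (p - q) / 2 * s.
  by move=> p q; field.
rewrite !mulrDr ![s * (_ / 2 * s)]mulrC -!mulrA i2.
by field.
Qed.

Lemma linec_cont_sub f : (forall z, ccont f z) -> forall a b,
  lcont (fun t => f (linec a b t)).
Proof. by move=> cf a b; exact: ccont_line. Qed.

(** The 4 is the 2 of [cint_bound] times the two sides in each direction. *)
Lemma circ_bound f (a c p q M : R) : (forall z, ccont f z) -> 0 <= p -> 0 <= q ->
  (forall x y : R, a <= x <= a + p -> c <= y <= c + q -> normc (f (x +i* y)) <= M) ->
  normc (circ f a (a + p) c (c + q)) <= 4 * M * (p + q).
Proof.
move=> cf p0 q0 fM.
have ap : a <= a + p by rewrite lerDl.
have cq : c <= c + q by rewrite lerDl.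
have H y : c <= y <= c + q -> normc (hseg f y a (a + p)) <= 2 * M * p.
  move=> yc; rewrite (le_trans (cint_bound (linec_cont_sub cf _ _) (M := M) _))//.
    move=> x; rewrite min_l// max_r// in_itv/= => xa.
    by rewrite linecH fM.
  by rewrite addrAC subrr add0r (ger0_norm p0).
have V x : a <= x <= a + p -> normc (vseg f x c (c + q)) <= 2 * M * q.
  move=> xa; rewrite (le_trans (cint_bound (linec_cont_sub cf _ _) (M := M) _))//.
    move=> y; rewrite min_l// max_r// in_itv/= => yc.
    by rewrite linecV fM.
  by rewrite addrAC subrr add0r (ger0_norm q0).
have ni (z : C) : normc ('i * z) = normc z.
  by rewrite ComplexField.Normc.normcM /= expr0n expr1n add0r sqrtr1 mul1r.
have tri (z w : C) : normc (z - w) <= normc z + normc w.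
  by rewrite (le_trans (ler_normcD _ _))// normcN.
rewrite /circ.
have h1 := H c; have h2 := H (c + q); have h3 := V a; have h4 := V (a + p).
rewrite lexx cq in h1; rewrite lexx cq in h2; rewrite lexx ap in h3.
rewrite lexx ap in h4.
have {}h1 := h1 isT; have {}h2 := h2 isT; have {}h3 := h3 isT; have {}h4 := h4 isT.
have t1 := tri (hseg f c a (a + p) + 'i * vseg f (a + p) c (c + q) -
   hseg f (c + q) a (a + p)) ('i * vseg f a c (c + q)).
have t2 := tri (hseg f c a (a + p) + 'i * vseg f (a + p) c (c + q))
  (hseg f (c + q) a (a + p)).
have t3 := ler_normcD (hseg f c a (a + p)) ('i * vseg f (a + p) c (c + q)).
rewrite !ni in t1 t3.
lra.
Qed.

Section Bisection.
Variable f : C -> C.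

(** A corner and two side lengths: bisection then divides the lengths by exactly 2. *)
Record rect := Rect { rx : R ; ry : R ; rp : R ; rq : R }.
Definition rcirc r := circ f (rx r) (rx r + rp r) (ry r) (ry r + rq r).
Definition quarter r r' := [/\ rp r' = rp r / 2, rq r' = rq r / 2,
  rx r' = rx r \/ rx r' = rx r + rp r / 2 &
  ry r' = ry r \/ ry r' = ry r + rq r / 2].

Lemma quarter_ex r : exists r', quarter r r' /\
  normc (rcirc r) <= 4 * normc (rcirc r').
Proof.
pose x := rx r; pose y := ry r; pose p := rp r / 2; pose q := rq r / 2.
pose r1 := Rect x y p q; pose r2 := Rect (x + p) y p q.
pose r3 := Rect x (y + q) p q; pose r4 := Rect (x + p) (y + q) p q.
have E : rcirc r = rcirc r1 + rcirc r2 + rcirc r3 + rcirc r4.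
  rewrite /rcirc (circ_split _ _ (x + p) _ _ (y + q)) /=.
  have -> : rx r + rp r = x + p + p by rewrite /x /p; field.
  by have -> : ry r + rq r = y + q + q by rewrite /y /q; field.
have := ler_normcD (rcirc r1 + rcirc r2 + rcirc r3) (rcirc r4).
have := ler_normcD (rcirc r1 + rcirc r2) (rcirc r3).
have := ler_normcD (rcirc r1) (rcirc r2).
rewrite -E => t1 t2 t3.
have [h1|h1] := lerP (normc (rcirc r)) (4 * normc (rcirc r1)).
  by exists r1; split => //; split => //=; left.
have [h2|h2] := lerP (normc (rcirc r)) (4 * normc (rcirc r2)).
  by exists r2; split => //; split => //=; [right|left].
have [h3|h3] := lerP (normc (rcirc r)) (4 * normc (rcirc r3)).
  by exists r3; split => //; split => //=; [left|right].
exists r4; split; first by split => //=; right.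
lra.
Qed.

(** Repeated quartering loses at most a factor 4 per stage in the boundary integral. At the common
    point of the chosen quarters, what remains after removing the tangent is small compared with the
    squared diameter, which also shrinks by 4. *)
Lemma goursat_pos (r : rect) : (forall z, exists l, cdiff f z l) ->
  0 <= rp r -> 0 <= rq r -> rcirc r = 0.
Proof.
move=> df p0 q0.
have cf z : ccont f z by have [l] := df z; exact: cdiff_cont.
have [next nextP] := choice quarter_ex.
pose s n := iter n next r.
have sS n : quarter (s n) (s n.+1) by have [] := nextP (s n).
have sp n : rp (s n) = rp r / 2 ^+ n.
  elim: n => [|n IH]; first by rewrite expr0 divr1.
  by have [-> _ _ _] := sS n; rewrite IH exprSr invfM mulrA.
have sq n : rq (s n) = rq r / 2 ^+ n.
  elim: n => [|n IH]; first by rewrite expr0 divr1.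
  by have [_ -> _ _] := sS n; rewrite IH exprSr invfM mulrA.
have sp0 n : 0 <= rp (s n) by rewrite sp divr_ge0// exprn_ge0.
have sq0 n : 0 <= rq (s n) by rewrite sq divr_ge0// exprn_ge0.
have sI n : normc (rcirc r) <= 4 ^+ n * normc (rcirc (s n)).
  elim: n => [|n IH]; first by rewrite expr0 mul1r.
  rewrite (le_trans IH)// exprSr -mulrA ler_wpM2l// ?exprn_ge0//.
  by have [] := nextP (s n).
have mx m n : (m <= n)%N -> rx (s m) <= rx (s n) /\
    rx (s n) + rp (s n) <= rx (s m) + rp (s m).
  elim: n => [|n IH]; first by rewrite leqn0 => /eqP ->.
  rewrite leq_eqVlt => /predU1P[-> //|]; rewrite ltnS => /IH[h1 h2].
  have [hp _ hx _] := sS n; have := sp0 n; case: hx => ->; rewrite hp; lra.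
have my m n : (m <= n)%N -> ry (s m) <= ry (s n) /\
    ry (s n) + rq (s n) <= ry (s m) + rq (s m).
  elim: n => [|n IH]; first by rewrite leqn0 => /eqP ->.
  rewrite leq_eqVlt => /predU1P[-> //|]; rewrite ltnS => /IH[h1 h2].
  have [_ hq _ hy] := sS n; have := sq0 n; case: hy => ->; rewrite hq; lra.
(* Nested intervals: the supremum of the left ends lies in all of them. *)
have nest (u v : nat -> R) : (forall m n, (m <= n)%N -> u m <= u n /\ v n <= v m) ->
    (forall n, u n <= v n) -> exists x, forall n, u n <= x <= v n.
  move=> huv le_uv.
  have uv m n : u m <= v n.
    rewrite (le_trans (huv m (maxn m n) (leq_maxl _ _)).1)//.
    by rewrite (le_trans (le_uv _))// (huv n (maxn m n) (leq_maxr _ _)).2.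
  exists (sup (range u)) => n; apply/andP; split.
    apply: ub_le_sup; last by exists n.
    by exists (v 0) => _ [m _ <-].
  by apply: sup_le_ub => [|_ [m _ <-]//]; exists (u 0); exists 0%N.
have [||x hx] := nest (fun n => rx (s n)) (fun n => rx (s n) + rp (s n)).
  exact: mx. by move=> n; rewrite lerDl.
have [||y hy] := nest (fun n => ry (s n)) (fun n => ry (s n) + rq (s n)).
  exact: my. by move=> n; rewrite lerDl.
have [l dl] := df (x +i* y).
pose L := rp r + rq r.
have L0 : 0 <= L by rewrite addr_ge0.
(* At stage [n] the integrand is at most [e L / 2^n] and the sides add up to [L / 2^n]; the factor
   [4^n] of the bisection cancels exactly. *)
have key e : 0 < e -> normc (rcirc r) <= 4 * e * L ^+ 2.
  move=> e0; have [d d0 H] := dl e e0.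
  have [n Ln] : exists n, L / 2 ^+ n < d.
    have [N] : exists N : nat, L / d < N%:R.
      by exists (Num.truncn (L / d)).+1; rewrite truncnS_gt.
    rewrite ltr_pdivrMr// => hN; exists N; rewrite ltr_pdivrMr ?exprn_gt0//.
    rewrite (lt_le_trans hN)// mulrC ler_pM2l// -natrX ler_nat.
    exact/ltnW/ltn_expl.
  pose E z := f z - f (x +i* y) - l * (z - (x +i* y)).
  have aff_cont (A B : C) z : ccont (fun z => A + B * z) z.
    apply: (@cdiff_cont _ _ _ B) => e' e'0; exists 1 => // w _.
    rewrite (_ : A + B * w - (A + B * z) - B * (w - z) = 0); last ring.
    by rewrite ComplexField.Normc.normc0 mulr_ge0 ?normc_ge0// ltW.
  have E_cont z : ccont E z.
    have [l' dl'] := df z.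
    apply: (@cdiff_cont _ _ _ (l' - l)) => e' e'0.
    have [d' d'0 H'] := dl' e' e'0; exists d' => // w /H'.
    rewrite /E; congr (normc _ <= _); ring.
  have EI : rcirc (s n) =
      circ E (rx (s n)) (rx (s n) + rp (s n)) (ry (s n)) (ry (s n) + rq (s n)).
    rewrite /rcirc -[RHS]addr0.
    rewrite -(circ_affine (f (x +i* y) - l * (x +i* y)) l (rx (s n))
      (rx (s n) + rp (s n)) (ry (s n)) (ry (s n) + rq (s n))) -circD//.
    suff -> : (fun z => E z + (f (x +i* y) - l * (x +i* y) + l * z)) = f by [].
    by apply/funext => z; rewrite /E; move: (x +i* y) => w0; ring.
  have Lsn : rp (s n) + rq (s n) = L / 2 ^+ n by rewrite sp sq /L mulrDl.
  have := sI n; rewrite EI => h; rewrite (le_trans h)//.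
  have Eb : normc (circ E (rx (s n)) (rx (s n) + rp (s n)) (ry (s n))
      (ry (s n) + rq (s n))) <= 4 * (e * (L / 2 ^+ n)) * (L / 2 ^+ n).
    rewrite -[X in _ <= _ * X]Lsn; apply: circ_bound => // x' y' hx' hy'.
    have nw : normc (x' +i* y' - (x +i* y)) <= L / 2 ^+ n.
      rewrite (le_trans (normc_le_ReIm _))//= -Lsn.
      move/andP: hx' => [? ?]; move/andP: hy' => [? ?].
      have /andP[? ?] := hx n; have /andP[? ?] := hy n.
      by rewrite lerD// ler_norml; apply/andP; split; lra.
    have := H (x' +i* y') (le_lt_trans nw Ln).
    by move/le_trans; apply; rewrite ler_pM2l.
  rewrite (le_trans (ler_wpM2l _ Eb)) ?exprn_ge0// le_eqVlt; apply/orP; left.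
  have -> : (4 : R) ^+ n = 2 ^+ n * 2 ^+ n by rewrite -exprMn; congr (_ ^+ n); ring.
  apply/eqP; have : (2 : R) ^+ n != 0 by rewrite expf_neq0.
  by move: (_ ^+ n) => k k0; field.
apply: ComplexField.Normc.eq0_normc; apply/eqP; rewrite eq_le normc_ge0 andbT.
apply/ler_addgt0Pl => e e0; rewrite addr0.
have L1 : 0 < 4 * (L ^+ 2 + 1) by rewrite mulr_gt0// ltr_wpDl ?sqr_ge0.
have := key (e / (4 * (L ^+ 2 + 1))) (divr_gt0 e0 L1).
move/le_trans; apply.
rewrite [X in X <= _](_ : _ = e * (4 * L ^+ 2 / (4 * (L ^+ 2 + 1)))); last first.
  by field; rewrite gt_eqF// ltr_wpDl ?sqr_ge0.
rewrite ger_pMr// ler_pdivrMr// mul1r ler_pM2l// lerDl//.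
Qed.

Lemma goursat a b c d : (forall z, exists l, cdiff f z l) -> circ f a b c d = 0.
Proof.
move=> df.
have pos a' b' c' d' : a' <= b' -> c' <= d' -> circ f a' b' c' d' = 0.
  move=> ab cd.
  have := @goursat_pos (Rect a' c' (b' - a') (d' - c')) df.
  by rewrite /rcirc /= !subr_ge0 !(addrC _ (_ - _)) !subrK; apply.
have sx a' b' c' d' : circ f a' b' c' d' = - circ f b' a' c' d'.
  by rewrite /circ /hseg (cint_sym _ a' b') (cint_sym _ a' b'); ring.
have sy a' b' c' d' : circ f a' b' c' d' = - circ f a' b' d' c'.
  by rewrite /circ /vseg (cint_sym _ c' d') (cint_sym _ c' d'); ring.
have [ab|/ltW ab] := leP a b; have [cd|/ltW cd] := leP c d.
- exact: pos.
- by rewrite sy pos// oppr0.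
- by rewrite sx pos// oppr0.
- by rewrite sx sy pos// !oppr0.
Qed.

End Bisection.
End Goursat.

(** * Real-valued norms and vector-valued derivatives *)

Section RealNorm.
Variable R : realType.

(** The norm of a module over [R[i]] is an element of [R[i]]; this is the same number in [R], where
    the order is total. *)
Definition nrm (V : normedModType R[i]) (v : V) : R := complex.Re `|v|.

Lemma nrmE (V : normedModType R[i]) (v : V) : `|v| = (nrm v)%:C.
Proof. by rewrite /nrm RRe_real. Qed.

Lemma cvg_nrm (V : normedModType R[i]) (T : Type) (F : set_system T)
    {FF : Filter F} (f : T -> V) (l : V) :
  f @ F --> l <-> forall e : R, 0 < e -> \forall x \near F, nrm (l - f x) <= e.
Proof.
split=> [|H]; last first.
  apply/cvgrPdist_le => e e0.
  have er : e = (complex.Re e)%:C by rewrite RRe_real ?gtr0_real.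
  move: e0; rewrite er (ltcR 0) => /H; apply: filterS => x.
  by rewrite nrmE lecR.
move/cvgrPdist_le => H e e0.
have eC : 0 < e%:C :> R[i] by rewrite (ltcR 0).
by apply: filterS (H _ eC) => x; rewrite nrmE lecR.
Qed.

End RealNorm.

Section VectorDerivative.
Variables (R : realType) (V : normedModType R[i]).
Local Notation normc := ComplexField.Normc.normc.
Implicit Types (F : R[i]^o -> V) (z : R[i]) (l : V).

Definition vdiff F z l := forall e : R, 0 < e ->
  exists2 d : R, 0 < d & forall w : R[i], normc (w - z) < d ->
    nrm (F w - F z - (w - z) *: l) <= e * normc (w - z).

Lemma normc_gt0 z : z != 0 -> 0 < normc z.
Proof.
move=> z0; rewrite lt_def normc_ge0 andbT; apply: contra_neq z0.
exact: ComplexField.Normc.eq0_normc.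
Qed.

(** The scalars of the increment are complex, so the derivative in the direction 1 is the full
    complex derivative. *)
Lemma vdiff_is_derive F z l :
  vdiff F z l <-> is_derive (z : R[i]^o) (1 : R[i]^o) F l.
Proof.
pose q (h : R[i]^o) : V := h^-1 *: ((F \o shift z) (h *: (1 : R[i]^o)) - F z).
have quo (w : R[i]) : w != 0 -> forall e : R, (nrm (l - q w) <= e) =
    (nrm (F (w + z) - F z - (w + z - z) *: l) <= e * normc (w + z - z)).
  move=> w0 e; rewrite addrK.
  have -> : q w = w^-1 *: (F (w + z) - F z) by rewrite /q /= /GRing.scale/= mulr1.
  rewrite -(ler_pM2r (x := normc w)) ?normc_gt0//; congr (_ <= _).
  rewrite /nrm -normrN opprB -[RHS]/(complex.Re _).
  have -> : F (w + z) - F z - w *: l = w *: (w^-1 *: (F (w + z) - F z) - l).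
    by rewrite scalerBr scalerA mulfV// scale1r.
  by rewrite normrZ normC_normc nrmE -rmorphM mulrC.

split=> [H|[h1 h2]].
  have cvg : q @ 0^' --> l.
    apply/cvg_nrm => er e0; have [d d0 {}H] := H er e0.
    have nb : \forall w \near (0 : R[i]^o)^', w != 0 /\ `|w| < d%:C.
      have dC : 0 < d%:C :> R[i] by rewrite (ltcR 0).
      exists d%:C => // w /=; rewrite sub0r normrN => wd w0; split => //.
    apply: filterS nb => w [w0 wd].
    rewrite (quo _ w0).
    by apply: H; rewrite addrK -ltcR -normC_normc.
  apply: DeriveDef; first by apply/cvg_ex; exists l.
  exact: cvg_lim.
move=> e e0.
have cvg : q @ 0^' --> l by rewrite -h2.
move/cvg_nrm : cvg => /(_ _ e0)[d /= d0 H].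
have [dr dreq] : exists dr : R, d = dr%:C.
  by exists (complex.Re d); rewrite RRe_real ?gtr0_real.
exists dr; first by rewrite -ltcR -dreq.
move=> w wd; have [->|wz] := eqVneq w z.
  by rewrite !subrr scale0r subrr /nrm normr0 ComplexField.Normc.normc0 mulr0.
have wz0 : w - z != 0 by rewrite subr_eq0.
have := quo _ wz0 e; rewrite subrK => <-.
have := H (w - z); rewrite /ball_/= sub0r normrN normC_normc dreq ltcR.
by move=> /(_ wd wz0).
Qed.

Lemma vdiff_derivable F z :
  derivable F (z : R[i]^o) (1 : R[i]^o) <-> exists l, vdiff F z l.
Proof.
split=> [h|[l /vdiff_is_derive[]]//]; exists ('D_(1 : R[i]^o) F (z : R[i]^o)).
by apply/vdiff_is_derive; exact: DeriveDef.
Qed.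

End VectorDerivative.

(** * Primitives of entire functions *)

Section EntirePrimitive.
Variable R : realType.
Local Notation C := R[i].
Local Notation Re := complex.Re.
Local Notation Im := complex.Im.
Local Notation normc := ComplexField.Normc.normc.
Implicit Types (f : C -> C).

(** The integral along the path that leaves 0 on the real axis and then rises vertically to [z]; on
    the real line it only sees the values of [f] there. *)
Definition cprim f (z : C) : C :=
  hseg f 0 0 (Re z) + 'i * vseg f (Re z) 0 (Im z).

Lemma cprim_real f (t : R) : cprim f t%:C = cint (fun s => f s%:C) 0 t.
Proof.
rewrite /cprim /= /vseg cintxx mulr0 addr0 /hseg.
suff -> : (fun s : R => f (linec (0 +i* 0) 1 s)) = (fun s => f s%:C) by [].
by apply/funext => s; rewrite linecH complexr0.
Qed.

Lemma cprim_diff f : (forall z, exists l, cdiff f z l) ->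
  forall z, cdiff (cprim f) z (f z).
Proof.
move=> df z.
have cf w : ccont f w by have [l] := df w; exact: cdiff_cont.
(* The quarter absorbs the 2 of [cint_bound] and the two sides of the path from [z] to [w]. *)
move=> e e0; have e40 : 0 < e / 4 by rewrite divr_gt0.
have [d d0 H] := cf z _ e40; exists (d / 2); first by rewrite divr_gt0.
move=> w wd.
pose x := Re z; pose y := Im z; pose x' := Re w; pose y' := Im w.
have dx : `|x' - x| <= normc (w - z) by rewrite /x' /x -raddfB normc_Re.
have dy : `|y' - y| <= normc (w - z) by rewrite /y' /y -raddfB normc_Im.
have := goursat x x' 0 y df; rewrite /circ => G.
(* Goursat lifts the horizontal piece from the real axis to the height of [z], so the increment
   becomes an integral over a short path from [z] to [w]. *)
have E : cprim f w - cprim f z = hseg f y x x' + 'i * vseg f x' y y'.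
  rewrite /cprim -/x -/y -/x' -/y'.
  rewrite [hseg f 0 0 x'](_ : _ = hseg f 0 0 x + hseg f 0 x x'); last first.
    by rewrite /hseg cint_chasles.
  rewrite [vseg f x' 0 y'](_ : _ = vseg f x' 0 y + vseg f x' y y'); last first.
    by rewrite /vseg cint_chasles.
  apply/eqP; rewrite -subr_eq0 -[X in _ == X]G; apply/eqP; ring.
pose g u := f u - f z.
have cg u : ccont g u.
  have [l dl] := df u; apply: (@cdiff_cont _ _ _ l) => e' e'0.
  have [d' d'0 H'] := dl e' e'0; exists d' => // v /H'.
  by rewrite /g; congr (normc _ <= _); ring.
have cc (A : C) u : ccont (fun=> A) u.
  by move=> e' e'0; exists 1 => // v _; rewrite subrr ComplexField.Normc.normc0.
have fE : f = (fun u => g u + f z) by apply/funext => u; rewrite /g; ring.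
have hc p q r : hseg (fun=> f z) p q r = f z * (r - q)%:C.
  rewrite /hseg (_ : (fun _ : R => f z) = (fun t : R => f z + 0 * t%:C)).
    by rewrite cint_affine !mul0r addr0.
  by apply/funext => t; rewrite mul0r addr0.
have vc p q r : vseg (fun=> f z) p q r = f z * (r - q)%:C.
  exact: (hc p q r).
have lc : lcont (fun _ : R => f z) := linec_cont_sub (cc (f z)) 0 0.
have hE p q r : hseg f p q r = hseg g p q r + f z * (r - q)%:C.
  rewrite -(hc p) /hseg.
  rewrite -(cintD _ _ (linec_cont_sub cg _ _) lc).
  by congr (cint _ q r); apply/funext => t; rewrite /g subrK.
have vE p q r : vseg f p q r = vseg g p q r + f z * (r - q)%:C.
  rewrite -(vc p) /vseg.
  rewrite -(cintD _ _ (linec_cont_sub cg _ _) lc).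
  by congr (cint _ q r); apply/funext => t; rewrite /g subrK.
have wzE : w - z = (x' - x)%:C + 'i * (y' - y)%:C.
  by rewrite [LHS]complexE /x' /x /y' /y !raddfB.
have -> : cprim f w - cprim f z - f z * (w - z) =
    hseg g y x x' + 'i * vseg g x' y y'.
  by rewrite E hE vE wzE; ring.
have gb u : normc (u - z) < d -> normc (g u) <= e / 4 by move=> /H /ltW.
have bt (a b t : R) : t \in `[Num.min a b, Num.max a b] -> `|t - a| <= `|b - a|.
  rewrite in_itv/=; have [ab|ba] := leP a b => /andP[t1 t2].
    by rewrite !ger0_norm ?subr_ge0 ?lerD2r.
  by rewrite !ler0_norm ?subr_le0 ?lerN2 ?lerD2r// ltW.
have b1 : normc (hseg g y x x') <= 2 * (e / 4) * `|x' - x|.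
  apply: (cint_bound (linec_cont_sub cg _ _)) => t /bt tx; apply: gb.
  rewrite linecH (le_lt_trans (normc_le_ReIm _))// !raddfB /= -/x -/y subrr normr0 addr0.
  by rewrite (le_lt_trans tx)// (le_lt_trans dx)// (lt_trans wd)// gtr_pMr// invf_lt1// ltr1n.
have b2 : normc (vseg g x' y y') <= 2 * (e / 4) * `|y' - y|.
  apply: (cint_bound (linec_cont_sub cg _ _)) => t /bt ty; apply: gb.
  rewrite linecV (le_lt_trans (normc_le_ReIm _))// !raddfB /= -/x -/y.
  by move: (le_trans ty dy) dx wd; lra.
rewrite (le_trans (ler_normcD _ _))//.
have -> : normc ('i * vseg g x' y y') = normc (vseg g x' y y').
  by rewrite ComplexField.Normc.normcM /= expr0n expr1n add0r sqrtr1 mul1r.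
rewrite (le_trans (lerD b1 b2))//.
have : 2 * (e / 4) * `|x' - x| <= 2 * (e / 4) * normc (w - z).
  by rewrite ler_wpM2l// mulr_ge0// ltW.
have : 2 * (e / 4) * `|y' - y| <= 2 * (e / 4) * normc (w - z).
  by rewrite ler_wpM2l// mulr_ge0// ltW.
by move: (normc _) => N; lra.
Qed.

Lemma nrm_normc (z : R[i]^o) : nrm z = normc z.
Proof. by case: z. Qed.

Lemma cdiff_is_derive f (z l : C) :
  cdiff f z l <-> is_derive (z : R[i]^o) (1 : R[i]^o) (f : R[i]^o -> R[i]^o) l.
Proof.
have E : cdiff f z l <-> vdiff (f : R[i]^o -> R[i]^o) z l.
  by split=> H e e0; have [d d0 Hd] := H e e0; exists d => // w wd;
    have := Hd w wd; rewrite nrm_normc /GRing.scale/= mulrC.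
exact: iff_trans E (vdiff_is_derive _ _ _).
Qed.
End EntirePrimitive.

(** * A maximum principle in the upper half-plane *)

Section MaximumPrinciple.
Variable R : realType.
Local Notation C := R[i].
Local Notation Re := complex.Re.
Local Notation Im := complex.Im.
Local Notation normc := ComplexField.Normc.normc.

Lemma is_derive_eps (f : R -> R) (t l : R) :
  (forall e : R, 0 < e -> exists2 d : R, 0 < d & forall s : R, `|s - t| < d ->
     `|f s - f t - l * (s - t)| <= e * `|s - t|) -> is_derive t (1:R) f l.
Proof.
move=> H.
pose q (h : R) : R := h^-1 *: ((f \o shift t) (h *: (1 : R)) - f t).
have cvg : q @ 0^' --> l.
  apply/cvgrPdist_le => e e0; have [d d0 Hd] := H e e0.
  have nb : \forall w \near (0 : R)^', w != 0 /\ `|w| < d.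
    by exists d => // w /=; rewrite sub0r normrN => wd w0; split => //.
  apply: filterS nb => w [w0 wd].
  rewrite -(ler_pM2r (x := `|w|)) ?normr_gt0// -normrM.
  have := Hd (w + t); rewrite addrK => /(_ wd); rewrite -normrN.
  congr (`| _ | <= _); rewrite /q /= /GRing.scale/= mulr1; field; exact: w0.
apply: DeriveDef; first by apply/cvg_ex; exists l.
exact: cvg_lim.
Qed.

Lemma cdiff_line (f : C -> C) (z b l : C) (t : R) : cdiff f (z + b * t%:C) l ->
  is_derive t (1:R) (fun s => Re (f (z + b * s%:C))) (Re (l * b)).
Proof.
move=> df; apply: is_derive_eps => e e0.
have n0 : 0 < normc b + 1 by rewrite ltr_wpDl ?normc_ge0.
have [d d0 H] := df (e / (normc b + 1)) (divr_gt0 e0 n0).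
exists (d / (normc b + 1)); first by rewrite divr_gt0.
move=> s; rewrite ltr_pdivlMr// => st.
have E : z + b * s%:C - (z + b * t%:C) = b * (s - t)%:C.
  by rewrite rmorphB/=; ring.
have nE : normc (z + b * s%:C - (z + b * t%:C)) <= `|s - t| * (normc b + 1).
  by rewrite E ComplexField.Normc.normcM normcR mulrC ler_wpM2l// lerDl.
have := H _ (le_lt_trans nE st); rewrite E => h.
have -> : Re (f (z + b * s%:C)) - Re (f (z + b * t%:C)) - Re (l * b) * (s - t) =
    Re (f (z + b * s%:C) - f (z + b * t%:C) - l * (b * (s - t)%:C)).
  rewrite mulrA !raddfB /=; congr (_ - _ - _).
  by move: (l * b) => -[p q] /=; ring.
rewrite (le_trans (normc_Re _))// (le_trans h)//.
rewrite -E (le_trans (ler_wpM2l _ nE))//; first by rewrite divr_ge0 ?ltW.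
by rewrite le_eqVlt; apply/orP; left; apply/eqP; field; rewrite gt_eqF.
Qed.

(** At an interior maximum [f1] vanishes, so a positive derivative of [f1] there makes it positive
    just to the right, and the mean value theorem puts a larger value of [f] there. *)
Lemma not_max_second_derivative (f f1 : R -> R) (d l : R) : 0 < d ->
  (forall t : R, t \in `]- d, d[ -> is_derive t (1:R) f (f1 t)) ->
  is_derive (0:R) (1:R) f1 l -> 0 < l ->
  (forall t : R, t \in `]- d, d[ -> f t <= f 0) -> False.
Proof.
move=> d0 df df1 l0 fmax.
have z0 : (0:R) \in `]- d, d[ by rewrite in_itv/= oppr_lt0 d0.
have f10 : f1 0 = 0.
  have le_d : - d <= d by rewrite ge0_cp// ltW.
  have dd t : t \in `]- d, d[ -> derivable f t 1 by move=> /df [].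
  have [_ E0] := derive1_at_max le_d dd z0 fmax.
  by have [_ <-] := df 0 z0.
have cvg : (fun h : R => h^-1 *: (f1 h - f1 0)) @ (0:R)^' --> l.
  have [h1 h2] := df1; move: h1; rewrite /derivable => h1.
  rewrite -h2; move: h1; rewrite /derive.
  suff -> : (fun h : R => h^-1 *: ((f1 \o shift 0) h%:A - f1 0)) =
            (fun h : R => h^-1 *: (f1 h - f1 0)) by [].
  by apply/funext => h /=; rewrite addr0 /GRing.scale/= mulr1.
have /cvgrPdist_lt /(_ _ l0)[e /= e0 He] := cvg.
pose h := Num.min (e / 2) (d / 2).
have h0 : 0 < h by rewrite lt_min !divr_gt0.
have hd : h < d by rewrite gt_min [X in _ || X](_ : _ = true) ?orbT//; lra.
have he : h < e by rewrite gt_min [X in X || _](_ : _ = true)//; lra.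
have f1pos c : c \in `]0, h[ -> 0 < f1 c.
  rewrite in_itv/= => /andP[c0 ch].
  have := He c; rewrite /ball_/= sub0r normrN gtr0_norm//.
  move=> /(_ (lt_trans ch he) (lt0r_neq0 c0)).
  rewrite f10 subr0 /GRing.scale/= ltr_norml => /andP[_ h2].
  have : 0 < c^-1 * f1 c by lra.
  by rewrite pmulr_rgt0 ?invr_gt0.
have dfh x : x \in `]0, h[ -> is_derive x (1:R) f (f1 x).
  rewrite in_itv/= => /andP[x0 xh]; apply: df.
  by rewrite in_itv/= (lt_trans xh hd) andbT (lt_trans _ x0)// oppr_lt0.
have cf : {within `[0, h], continuous f}.
  apply: derivable_within_continuous => x; rewrite in_itv/= => /andP[x0 xh].
  have xd : x \in `]- d, d[.
    by rewrite in_itv/= (le_lt_trans xh hd) andbT (lt_le_trans _ x0)// oppr_lt0.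
  by have [] := df x xd.
have [c ch E] := MVT h0 dfh cf.
have := fmax h; rewrite in_itv/= hd andbT (lt_trans _ h0) ?oppr_lt0// => /(_ isT).
by rewrite -subr_le0 E subr0 pmulr_lle0// leNgt f1pos.
Qed.

(** The part in the closed upper half-plane of the disc of radius [rho] about [-i]. The centre lies
    below the real axis so that powers of [1 / (z + i)] have no pole in the region. *)
Definition region (rho : R) : set (R * R) :=
  [set p | 0 <= p.2 /\ p.1 ^+ 2 + (p.2 + 1) ^+ 2 <= rho ^+ 2].

Lemma region_compact rho : 0 <= rho -> compact (region rho).
Proof.
move=> r0.
apply: (@subclosed_compact _ _ (`[- rho, rho] `*` `[0, rho])).
- have -> : region rho = ((fun p : R * R => p.2) @^-1` [set x | 0 <= x]) `&`
     ((fun p : R * R => p.1 ^+ 2 + (p.2 + 1) ^+ 2) @^-1` [set x | x <= rho ^+ 2]).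
    by [].
  apply: closedI; apply: closed_comp.
  + by move=> p _; exact: cvg_snd.
  + exact: closed_ge.
  + move=> p _; apply: cvgD; first by apply: cvgM; exact: cvg_fst.
    by apply: cvgM; apply: cvgD; (exact: cvg_snd || exact: cvg_cst).
  + exact: closed_le.
- by apply: compact_setX; exact: segment_compact.
- move=> [x y] [/= y0 h]; split => /=; rewrite in_itv/=.
    rewrite -ler_norml -(ler_pXn2r (n := 2)) ?nnegrE// real_normK ?num_real//.
    by rewrite (le_trans _ h)// lerDl sqr_ge0.
  rewrite y0/= -(ler_pXn2r (n := 2)) ?nnegrE//.
  by rewrite (le_trans _ h)//; have := sqr_ge0 x; lra.
Qed.

End MaximumPrinciple.

Section Uniqueness.
Variable R : realType.
Local Notation C := R[i].
Local Notation Re := complex.Re.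
Local Notation Im := complex.Im.
Local Notation normc := ComplexField.Normc.normc.

Lemma cdiffD (f g : C -> C) z l m : cdiff f z l -> cdiff g z m ->
  cdiff (fun w => f w + g w) z (l + m).
Proof.
move=> /cdiff_is_derive df /cdiff_is_derive dg.
exact: (cdiff_is_derive _ _ _).2 (is_deriveD df dg).
Qed.

Lemma cdiffM (f g : C -> C) z l m : cdiff f z l -> cdiff g z m ->
  cdiff (fun w => f w * g w) z (f z * m + g z * l).
Proof.
move=> /cdiff_is_derive df /cdiff_is_derive dg.
exact: (cdiff_is_derive _ _ _).2 (is_deriveM df dg).
Qed.

Lemma cdiff_cst (c : C) z : cdiff (fun=> c) z 0.
Proof. move=> e e0; exists 1 => // w _.
by rewrite subrr mul0r subrr ComplexField.Normc.normc0 mulr_ge0 ?normc_ge0// ltW. Qed.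

Lemma cdiff_invD (a z : C) : z + a != 0 ->
  cdiff (fun w => (w + a)^-1) z (- ((z + a)^-1 * (z + a)^-1)).
Proof.
move=> za; apply: (cdiff_is_derive _ _ _).2.
have d0 : cdiff (fun w => w + a) z 1.
  move=> e e0; exists 1 => // w _.
  rewrite (_ : w + a - (z + a) - 1 * (w - z) = 0); last ring.
  by rewrite ComplexField.Normc.normc0 mulr_ge0 ?normc_ge0// ltW.
have [h1 h2] := (cdiff_is_derive _ _ _).1 d0.
apply: DeriveDef; first exact: (derivableV za h1).
rewrite [LHS](deriveV za h1) h2 /GRing.scale/= mulr1.
by rewrite expr2 invfM.
Qed.

Definition cdiff2 (D : set C) (f : C -> C) := exists f1 : C -> C,
  forall z, D z -> cdiff f z (f1 z) /\ exists l, cdiff f1 z l.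

Lemma cdiff2M D f g : cdiff2 D f -> cdiff2 D g -> cdiff2 D (fun w => f w * g w).
Proof.
move=> [f1 Hf] [g1 Hg]; exists (fun w => f w * g1 w + g w * f1 w) => z Dz.
have [df [l dl]] := Hf z Dz; have [dg [m dm]] := Hg z Dz.
split; first exact: cdiffM.
by eexists; apply: cdiffD; apply: cdiffM; eassumption.
Qed.

Lemma cdiff2_cst D (c : C) : cdiff2 D (fun=> c).
Proof.
by exists (fun=> 0) => z _; split; [exact: cdiff_cst|exists 0; exact: cdiff_cst].
Qed.

Lemma cdiff2_invD (D : set C) (a : C) : (forall z, D z -> z + a != 0) ->
  cdiff2 D (fun w => (w + a)^-1).
Proof.
move=> H; exists (fun w => -1 * ((w + a)^-1 * (w + a)^-1)) => z Dz.
split; first by rewrite mulN1r; exact: cdiff_invD (H z Dz).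
have d := cdiff_invD (H z Dz).
by eexists; apply: cdiffM (cdiff_cst _ _) (cdiffM d d).
Qed.

Lemma cdiff2X D (f : C -> C) n : cdiff2 D f -> cdiff2 D (fun w => f w ^+ n).
Proof.
move=> df; elim: n => [|n IH]; first exact: cdiff2_cst.
rewrite (_ : (fun w => _) = (fun w => f w * f w ^+ n)); first exact: cdiff2M.
by apply/funext => w; rewrite exprS.
Qed.

(** An open neighbourhood of the closed upper half-plane that still avoids the pole [-i]. *)
Definition halfplane : set C := [set z | - 1 < Im z].

Lemma is_derive_shift_sqr (eps a t : R) :
  is_derive t (1:R) (fun s : R => eps * (a + s) ^+ 2) (2 * eps * (a + t)).
Proof.
have := is_deriveZ eps (is_deriveX 2 (is_deriveD (is_derive_cst a t 1) (is_derive_id t (1:R)))).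
move/is_derive_eq => H; apply: H.
by rewrite fctE /GRing.scale/= /GRing.scale/= add0r mulr1 expr1; ring.
Qed.

Lemma is_derive_shift_lin (k a t : R) :
  is_derive t (1:R) (fun s : R => k * (a + s)) k.
Proof.
have := is_deriveZ k (is_deriveD (is_derive_cst a t 1) (is_derive_id t (1:R))).
move/is_derive_eq => H; apply: H.
by rewrite /GRing.scale/= add0r mulr1.
Qed.

(* Re W + eps x^2 has positive Laplacian, so its maximum is not interior. *)
Lemma maximum_principle (W : C -> C) (rho B : R) : 0 <= rho -> 0 <= B ->
  cdiff2 halfplane W ->
  (forall x y, region rho (x, y) ->
     y = 0 \/ x ^+ 2 + (y + 1) ^+ 2 = rho ^+ 2 -> Re (W (x +i* y)) <= B) ->
  forall x y, region rho (x, y) -> Re (W (x +i* y)) <= B.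
Proof.
move=> r0 B0 [W1 HW] bd x y Kxy.
apply/ler_addgt0Pl => e e0.
(* On the region [x^2] is at most [rho^2], so the perturbation [eps x^2] stays below [e]. *)
pose eps := e / (rho ^+ 2 + 1).
have r1 : 0 < rho ^+ 2 + 1 by rewrite ltr_wpDl ?sqr_ge0.
have eps0 : 0 < eps by rewrite divr_gt0.
pose u (p : R * R) := Re (W (p.1 +i* p.2)) + eps * p.1 ^+ 2.
have cu : {within region rho, continuous u}.
  apply/subspace_continuousP => -[a b] [/= b0 _].
  apply: (@cvg_within_filter _ _ u (nbhs (a, b))).
  apply: cvgD; last first.
    by apply: cvgM; [exact: cvg_cst|apply: cvgM; exact: cvg_fst].
  have hab : halfplane (a +i* b) by rewrite /halfplane/=; lra.
  have [dW _] := HW _ hab.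
  apply/cvgrPdist_lt => e' e'0; have [d d0 H] := cdiff_cont dW e'0.
  have nb : \forall p \near (a, b), `|p.1 - a| < d / 2 /\ `|p.2 - b| < d / 2.
    have d20 : 0 < d / 2 by rewrite divr_gt0.
    exists (ball a (d / 2), ball b (d / 2)) => /=.
      by split; exact: nbhsx_ballx.
    by move=> [p q] [/= h1 h2]; rewrite /ball/= in h1 h2; rewrite !(distrC _ a, distrC _ b).
  apply: filterS nb => -[p q] [/= h1 h2].
  rewrite distrC -raddfB (le_lt_trans (normc_Re _))// H//.
  by rewrite (le_lt_trans (normc_le_ReIm _))//=; lra.
have K0 : region rho !=set0 by exists (x, y).
have [[a b] abK umax] := compact_EVT_max K0 (region_compact r0) cu.
move: abK; rewrite inE => abK.
have {}umax p q : region rho (p, q) -> u (p, q) <= u (a, b).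
  by move=> h; apply: umax; rewrite inE.
have [b0 abr] := abK; rewrite /= in b0 abr.
have a2 : a ^+ 2 <= rho ^+ 2 by rewrite (le_trans _ abr)// lerDl sqr_ge0.
have bdcase : b = 0 \/ a ^+ 2 + (b + 1) ^+ 2 = rho ^+ 2 -> Re (W (x +i* y)) <= e + B.
  move=> /(bd _ _ abK) h; have := umax _ _ Kxy; rewrite /u /=.
  have : eps * a ^+ 2 <= e.
    rewrite /eps mulrAC ler_pdivrMr// ler_pM2l//; lra.
  have : 0 <= eps * x ^+ 2 by rewrite mulr_ge0 ?sqr_ge0// ltW.
  lra.
move: b0; rewrite le_eqVlt => /predU1P[b0|b0]; first by apply: bdcase; left.
move: abr; rewrite le_eqVlt => /predU1P[abr|abr]; first by apply: bdcase; right.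
exfalso.
have [d d0 dK] : exists2 d : R, 0 < d & forall s t : R, `|s| < d -> `|t| < d ->
    region rho (a + s, b + t).
  pose k := rho ^+ 2 - (a ^+ 2 + (b + 1) ^+ 2).
  have k0 : 0 < k by rewrite subr_gt0.
  (* Moving each coordinate by at most [M <= 1] changes the squared distance to [-i] by at most
     [m M], because squares of numbers up to 1 are below the numbers themselves. *)
  pose m := 2 * `|a| + 2 * (b + 1) + 2.
  have m0 : 0 < m.
    by have := normr_ge0 a; rewrite /m; lra.
  exists (Num.min (Num.min b 1) (k / m)).
    by rewrite !lt_min b0 ltr01 divr_gt0.
  move=> s t; rewrite !lt_min => /andP[/andP[_ s1] sk] /andP[/andP[tb t1] tk].
  split => /=; first by move: tb; rewrite ltr_norml => /andP[]; lra.
  rewrite -subr_ge0.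
  have -> : rho ^+ 2 - ((a + s) ^+ 2 + (b + t + 1) ^+ 2) =
    k - (2 * (a * s) + 2 * ((b + 1) * t) + s * s + t * t) by rewrite /k; ring.
  rewrite subr_ge0.
  have h1 : a * s <= `|a| * `|s| by rewrite -normrM ler_norm.
  have h2 : (b + 1) * t <= (b + 1) * `|t| by rewrite ler_wpM2l ?ler_norm//; lra.
  have h3 : s * s <= `|s| by rewrite -expr2 -real_normK ?num_real// expr2 ler_piMl// ltW.
  have h4 : t * t <= `|t| by rewrite -expr2 -real_normK ?num_real// expr2 ler_piMl// ltW.
  pose M := Num.max `|s| `|t|.
  have sM : `|s| <= M by rewrite le_max lexx.
  have tM : `|t| <= M by rewrite le_max lexx orbT.
  have Mk : M * m < k by rewrite -ltr_pdivlMr// gt_max sk tk.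
  have h5 : `|a| * `|s| <= `|a| * M by rewrite ler_wpM2l.
  have h6 : (b + 1) * `|t| <= (b + 1) * M by rewrite ler_wpM2l//; lra.
  move: Mk; rewrite /m; lra.
have in_d (t : R) : t \in `]- d, d[ -> `|t| < d by rewrite in_itv/= ltr_norml.
pose z := a +i* b.
have Dz s t : `|s| < d -> `|t| < d -> halfplane ((a + s) +i* (b + t)).
  by move=> h1 h2; have [/= ? _] := dK s t h1 h2; rewrite /halfplane/=; lra.
have lineH (t : R) : z + 1 * t%:C = (a + t) +i* (b + 0).
  by apply/eqP; rewrite /z eq_complex /=; apply/andP; split; apply/eqP; ring.
have lineV (t : R) : z + 'i * t%:C = (a + 0) +i* (b + t).
  by apply/eqP; rewrite /z eq_complex /=; apply/andP; split; apply/eqP; ring.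
have dd0 : `|0 : R| < d by rewrite normr0.
have Dz0 : halfplane z by rewrite /halfplane/=; lra.
have [_ [l dl]] := HW z Dz0.
have z0E (c : C) : z + c * 0%:C = z by rewrite mulr0 addr0.
(* The second derivatives along the two axes are [Re l + 2 eps] and [- Re l], the latter because
   [i^2 = -1]. Their sum [2 eps] is positive, so one of them is positive and contradicts the
   maximum. *)
have [lneg|lpos] := leP (Re l + 2 * eps) 0; last first.
  apply: (@not_max_second_derivative R
    (fun t => Re (W (z + 1 * t%:C)) + eps * (a + t) ^+ 2)
    (fun t => Re (W1 (z + 1 * t%:C)) + 2 * eps * (a + t)) d
    (Re l + 2 * eps) d0) => //.
  - move=> t /in_d td.
    have h : cdiff W (z + 1 * t%:C) (W1 (z + 1 * t%:C)).
      by rewrite lineH; have [] := HW _ (Dz t 0 td dd0).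
    by have := is_deriveD (cdiff_line h) (is_derive_shift_sqr eps a t); rewrite mulr1.
  - have h : cdiff W1 (z + 1 * 0%:C) l by rewrite z0E.
    have := is_deriveD (cdiff_line h) (is_derive_shift_lin (2 * eps) a 0).
    by rewrite mulr1.
  - move=> t /in_d td; have := umax _ _ (dK t 0 td dd0).
    by rewrite /u /= lineH z0E !addr0.
apply: (@not_max_second_derivative R
    (fun t => Re (W (z + 'i * t%:C)))
    (fun t => Re (W1 (z + 'i * t%:C) * 'i)) d
    (- Re l) d0) => //.
- move=> t /in_d td.
  have h : cdiff W (z + 'i * t%:C) (W1 (z + 'i * t%:C)).
    by rewrite lineV; have [] := HW _ (Dz 0 t dd0 td).
  exact: (cdiff_line h).
- have -> : - Re l = Re ((0 * W1 z + 'i * l) * 'i).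
    by rewrite mul0r add0r; case: (l) => p q /=; ring.
  have h : cdiff (fun w => W1 w * 'i) (z + 'i * 0%:C) (0 * W1 z + 'i * l).
    have := cdiffM dl (cdiff_cst 'i z).
    by rewrite mulr0 mul0r z0E.
  exact: (cdiff_line h).
- lra.
- move=> t /in_d td; have := umax _ _ (dK 0 t dd0 td).
  by rewrite /u /= lineV z0E !addr0; lra.
Qed.
End Uniqueness.

(** * Uniqueness of entire functions *)

Section IdentityTheorem.
Variable R : realType.
Local Notation C := R[i].
Local Notation Re := complex.Re.
Local Notation Im := complex.Im.
Local Notation normc := ComplexField.Normc.normc.

Lemma Re_conjcM (A : C) : Re (conjc A * A) = normc A ^+ 2.
Proof. by case: A => a b /=; rewrite sqr_sqrtr ?addr_ge0 ?sqr_ge0//; ring. Qed.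

Lemma bernoulli_ineq (x : R) n : 0 <= x -> 1 + n%:R * x <= (1 + x) ^+ n.
Proof.
move=> x0; elim: n => [|n IH]; first by rewrite mul0r addr0.
rewrite exprS (le_trans _ (ler_wpM2l _ IH)) ?addr_ge0//.
have : 0 <= n%:R * x * x by rewrite !mulr_ge0.
by rewrite -natr1; lra.
Qed.

Lemma region_normc_bounded (g : C -> C) (rho : R) : 0 <= rho ->
  (forall z, ccont g z) ->
  exists2 M : R, 0 <= M & forall x y : R, region rho (x, y) -> normc (g (x +i* y)) <= M.
Proof.
move=> r0 cg.
have [[[a b] ab]|] := pselect (region rho !=set0); last first.
  by move=> H; exists 0 => // x y xy; exfalso; apply: H; exists (x, y).
pose u (p : R * R) : R := normc (g (p.1 +i* p.2)).
have cu : {within region rho, continuous u}.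
  apply: continuous_subspaceT => -[p q].
  apply/cvgrPdist_lt => e' e'0; have [d d0 H] := cg (p +i* q) _ e'0.
  have nb : \forall r \near (p, q), `|r.1 - p| < d / 2 /\ `|r.2 - q| < d / 2.
    have d20 : 0 < d / 2 by rewrite divr_gt0.
    exists (ball p (d / 2), ball q (d / 2)) => /=.
      by split; exact: nbhsx_ballx.
    by move=> [r s] [/= h1 h2]; rewrite /ball/= in h1 h2; rewrite !(distrC _ p, distrC _ q).
  apply: filterS nb => -[r s] [/= h1 h2].
  have h : normc (g (r +i* s) - g (p +i* q)) < e'.
    by apply: H; rewrite (le_lt_trans (normc_le_ReIm _))//=; lra.
  rewrite /u /= ltr_norml.
  move: (g (r +i* s)) (g (p +i* q)) h => X Y h.
  have := ler_normcD (X - Y) Y.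
  have := ler_normcD (Y - X) X.
  rewrite !subrK -(normcN (Y - X)) opprB => t1 t2; apply/andP; split; lra.
have K0 : region rho !=set0 by exists (a, b).
have [c _ umax] := compact_EVT_max K0 (region_compact r0) cu.
exists (u c); first exact: normc_ge0.
by move=> x y xy; apply: (umax (x, y)); rewrite inE.
Qed.

(* For fixed z0, apply the maximum principle to c g(z) / (z + i)^n on the part of
   the disc |z + i| <= rho in the upper half-plane, where rho > |z0 + i|:
   |g(z0)| <= M (|z0 + i| / rho)^n for all n. *)
Lemma cdiff2_zero_upper (g : C -> C) : cdiff2 setT g ->
  (forall t : R, g t%:C = 0) -> forall x y : R, 0 <= y -> g (x +i* y) = 0.
Proof.
move=> dg g0 x y y0.
have cg z : ccont g z.
  by have [g1 /(_ z I)[h _]] := dg; exact: cdiff_cont h.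
pose z0 := x +i* y.
apply: ComplexField.Normc.eq0_normc; apply/eqP; rewrite eq_le normc_ge0 andbT leNgt.
apply/negP => N0; set N := normc _ in N0.
pose r := normc (z0 + 'i).
have rE (a b : R) : normc (a +i* b + 'i) = Num.sqrt (a ^+ 2 + (b + 1) ^+ 2).
  by rewrite /= addr0.
have r0 : 0 < r.
  rewrite /r rE sqrtr_gt0 ltr_wpDl ?sqr_ge0// exprn_gt0//; lra.
pose rho := r + 1.
have rho0 : 0 < rho by rewrite /rho; lra.
have [M M0 HM] := region_normc_bounded (ltW rho0) cg.
have key n : N / r ^+ n <= M / rho ^+ n.
  pose q w : C := (w + 'i)^-1 ^+ n.
  (* Multiplication by the conjugate of [A] makes the value at [z0] equal to [|A|^2], so a bound on
     real parts becomes a bound on the modulus. *)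
  pose A := g z0 * q z0.
  have nq w : normc (q w) = (normc (w + 'i) ^+ n)^-1.
    rewrite /q; elim: n {A q} => [|n IH]; first by rewrite !expr0 ComplexField.Normc.normc1 invr1.
    by rewrite !exprS ComplexField.Normc.normcM IH ComplexField.Normc.normcV invfM.
  have nA : normc A = N / r ^+ n by rewrite /A ComplexField.Normc.normcM nq.
  have A0 : 0 < normc A by rewrite nA divr_gt0// exprn_gt0.
  have dW : cdiff2 (@halfplane R) (fun w => conjc A * (g w * q w)).
    apply: cdiff2M; first exact: cdiff2_cst.
    apply: cdiff2M; first by have [g1 H] := dg; exists g1 => z _; exact: H.
    apply: cdiff2X; apply: cdiff2_invD => z; rewrite /halfplane /= => hz.
    apply/eqP => /(congr1 (@complex.Im R)); case: z hz => a b /=; lra.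
  have nconj : normc (conjc A) = normc A by case: (A) => a b /=; rewrite sqrrN.
  have reg : region rho (x, y).
    split => //=; rewrite /rho -(@ler_sqrt _ (x ^+ 2 + _)) ?sqr_ge0//.
    rewrite sqrtr_sqr -rE -/z0 -/r ger0_norm; lra.
  have B0 : 0 <= normc A * (M / rho ^+ n).
    by rewrite mulr_ge0 ?normc_ge0// divr_ge0// exprn_ge0// ltW.
  have AE : A = g z0 * q z0 by [].
  clearbody A q.
  have bdy (a b : R) : region rho (a, b) ->
      b = 0 \/ a ^+ 2 + (b + 1) ^+ 2 = rho ^+ 2 ->
      Re (conjc A * (g (a +i* b) * q (a +i* b))) <= normc A * (M / rho ^+ n).
    move=> ab [b0|E].
      by rewrite b0 complexr0 g0 mul0r mulr0.
    rewrite (le_trans (ler_norm _))// (le_trans (normc_Re _))//.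
    rewrite (ComplexField.Normc.normcM (conjc A)) nconj ler_wpM2l ?normc_ge0//.
    rewrite (ComplexField.Normc.normcM (g (a +i* b))).
    rewrite nq rE E sqrtr_sqr ger0_norm ?(ltW rho0)// ler_wpM2r//.
      by rewrite invr_ge0 exprn_ge0// ltW.
    exact: HM.
  have h : Re (conjc A * A) <= normc A * (M / rho ^+ n).
    by rewrite {2}AE; exact: (maximum_principle (ltW rho0) B0 dW bdy reg).
  by rewrite Re_conjcM expr2 ler_pM2l// nA in h.
(* Since [rho = r + 1], Bernoulli bounds [(rho / r)^n] below by [1 + n / r], which is unbounded in
   [n]. *)
have key' n : N * (1 + n%:R / r) <= M.
  have := key n; rewrite ler_pdivlMr ?exprn_gt0// => h.
  rewrite (le_trans _ h)// -mulrA ler_pM2l//.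
  rewrite [leRHS]mulrC -expr_div_n (_ : rho / r = 1 + r^-1); last first.
    by rewrite /rho; field; rewrite gt_eqF.
  by apply: bernoulli_ineq; rewrite invr_ge0 ltW.
have := key' (Num.truncn (r * M / N)).+1.
apply/negP; rewrite -ltNge mulrC -ltr_pdivrMr//.
have : r * M / N < (Num.truncn (r * M / N)).+1%:R by rewrite truncnS_gt.
move: (_.+1%:R) => k h; have : M / N < k / r by rewrite ltr_pdivlMr// mulrC mulrA.
lra.
Qed.

Lemma cdiff_near0 (f : C -> C) (z l : C) (e : R) : 0 < e ->
  (forall w, normc (w - z) < e -> f w = 0) -> cdiff f z l -> l = 0.
Proof.
move=> e0 f0 /cdiff_is_derive[_ <-].
have : cdiff f z 0.
  move=> e' e'0; exists e => // w wz.
  rewrite !f0// ?subrr ?ComplexField.Normc.normc0 ?mul0r ?subr0 ?ComplexField.Normc.normc0//.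
  by rewrite mulr_ge0 ?normc_ge0// ltW.
by move=> /cdiff_is_derive[_ <-].
Qed.

(* The maximum principle needs a second derivative, so it is applied to a second
   primitive of f. *)
Lemma entire_zero_upper (f : C -> C) : (forall z, exists l, cdiff f z l) ->
  (forall t : R, f t%:C = 0) -> forall z : C, 0 < Im z -> f z = 0.
Proof.
move=> df f0 z z0.
pose F := cprim f; pose G := cprim F.
have dF w : cdiff F w (f w) by exact: cprim_diff.
have dG w : cdiff G w (F w) by apply: cprim_diff => u; exists (f u).
have cint0 (h : R -> C) a b : (forall t, h t = 0) -> cint h a b = 0.
  move=> h0; have -> : h = (fun t => 0 + 0 * t%:C).
    by apply/funext => t; rewrite h0 mul0r addr0.
  by rewrite cint_affine !mul0r addr0.
have F0 (t : R) : F t%:C = 0 by rewrite /F cprim_real cint0.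
have G0 (t : R) : G t%:C = 0 by rewrite /G cprim_real cint0.
have d2G : cdiff2 setT G by exists F => w _; split => //; exists (f w).
have near_up (w u : C) : normc (u - w) < Im w -> 0 < Im u.
  move=> h; have := le_lt_trans (normc_Im _) h.
  by rewrite raddfB /= ltr_norml => /andP[]; lra.
(* The second primitive vanishes on an open set, and differentiating twice returns to [f]. *)
have up0 (w : C) : 0 < Im w -> G w = 0.
  by case: w => a b /= b0; apply: cdiff2_zero_upper => //; exact: ltW.
have F_up (w : C) : 0 < Im w -> F w = 0.
  move=> w0; apply: (cdiff_near0 w0 _ (dG w)) => u uw.
  by apply: up0; exact: near_up uw.
apply: (cdiff_near0 z0 _ (dF z)) => u uw.
by apply: F_up; exact: near_up uw.
Qed.

(** The lower half-plane is reduced to the upper one by [z |-> f(-z)], which also vanishes on the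
    real line. *)
Lemma entire_zero (f : C -> C) : (forall z, exists l, cdiff f z l) ->
  (forall t : R, f t%:C = 0) -> forall z, f z = 0.
Proof.
move=> df f0 z.
have [z0|z0|z0] := ltgtP 0 (Im z).
- exact: entire_zero_upper.
- have H := @entire_zero_upper (fun w => f (- w)) _ _ (- z).
  rewrite -[z]opprK; apply: H; last by rewrite raddfN /=; lra.
    move=> w; have [l dl] := df (- w); exists (- l) => e e0.
    have [d d0 H] := dl e e0; exists d => // u uw.
    have E : - u - - w = - (u - w) by ring.
    have := H (- u); rewrite E normcN => /(_ uw).
    by rewrite mulrN mulNr.
  move=> t; have -> : - t%:C = (- t)%:C :> C.
    by apply/eqP; rewrite eq_complex /= oppr0 !eqxx.
  exact: f0.
- by case: z z0 => a b /= <-; rewrite complexr0.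
Qed.

End IdentityTheorem.

(** * Homomorphisms and states of C*-algebras *)

Section NrmTheory.
Variables (R : realType) (V : normedModType R[i]).
Local Notation normc := ComplexField.Normc.normc.
Implicit Types (v w : V).

Lemma nrm_ge0 v : 0 <= nrm v.
Proof. by have := normr_ge0 v; rewrite nrmE (lecR 0). Qed.

Lemma nrm0 : nrm (0 : V) = 0.
Proof. by rewrite /nrm normr0. Qed.

Lemma nrm0_eq v : nrm v = 0 -> v = 0.
Proof. by move=> h; apply/normr0_eq0; rewrite nrmE h. Qed.

Lemma ler_nrmD v w : nrm (v + w) <= nrm v + nrm w.
Proof. by have := ler_normD v w; rewrite !nrmE -rmorphD lecR. Qed.

Lemma nrmN v : nrm (- v) = nrm v.
Proof. by rewrite /nrm normrN. Qed.

Lemma nrmB v w : nrm (v - w) = nrm (w - v).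
Proof. by rewrite -nrmN opprB. Qed.

Lemma nrmZ z v : nrm (z *: v) = normc z * nrm v.
Proof. by apply: complexI; rewrite -nrmE normrZ normC_normc nrmE rmorphM. Qed.

Lemma ler_nrmB v w : nrm (v - w) <= nrm v + nrm w.
Proof. by rewrite (le_trans (ler_nrmD _ _))// nrmN. Qed.

Lemma ler_nrm_dist v w u : nrm (v - u) <= nrm (v - w) + nrm (w - u).
Proof. by rewrite -[v - u](subrKA w) (le_trans (ler_nrmD _ _))// opprB addrC. Qed.

Lemma nrm_le_eps v w : (forall e : R, 0 < e -> nrm (v - w) <= e) -> v = w.
Proof.
move=> H; apply/subr0_eq/nrm0_eq/eqP; rewrite eq_le nrm_ge0 andbT.
by apply/ler_addgt0Pl => e e0; rewrite addr0 H.
Qed.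

Lemma nbhs_nrm v (S : set V) : nbhs v S <->
  exists2 d : R, 0 < d & forall w, nrm (v - w) < d -> S w.
Proof.
split=> [/nbhs_ballP[e /= e0 He]|[d d0 Hd]].
  have er : e = (complex.Re e)%:C by rewrite RRe_real ?gtr0_real.
  exists (complex.Re e); first by rewrite -ltcR -er.
  move=> w vw; apply: He; rewrite -ball_normE /= nrmE er.
  by rewrite ltcR.
apply/nbhs_ballP; exists d%:C => /=; first by rewrite (ltcR 0).
move=> w; rewrite -ball_normE /= nrmE => h; apply: Hd.
by rewrite -ltcR.
Qed.

Lemma dense_nrm (S : set V) : dense S -> forall v (e : R), 0 < e ->
  exists2 w, S w & nrm (v - w) <= e.
Proof.
move=> dS v e e0.
have [|w [/= vw Sw]] := dS (interior [set w | nrm (v - w) <= e]) _ (open_interior _).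
  exists v; apply/nbhs_nrm; exists e => // w; exact: ltW.
by exists w => //; exact: interior_subset vw.
Qed.
End NrmTheory.

Section Completeness.
Variables (R : realType) (V : completeNormedModType R[i]).

Lemma nrm_complete (u : nat -> V) :
  (forall e : R, 0 < e -> exists N, forall n, (N <= n)%N -> nrm (u N - u n) <= e) ->
  exists l : V, forall e : R, 0 < e ->
    exists N, forall n, (N <= n)%N -> nrm (l - u n) <= e.
Proof.
move=> H.
have cu : cauchy (u @ \oo).
  apply: cauchy_exP => e e0.
  have er : e = (complex.Re e)%:C by rewrite RRe_real ?gtr0_real.
  have e2 : 0 < complex.Re e / 2 by rewrite divr_gt0// -ltcR -er.
  have [N HN] := H _ e2; exists (u N).
  exists N => // n /= /HN h; rewrite -ball_normE /= nrmE er ltcR.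
  by rewrite (le_lt_trans h)//; lra.
have cv : cvg (u @ \oo) by exact: cauchy_cvg.
have /cvg_ex[l /= /cvg_nrm ul] := cv.
exists l => e /ul[N _ HN]; exists N => n Nn; exact: HN.
Qed.
End Completeness.

(** * Square roots in C*-algebras *)

Section CstarBasics.
Variables (R : realType) (A : cstarAlgType R).
Implicit Types (a b c : A).

Lemma cmul0l a : 0 ** a = 0.
Proof. by apply: (addIr (0 ** a)); rewrite -cmulDl !add0r. Qed.
Lemma cmul0r a : a ** 0 = 0.
Proof. by apply: (addIr (a ** 0)); rewrite -cmulDr !add0r. Qed.
Lemma cmulNl a b : (- a) ** b = - (a ** b).
Proof. by apply: (addIr (a ** b)); rewrite -cmulDl !addNr cmul0l. Qed.
Lemma cmulNr a b : a ** (- b) = - (a ** b).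
Proof. by apply: (addIr (a ** b)); rewrite -cmulDr !addNr cmul0r. Qed.
Lemma cmulBl a b c : (a - b) ** c = a ** c - b ** c.
Proof. by rewrite cmulDl cmulNl. Qed.
Lemma cmulBr a b c : a ** (b - c) = a ** b - a ** c.
Proof. by rewrite cmulDr cmulNr. Qed.
Lemma cstar0 : cstar 0 = 0 :> A.
Proof. by apply: (addIr (cstar 0)); rewrite -cstarD !add0r. Qed.
Lemma cstarN a : cstar (- a) = - cstar a.
Proof. by apply: (addIr (cstar a)); rewrite -cstarD !addNr cstar0. Qed.
Lemma cstarB a b : cstar (a - b) = cstar a - cstar b.
Proof. by rewrite cstarD cstarN. Qed.
Lemma cstar1 : cstar cone = cone :> A.
Proof. by rewrite -[LHS]cmul1l -{1}(cstarK cone) -cstarM cmul1l cstarK. Qed.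

Lemma nrmM a b : nrm (a ** b) <= nrm a * nrm b.
Proof. by have := cnormM a b; rewrite !nrmE -rmorphM lecR. Qed.

Lemma nrm_starM a : nrm (cstar a ** a) = nrm a ^+ 2.
Proof.
have := cnorm_star a; rewrite !nrmE -rmorphXn.
by move=> h; apply: (@complexI R); rewrite h.
Qed.

Lemma nrm_cstar a : nrm (cstar a) = nrm a.
Proof.
have le b : nrm b <= nrm (cstar b).
  have := nrmM (cstar b) b; rewrite nrm_starM expr2.
  have [->|b0] := eqVneq (nrm b) 0; first by rewrite nrm_ge0.
  by rewrite ler_pM2r// lt_def b0 nrm_ge0.
by apply/eqP; rewrite eq_le le andbT -{2}(cstarK a) le.
Qed.

(** Only an inequality: the zero algebra is a [cstarAlgType], and there the unit has norm 0. *)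
Lemma nrm_cone_le1 : nrm (cone : A) <= 1.
Proof.
have := nrm_starM (cone : A); rewrite cstar1 cmul1l expr2 => h.
have [->|n0] := eqVneq (nrm (cone : A)) 0; first exact: ler01.
by move: h; rewrite -{1}[nrm cone]mulr1 => /(mulfI n0) <-.
Qed.

(* The solution of y = (c + y^2) / 2 is a fixed point; x = 1 - y. *)
Lemma cstar_sqrt (c : A) : cstar c = c -> nrm c < 1 ->
  exists x : A, [/\ cstar x = x, x ** x = cone - c &
    forall b, b ** c = c ** b -> b ** x = x ** b].
Proof.
move=> cc c1; pose q := nrm c.
have q0 : 0 <= q := nrm_ge0 c.
pose T (y : A) : A := (2^-1 : R)%:C *: (c + y ** y).
pose y n := iter n T 0.
have h2 : ComplexField.Normc.normc (2^-1 : R)%:C = 2^-1.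
  by rewrite normcR ger0_norm// invr_ge0.
(* [T] maps the ball of radius [q = |c| < 1] into itself, and is Lipschitz there with constant
   [(q + q) / 2 = q]. *)
have yq n : nrm (y n) <= q.
  elim: n => [|n IH]; first by rewrite nrm0.
  rewrite /= -/(y n) /T nrmZ h2 -ler_pdivlMl ?invr_gt0// invrK.
  have y2 : nrm (y n ** y n) <= q.
    rewrite (le_trans (nrmM _ _))// (le_trans (ler_pM _ _ IH IH)) ?nrm_ge0//.
    by rewrite ler_piMr// ltW.
  by have := ler_nrmD c (y n ** y n); rewrite -/q; lra.
have Tlip u v : nrm u <= q -> nrm v <= q -> nrm (T u - T v) <= q * nrm (u - v).
  move=> uq vq; rewrite /T -scalerBr opprD addrACA subrr add0r nrmZ h2.
  have -> : u ** u - v ** v = u ** (u - v) + (u - v) ** v.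
    by rewrite cmulBr cmulBl addrA subrK.
  rewrite -ler_pdivlMl ?invr_gt0// invrK.
  rewrite (le_trans (ler_nrmD _ _))//.
  have := le_trans (nrmM u (u - v)) (ler_wpM2r (nrm_ge0 _) uq).
  have := le_trans (nrmM (u - v) v) (ler_wpM2l (nrm_ge0 _) vq).
  by rewrite [nrm (u - v) * q]mulrC; lra.
have dist n k : nrm (y n - y (n + k)%N) <= q ^+ n * q.
  elim: n => [|n IH].
    by rewrite expr0 mul1r [y 0%N]/(0 : A) sub0r nrmN add0n.
  rewrite addSn /= -/(y n) -/(y (n + k)%N) exprS -mulrA.
  by rewrite (le_trans (Tlip _ _ _ _))// ler_wpM2l.
have [|l yl] := @nrm_complete R A y.
  move=> e e0.
  have [N HN] : exists N, q ^+ N < e.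
    have := @cvg_expr R q _; rewrite ger0_norm// => /(_ c1).
    move/cvgr0Pnorm_lt => /(_ _ e0)[N _ /(_ N (leqnn N))].
    by exists N; rewrite -[ltLHS]ger0_norm// exprn_ge0.
  exists N => n Nn; rewrite -(subnKC Nn) (le_trans (dist _ _))//.
  rewrite (le_trans _ (ltW HN))// ler_piMr ?exprn_ge0// ltW//.
have lq : nrm l <= q.
  apply/ler_addgt0Pl => e /yl[N /(_ N (leqnn N)) h].
  rewrite -[l](subrK (y N)) (le_trans (ler_nrmD _ _))// lerD//.
have lT : l = T l.
  apply: nrm_le_eps => e e0; have e20 : 0 < e / 2 by rewrite divr_gt0.
  have [N HN] := yl _ e20.
  have h1 := HN _ (leqnSn N); have h2' := HN _ (leqnn N).
  rewrite (le_trans (ler_nrm_dist _ (y N.+1) _))//.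
  have := Tlip (y N) l (yq _) lq; rewrite (nrmB (y N)) -[T (y N)]/(y N.+1) => h3.
  have : q * nrm (l - y N) <= nrm (l - y N) by rewrite ler_piMl ?nrm_ge0// ltW.
  by lra.
have star_y n : cstar (y n) = y n.
  elim: n => [|n IH]; first exact: cstar0.
  rewrite /= -/(y n) /T cstarZ cstarD cstarM IH cc; congr (_ *: _).
  exact: conjc_real.
have l_star : cstar l = l.
  apply: nrm_le_eps => e e0; have e20 : 0 < e / 2 by rewrite divr_gt0.
  have [N /(_ N (leqnn N)) HN] := yl _ e20.
  rewrite (le_trans (ler_nrm_dist _ (y N) _))//.
  have -> : cstar l - y N = cstar (l - y N) by rewrite cstarB star_y.
  by rewrite nrm_cstar [nrm (y N - l)]nrmB; lra.
have comm_y b n : b ** c = c ** b -> b ** y n = y n ** b.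
  move=> bc; elim: n => [|n IH]; first by rewrite cmul0l cmul0r.
  rewrite /= -/(y n) /T cmulZl cmulZr cmulDl cmulDr bc cmulA IH.
  by rewrite -!cmulA IH.
have comm_l b : b ** c = c ** b -> b ** l = l ** b.
  move=> bc; apply: nrm_le_eps => e e0.
  have b1 : 0 < 2 * nrm b + 1 by have := nrm_ge0 b; lra.
  have [N /(_ N (leqnn N)) HN] := yl _ (divr_gt0 e0 b1).
  rewrite (le_trans (ler_nrm_dist _ (b ** y N) _))// -cmulBr comm_y// -cmulBl.
  have := nrmM b (l - y N); have := nrmM (y N - l) b; rewrite (nrmB (y N)) => t1 t2.
  have : nrm (l - y N) * (2 * nrm b + 1) <= e by rewrite -ler_pdivlMr.
  by have := nrm_ge0 (l - y N); rewrite mulrC; lra.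
exists (cone - l); split.
- by rewrite cstarB cstar1 l_star.
- rewrite cmulBl cmul1l cmulBr cmul1r.
  have : l + l = c + l ** l.
    rewrite {1 2}lT /T -scalerDl -rmorphD /=.
    by rewrite (_ : 2^-1 + 2^-1 = 1 :> R) ?scale1r//; field.
  move=> h; have -> : c = l + l - l ** l by rewrite h addrK.
  by rewrite !opprD !opprK !addrA.
- by move=> b /comm_l bl; rewrite cmulBl cmulBr cmul1l cmul1r bl.
Qed.
End CstarBasics.

(** * Contractivity of homomorphisms *)

Section StarHom.
Variables (R : realType) (A B : cstarAlgType R).
Local Notation normc := ComplexField.Normc.normc.

Record star_hom (phi : A -> B) : Prop := {
  shD : forall a b, phi (a + b) = phi a + phi b;
  shZ : forall (z : R[i]) a, phi (z *: a) = z *: phi a;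
  shM : forall a b, phi (a ** b) = phi a ** phi b;
  sh_star : forall a, phi (cstar a) = cstar (phi a);
  sh1 : phi cone = cone
}.

(* A self-adjoint h with |h| < 1 is the mean of the unitaries
   h +/- i sqrt (1 - h^2). *)
Lemma star_hom_contraction phi a : star_hom phi -> nrm (phi a) <= nrm a.
Proof.
move=> hphi.
have i2 : ('i : R[i]) * 'i = -1 by rewrite -expr2 sqr_i.
have ci : conjc ('i : R[i]) = - 'i by apply/eqP; rewrite eq_complex /= oppr0 !eqxx.
have sa h : cstar h = h -> nrm h < 1 -> nrm (phi h) <= 1.
  move=> hh h1.
  have [] := @cstar_sqrt R A (h ** h); first by rewrite cstarM hh.
    by rewrite -{1}hh nrm_starM expr_lt1// nrm_ge0.
  move=> x [xx x2 xcomm].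
  have hx : h ** x = x ** h by apply: xcomm; rewrite cmulA.
  (* For [s = i] and [s = -i] the cross terms of [(h + s x)^* (h + s x)] cancel because [h] and [x]
     commute, and [h^2 + x^2 = 1] remains. *)
  have uni (s : R[i]) : conjc s = - s -> s * s = -1 -> nrm (phi (h + s *: x)) <= 1.
    move=> cs s2.
    rewrite -(@expr_le1 _ 2)// ?nrm_ge0// -nrm_starM -(sh_star hphi) -(shM hphi).
    rewrite cstarD cstarZ cs hh xx cmulDl !cmulDr !cmulZl !cmulZr hx x2.
    rewrite scalerA mulNr s2 opprK scale1r scaleNr addrA addrK.
    by rewrite addrC subrK (sh1 hphi) nrm_cone_le1.
  have u1 := uni 'i ci i2.
  have u2 : nrm (phi (h + (- 'i) *: x)) <= 1.
    apply: uni; last by rewrite mulrNN.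
    by apply/eqP; rewrite eq_complex /= ?oppr0 ?opprK !eqxx.
  have E : phi h = (2^-1 : R)%:C *: (phi (h + 'i *: x) + phi (h + (- 'i) *: x)).
    rewrite -(shD hphi) addrACA -scalerDl subrr scale0r addr0 -(shZ hphi).
    suff -> : (2^-1 : R)%:C *: (h + h) = h by [].
    rewrite -{1 2}[h]scale1r -scalerDl scalerA.
    rewrite (_ : (2^-1 : R)%:C * (1 + 1) = 1) ?scale1r//.
    by apply/eqP; rewrite eq_complex /=; apply/andP; split; apply/eqP; field.
  rewrite E nrmZ normcR ger0_norm ?invr_ge0// -ler_pdivlMl ?invr_gt0// invrK mulr1.
  by rewrite (le_trans (ler_nrmD _ _))//; lra.
(* The C*-identity reduces an arbitrary element to the self-adjoint [cstar b ** b]. *)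
have gen b : nrm b < 1 -> nrm (phi b) <= 1.
  move=> b1; rewrite -(@expr_le1 _ 2)// ?nrm_ge0// -nrm_starM.
  rewrite -(sh_star hphi) -(shM hphi); apply: sa.
    by rewrite cstarM cstarK.
  by rewrite nrm_starM expr_lt1// nrm_ge0.
apply/ler_addgt0Pl => e e0; set t := e + _.
have t0 : 0 < t by rewrite ltr_pwDl ?nrm_ge0.
have nz (b : A) : nrm ((t^-1)%:C *: b) = t^-1 * nrm b.
  by rewrite nrmZ normcR ger0_norm// invr_ge0 ltW.
have := gen ((t^-1)%:C *: a); rewrite nz (shZ hphi) nrmZ normcR.
rewrite ger0_norm ?invr_ge0 ?(ltW t0)// !(mulrC t^-1) ltr_pdivrMr// ler_pdivrMr//.
by rewrite !mul1r; apply; rewrite /t; lra.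
Qed.

End StarHom.

(** * Extension of contractive relations by density *)

Section Extension.
Variables (R : realType) (A B : cstarAlgType R) (P : A -> B -> Prop).
Local Notation normc := ComplexField.Normc.normc.
Hypothesis PD : forall a b a' b', P a b -> P a' b' -> P (a + a') (b + b').
Hypothesis PZ : forall (z : R[i]) a b, P a b -> P (z *: a) (z *: b).
Hypothesis PM : forall a b a' b', P a b -> P a' b' -> P (a ** a') (b ** b').
Hypothesis PS : forall a b, P a b -> P (cstar a) (cstar b).
Hypothesis P1 : P cone cone.
Hypothesis Pcontr : forall a b, P a b -> nrm b <= nrm a.
Hypothesis Pdense : forall a (e : R), 0 < e ->
  exists a' b', P a' b' /\ nrm (a - a') <= e.

(** The closure of the graph [P]. A relation is used because one element has many expressions as a
    finite sum; single-valuedness is then a consequence of [Pcontr]. *)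
Let Rel a b := forall e : R, 0 < e ->
  exists a' b', [/\ P a' b', nrm (a - a') <= e & nrm (b - b') <= e].

Let PB a b a' b' : P a b -> P a' b' -> P (a - a') (b - b').
Proof. by move=> h /(PZ (-1)); rewrite !scaleN1r; exact: PD. Qed.

Let Rel_P a b : P a b -> Rel a b.
Proof. by move=> h e e0; exists a, b; rewrite !subrr !nrm0 ltW. Qed.

Let Rel_unique a b1 b2 : Rel a b1 -> Rel a b2 -> b1 = b2.
Proof.
move=> h1 h2; apply: nrm_le_eps => e e0.
have e4 : 0 < e / 4 by rewrite divr_gt0.
have [a1 [c1 [P1' a1e c1e]]] := h1 _ e4.
have [a2 [c2 [P2 a2e c2e]]] := h2 _ e4.
have := Pcontr (PB P1' P2).
have := ler_nrm_dist a1 a a2; rewrite (nrmB a1 a) => t1.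
have := ler_nrm_dist b1 c1 b2; have := ler_nrm_dist c1 c2 b2.
rewrite (nrmB c2 b2); lra.
Qed.

Let Rel_ex a : exists b, Rel a b.
Proof.
have pos n : (0 : R) < n.+1%:R^-1 by rewrite invr_gt0.
have ex n : exists u : A * B, P u.1 u.2 /\ nrm (a - u.1) <= n.+1%:R^-1.
  by have [a' [b' h]] := Pdense a (pos n); exists (a', b').
have [u Hu] := choice ex.
have small e : 0 < e -> exists N, forall n, (N <= n)%N -> n.+1%:R^-1 <= e :> R.
  move=> e0; exists (Num.truncn e^-1) => n Nn.
  rewrite -[leRHS]invrK lef_pV2 ?posrE ?invr_gt0//.
  rewrite (le_trans (ltW (truncnS_gt _)))// ler_nat ltnS//.
have dist n m : nrm ((u n).2 - (u m).2) <= n.+1%:R^-1 + m.+1%:R^-1.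
  rewrite (le_trans (Pcontr (PB (Hu n).1 (Hu m).1)))//.
  rewrite (le_trans (ler_nrm_dist _ a _))// lerD//; first by rewrite nrmB (Hu n).2.
  exact: (Hu m).2.
have [e e0|b Hb] := @nrm_complete R B (fun n => (u n).2).
  have [N HN] := small _ (divr_gt0 e0 (ltr0n R 2)); exists N => n Nn.
  rewrite (le_trans (dist _ _))// (le_trans (lerD (HN _ (leqnn N)) (HN _ Nn)))//.
  by rewrite -splitr.
exists b => e e0; have [N HN] := small e e0; have [M HM] := Hb e e0.
exists (u (maxn N M)).1, (u (maxn N M)).2; split; first exact: (Hu _).1.
  by rewrite (le_trans (Hu _).2)// HN// leq_maxl.
by rewrite HM// leq_maxr.
Qed.

Let mulE (D : cstarAlgType R) (a a' x x' : D) (K d : R) : 0 <= d -> d <= 1 ->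
  nrm a + nrm a' + 1 <= K -> nrm (a - x) <= d -> nrm (a' - x') <= d ->
  nrm (a ** a' - x ** x') <= K * d.
Proof.
move=> d0 d1 KE ax ax'.
have -> : a ** a' - x ** x' = a ** (a' - x') + (a - x) ** x'.
  by rewrite cmulBr cmulBl addrA subrK.
rewrite (le_trans (ler_nrmD _ _))//.
have x'1 : nrm x' <= nrm a' + 1.
  by have := ler_nrmB a' (a' - x'); rewrite subKr; lra.
have := le_trans (nrmM a (a' - x')) (ler_wpM2l (nrm_ge0 a) ax').
have := le_trans (nrmM (a - x) x') (ler_pM (nrm_ge0 _) (nrm_ge0 _) ax x'1).
have : (nrm a + nrm a' + 1) * d <= K * d by rewrite ler_wpM2r.
lra.
Qed.

(** Contractivity turns approximations of [a] into a Cauchy sequence in [B], so the closed graph is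
    that of a map defined everywhere. Each algebraic law follows from uniqueness of the value, since
    the closure respects the operations. *)
Lemma star_hom_extension :
  exists phi : A -> B, star_hom phi /\ forall a b, P a b -> phi a = b.
Proof.
have [phi Hphi] := choice Rel_ex.
exists phi; split; last by move=> a b /Rel_P; exact: Rel_unique.
split.
- move=> a b; apply: (Rel_unique (Hphi _)) => e e0.
  have e2 : 0 < e / 2 by rewrite divr_gt0.
  have [a1 [c1 [P1' ae ce]]] := Hphi a _ e2.
  have [a2 [c2 [P2 ae2 ce2]]] := Hphi b _ e2.
  exists (a1 + a2), (c1 + c2); split; first exact: PD.
    by rewrite opprD addrACA (le_trans (ler_nrmD _ _))//; lra.
  by rewrite opprD addrACA (le_trans (ler_nrmD _ _))//; lra.
- move=> z a; apply: (Rel_unique (Hphi _)) => e e0.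
  have K0 : 0 < normc z + 1 by rewrite ltr_wpDl ?normc_ge0.
  have [a1 [c1 [P1' ae ce]]] := Hphi a _ (divr_gt0 e0 K0).
  exists (z *: a1), (z *: c1); split; first exact: PZ.
    rewrite -scalerBr nrmZ.
    rewrite ler_pdivlMr// in ae; have := nrm_ge0 (a - a1); lra.
  rewrite -scalerBr nrmZ.
  rewrite ler_pdivlMr// in ce; have := nrm_ge0 (phi a - c1); lra.
- move=> a b; apply: (Rel_unique (Hphi _)) => e e0.
  pose K := nrm a + nrm b + nrm (phi a) + nrm (phi b) + 1.
  have := nrm_ge0 a; have := nrm_ge0 b; have := nrm_ge0 (phi a).
  have := nrm_ge0 (phi b) => n1 n2 n3 n4.
  have K0 : 0 < K by rewrite /K; lra.
  pose d := Num.min 1 (e / K).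
  have d0 : 0 < d by rewrite lt_min ltr01 divr_gt0.
  have d1 : d <= 1 by rewrite ge_min lexx.
  have dK : K * d <= e by rewrite mulrC -ler_pdivlMr// ge_min lexx orbT.
  have [a1 [c1 [P1' ae ce]]] := Hphi a _ d0.
  have [a2 [c2 [P2 ae2 ce2]]] := Hphi b _ d0.
  exists (a1 ** a2), (c1 ** c2); split; first exact: PM.
    by rewrite (le_trans _ dK)//; apply: mulE => //; rewrite ?(ltW d0)// /K; lra.
  by rewrite (le_trans _ dK)//; apply: mulE => //; rewrite ?(ltW d0)// /K; lra.
- move=> a; apply: (Rel_unique (Hphi _)) => e e0.
  have [a1 [c1 [P1' ae ce]]] := Hphi a _ e0.
  exists (cstar a1), (cstar c1); split; first exact: PS.
    by rewrite -cstarB nrm_cstar.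
  by rewrite -cstarB nrm_cstar.
- exact: Rel_unique (Hphi _) (Rel_P P1).
Qed.

End Extension.

(** * States: Cauchy-Schwarz and contractivity *)

Section StateTheory.
Variables (R : realType) (A : cstarAlgType R) (omega : A -> R[i]^o).
Hypothesis homega : is_state omega.
Local Notation normc := ComplexField.Normc.normc.
Local Notation Re := complex.Re.
Local Notation Im := complex.Im.
Implicit Types (a b : A).

Lemma stD a b : omega (a + b) = omega a + omega b.
Proof. by have [h _ _] := homega; have := h 1 a b; rewrite scale1r mul1r. Qed.

Lemma st0 : omega 0 = 0.
Proof. by apply: (addIr (omega 0)); rewrite -stD !add0r. Qed.

Lemma stZ z a : omega (z *: a) = z * omega a.
Proof. by have [h _ _] := homega; have := h z a 0; rewrite !addr0 st0 addr0. Qed.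

Lemma stN a : omega (- a) = - omega a.
Proof. by rewrite -scaleN1r stZ mulN1r. Qed.

Lemma stB a b : omega (a - b) = omega a - omega b.
Proof. by rewrite stD stN. Qed.

Lemma st_pos a : Im (omega (cstar a ** a)) = 0 /\ 0 <= Re (omega (cstar a ** a)).
Proof.
have [_ h _] := homega; have := h a.
by rewrite (lecE 0) /= => /andP[/eqP -> ->].
Qed.

Lemma cauchy_schwarz a b :
  normc (omega (cstar a ** b)) ^+ 2 <=
  Re (omega (cstar a ** a)) * Re (omega (cstar b ** b)).
Proof.
set S := omega (cstar a ** b).
have [aI aR] := st_pos a; have [bI bR] := st_pos b.
have expand z : omega (cstar (a + z *: b) ** (a + z *: b)) =
    omega (cstar a ** a) + z * S + conjc z * omega (cstar b ** a)
    + conjc z * z * omega (cstar b ** b).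
  rewrite cstarD cstarZ cmulDl !cmulDr !cmulZl !cmulZr !stD !stZ -/S !addrA.
  by rewrite mulrA.
(* Positivity makes the values at [z = 1] and [z = i] real, which forces hermitian symmetry. *)
have herm : omega (cstar b ** a) = conjc S.
  have [h1 _] := st_pos (a + 1 *: b); have [h2 _] := st_pos (a + 'i *: b).
  move: h1 h2; rewrite !expand; move: aI bI.
  case: (omega (cstar a ** a)) => a1 a2; case: (omega (cstar b ** b)) => b1 b2.
  case: (omega (cstar b ** a)) => s1 s2; case: (S) => t1 t2 /= -> -> h1 h2.
  by apply/eqP; rewrite eq_complex /=; apply/andP; split; apply/eqP; lra.
(* The choice [z = - t conj(S)] makes both cross terms equal to [- t |S|^2]. *)
have key (t : R) : 0 <= Re (omega (cstar a ** a)) - 2 * t * normc S ^+ 2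
    + t ^+ 2 * normc S ^+ 2 * Re (omega (cstar b ** b)).
  have [_] := st_pos (a + (- (t%:C * conjc S)) *: b).
  rewrite expand herm; move: bI.
  case: (omega (cstar a ** a)) => a1 a2; case: (omega (cstar b ** b)) => b1 b2.
  case: (S) => s1 s2 /= -> h; rewrite (sqr_sqrtr (addr_ge0 (sqr_ge0 s1) (sqr_ge0 s2))).
  apply: (le_trans h); rewrite le_eqVlt; apply/orP; left; apply/eqP; ring.
move: key aR bR; move: (Re _) => X; move: (Re _) => Y; move: (normc S ^+ 2) (sqr_ge0 (normc S)) => Q Q0 key X0.
(* If [Y = 0], the expression is affine in [t] and a large [t] makes it equal to -1; otherwise its
   minimum is at [t = 1 / Y]. *)
rewrite le_eqVlt => /predU1P[Y0|Y0].
  rewrite -Y0 mulr0 leNgt; apply/negP => Qp.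
  have := key ((X + 1) / (2 * Q)); rewrite -Y0 mulr0 addr0.
  rewrite (_ : 2 * _ * Q = X + 1); last by field; rewrite gt_eqF.
  lra.
have := key Y^-1.
rewrite (_ : _ + _ = X - Q / Y); last by field; rewrite gt_eqF.
by rewrite subr_ge0 ler_pdivrMr.
Qed.

(** For [t > |a|] the element [1 - a^* a / t^2] has a self-adjoint square root, so the state is
    nonnegative on it; then [t] decreases to [|a|]. *)
Lemma st_bound a : Re (omega (cstar a ** a)) <= nrm a ^+ 2.
Proof.
have om1 : omega cone = 1 by case: homega.
have H (t : R) : nrm a < t -> Re (omega (cstar a ** a)) <= t ^+ 2.
  move=> at'; have t0 : 0 < t := le_lt_trans (nrm_ge0 a) at'.
  have t20 : 0 < t ^+ 2 by rewrite exprn_gt0.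
  have [] := @cstar_sqrt R A ((t ^- 2)%:C *: (cstar a ** a)).
  - by rewrite cstarZ conjc_real cstarM cstarK.
  - rewrite nrmZ normcR ger0_norm ?invr_ge0 ?ltW// nrm_starM mulrC.
    by rewrite ltr_pdivrMr// mul1r ltr_pXn2r// ?nnegrE ?nrm_ge0// ltW.
  move=> x [xx x2 _]; have [_] := st_pos x; rewrite xx x2 stB stZ om1.
  case: (omega (cstar a ** a)) => p q /=.
  rewrite mul0r subr0 subr_ge0 mulrC ler_pdivrMr// mul1r; exact.
apply/ler_addgt0Pl => e e0.
pose n := nrm a; have n0 : 0 <= n := nrm_ge0 a.
pose d := Num.min 1 (e / (2 * n + 1)).
have k0 : 0 < 2 * n + 1 by lra.
have d0 : 0 < d by rewrite lt_min ltr01 divr_gt0.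
have d1 : d <= 1 by rewrite ge_min lexx.
have de : d * (2 * n + 1) <= e by rewrite -ler_pdivlMr// ge_min lexx orbT.
rewrite (le_trans (H (n + d) _)) ?ltrDl// -/n sqrrD.
have : d ^+ 2 <= d by rewrite expr2 ler_piMl// ltW.
rewrite mulr2n; lra.
Qed.

Lemma state_contraction a : normc (omega a) <= nrm a.
Proof.
have om1 : omega cone = 1 by case: homega.
have := cauchy_schwarz cone a; rewrite cstar1 !cmul1l om1 /= mul1r => h.
rewrite -(@ler_pXn2r _ 2)// ?nnegrE ?normc_ge0 ?nrm_ge0//.
exact: le_trans h (st_bound a).
Qed.

End StateTheory.

(** * Random walks, Green functions and Martin kernels *)

Section EsumTheory.
Variables (R : realType) (T : choiceType).
Implicit Types (f g : T -> \bar R).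
Local Open Scope ereal_scope.

Lemma sum_le_esum (F : seq T) f : (forall x, 0 <= f x) -> uniq F ->
  \sum_(x <- F) f x <= \esum_(x in [set: T]) f x.
Proof.
move=> f0 uF; apply: esum_ge; exists [set` F].
  by split => //; exact: finite_seq.
by rewrite -fsbig_seq.
Qed.

Lemma esum_le_sums f (c : \bar R) :
  (forall F : seq T, uniq F -> \sum_(x <- F) f x <= c) ->
  \esum_(x in [set: T]) f x <= c.
Proof.
move=> H; apply: ge_ereal_sup => _ [X [finX _] <-].
by rewrite fsbig_finite//= H.
Qed.

Lemma esumT_ge0 f : (forall x, 0 <= f x) -> 0 <= \esum_(x in [set: T]) f x.
Proof. by move=> f0; apply: esum_ge0. Qed.

Lemma le_esumT f g : (forall x, f x <= g x) ->
  \esum_(x in [set: T]) f x <= \esum_(x in [set: T]) g x.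
Proof. by move=> fg; apply: le_esum. Qed.

Lemma term_le_esum f x : (forall x, 0 <= f x) ->
  f x <= \esum_(x in [set: T]) f x.
Proof. by move=> f0; have := @sum_le_esum [:: x] f f0 isT; rewrite big_seq1. Qed.

Lemma esumZl (c : \bar R) f : 0 <= c -> (forall x, 0 <= f x) ->
  \esum_(x in [set: T]) (c * f x) = c * \esum_(x in [set: T]) f x.
Proof.
move=> c0 f0; apply/eqP; rewrite eq_le; apply/andP; split.
  apply: esum_le_sums => F uF; rewrite -ge0_sume_distrr//.
  by rewrite lee_wpmul2l// sum_le_esum.
have [->|cn0] := eqVneq c 0.
  by rewrite mul0e esumT_ge0// => x; rewrite mul0e.
have {}c0 : 0 < c by rewrite lt0e cn0.
case: c {cn0} c0 => [r r0| |]//.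
  rewrite muleC -lee_pdivlMr//; apply: esum_le_sums => F uF.
  rewrite lee_pdivlMr// muleC ge0_sume_distrr// sum_le_esum// => x.
  by rewrite mule_ge0// ltW.
move=> _; have [E|E] := eqVneq (\esum_(x in [set: T]) f x) 0.
  by rewrite E mule0 esumT_ge0// => x; rewrite mule_ge0.
have [x fx] : exists x, 0 < f x.
  apply/not_existsP => H; move/eqP: E; apply; apply: esum1 => x _.
  by apply/eqP; rewrite eq_le f0 andbT leNgt; apply/negP; exact: H.
apply: (@le_trans _ _ (+oo * f x)); first by rewrite (gt0_mulye fx) leey.
by apply: (@term_le_esum (fun x => +oo * f x)) => y; rewrite mule_ge0.
Qed.

Lemma esumZr (c : \bar R) f : 0 <= c -> (forall x, 0 <= f x) ->
  \esum_(x in [set: T]) (f x * c) = (\esum_(x in [set: T]) f x) * c.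
Proof.
by move=> c0 f0; rewrite muleC -esumZl//; apply: eq_esum => x _; rewrite muleC.
Qed.

Lemma esumDT f g : (forall x, 0 <= f x) -> (forall x, 0 <= g x) ->
  \esum_(x in [set: T]) (f x + g x) =
  \esum_(x in [set: T]) f x + \esum_(x in [set: T]) g x.
Proof. by move=> f0 g0; apply: esumD. Qed.

Lemma esum_delta (y : T) (f : T -> \bar R) : (forall x, 0 <= f x) ->
  \esum_(x in [set: T]) (if y == x then f x else 0) = f y.
Proof.
move=> f0; rewrite (esumID [set y]); last by move=> x _; case: ifP.
rewrite setTI esum_set1 ?eqxx// esum1 ?adde0// => x [_ /= /eqP].
by rewrite eq_sym => /negPf ->.
Qed.

End EsumTheory.

Lemma esum_exchange (R : realType) (S T : choiceType) (f : S -> T -> \bar R) :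
  (forall x y, (0 <= f x y)%E) ->
  (\esum_(x in [set: S]) \esum_(y in [set: T]) f x y =
   \esum_(y in [set: T]) \esum_(x in [set: S]) f x y)%E.
Proof.
move=> f0; rewrite !esum_esum//.
apply: (@reindex_esum R _ _ ([set: T] `*`` (fun=> [set: S])) _ (fun p => (p.2, p.1))).
split => //.
  by move=> [a b] [c d] _ _ /= [-> ->].
by move=> [a b] _; exists (b, a).
Qed.

(** * The Markov operator and the Green function *)

Section WalkTheory.
Variables (R : realType) (Gam : groupType) (mu : Gam -> R).
Hypothesis hmu : random_walk mu.
Local Open Scope ereal_scope.
Local Notation G := (green mu).
Implicit Types (x y g s : Gam) (f : Gam -> \bar R).

Lemma mu_ge0 g : (0 <= mu g)%R.
Proof. by have /andP[] := rw_itv hmu g. Qed.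

Lemma muE_ge0 g : 0 <= (mu g)%:E.
Proof. by rewrite lee_fin mu_ge0. Qed.

Lemma mu_pow_ge0 n x y : 0 <= mu_pow mu n x y.
Proof.
elim: n y => [|n IH] y /=; first by case: ifP.
by apply: esumT_ge0 => z; rewrite mule_ge0// muE_ge0.
Qed.

(** [mu_pow] splits off the last step of the walk. Splitting off the first one gives left invariance
    and the mean value property of the Green function in its first variable. *)
Lemma mu_powS n x y : mu_pow mu n.+1 x y =
  \esum_(s in [set: Gam]) ((mu s)%:E * mu_pow mu n (x * s)%g y).
Proof.
elim: n y => [|n IH] y.
  rewrite /=.
  transitivity (\esum_(z in [set: Gam]) if x == z then (mu (z^-1 * y)%g)%:E else 0).
    by apply: eq_esum => z _; case: ifP; rewrite ?mul1e ?mul0e.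
  rewrite esum_delta; last by move=> z; exact: muE_ge0.
  rewrite -(@esum_delta _ _ (x^-1 * y)%g (fun s => (mu s)%:E)); last exact: muE_ge0.
  apply: eq_esum => s _; have -> : ((x * s)%g == y) = ((x^-1 * y)%g == s).
    by apply/eqP/eqP => [<-|<-]; rewrite ?mulKg ?mulVKg.
  by case: ifP; rewrite ?mule1 ?mule0.
rewrite [LHS]/=.
transitivity (\esum_(z in [set: Gam]) \esum_(s in [set: Gam])
   ((mu s)%:E * mu_pow mu n (x * s)%g z * (mu (z^-1 * y)%g)%:E)).
  apply: eq_esum => z _; rewrite -[X in X * _]/(mu_pow mu n.+1 x z) IH.
  rewrite -esumZr ?muE_ge0// => s.
  by rewrite mule_ge0 ?muE_ge0 ?mu_pow_ge0.
rewrite esum_exchange; last first.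
  by move=> z s; rewrite !mule_ge0 ?muE_ge0 ?mu_pow_ge0.
apply: eq_esum => s _; rewrite /= -esumZl ?muE_ge0//.
  by apply: eq_esum => z _; rewrite muleA.
by move=> z; rewrite !mule_ge0 ?muE_ge0 ?mu_pow_ge0.
Qed.

Lemma mu_pow_invariant n g x y : mu_pow mu n (g * x)%g (g * y)%g = mu_pow mu n x y.
Proof.
elim: n x => [|n IH] x; first by rewrite /= (inj_eq (mulgI g)).
by rewrite !mu_powS; apply: eq_esum => s _; rewrite -mulgA IH.
Qed.

Lemma mu_sum1 : \esum_(s in [set: Gam]) (mu s)%:E = 1.
Proof. exact: rw_sum1 hmu. Qed.

Lemma mu_pow_sum1 n x : \esum_(y in [set: Gam]) mu_pow mu n x y = 1.
Proof.
elim: n x => [|n IH] x.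
  by rewrite (@esum_delta _ _ x (fun=> 1)).
under eq_esum do rewrite mu_powS.
rewrite esum_exchange; last by move=> *; rewrite mule_ge0 ?muE_ge0 ?mu_pow_ge0.
rewrite -[RHS]mu_sum1; apply: eq_esum => s _.
by rewrite esumZl ?IH ?mule1 ?muE_ge0// => y; exact: mu_pow_ge0.
Qed.

(** The Markov operator of the walk. *)
Definition step f x := \esum_(s in [set: Gam]) ((mu s)%:E * f (x * s)%g).

Lemma step_ge0 f x : (forall y, 0 <= f y) -> 0 <= step f x.
Proof. by move=> f0; apply: esumT_ge0 => s; rewrite mule_ge0// muE_ge0. Qed.

Lemma iter_step_ge0 n f x : (forall y, 0 <= f y) -> 0 <= iter n step f x.
Proof. by move=> f0; elim: n x => [|n IH] x //=; exact: step_ge0. Qed.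

Lemma le_step f f' x : (forall y, f y <= f' y) -> step f x <= step f' x.
Proof. by move=> ff'; apply: le_esumT => s; rewrite lee_wpmul2l// muE_ge0. Qed.

Lemma le_iter_step n f f' x : (forall y, f y <= f' y) ->
  iter n step f x <= iter n step f' x.
Proof. by move=> ff'; elim: n x => [|n IH] x //=; exact: le_step. Qed.

Lemma stepD f f' x : (forall y, 0 <= f y) -> (forall y, 0 <= f' y) ->
  step (fun y => f y + f' y) x = step f x + step f' x.
Proof.
move=> f0 f'0; rewrite /step -esumDT.
- by apply: eq_esum => s _; rewrite ge0_muleDr.
- by move=> s; rewrite mule_ge0// muE_ge0.
- by move=> s; rewrite mule_ge0// muE_ge0.
Qed.

Lemma step_cst (c : \bar R) x : 0 <= c -> step (fun=> c) x = c.
Proof. by move=> c0; rewrite /step esumZr ?mu_sum1 ?mul1e//; exact: muE_ge0. Qed.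

Lemma iter_stepE n f x : (forall y, 0 <= f y) ->
  iter n step f x = \esum_(y in [set: Gam]) (mu_pow mu n x y * f y).
Proof.
move=> f0; elim: n x => [|n IH] x.
  rewrite -[LHS](@esum_delta _ _ x f)//; apply: eq_esum => y _ /=.
  by case: ifP; rewrite ?mul1e ?mul0e.
rewrite /= /step.
under [LHS]eq_esum do rewrite IH.
under [RHS]eq_esum => y _.
  rewrite -[X in X * _]/(mu_pow mu n.+1 x y) mu_powS -esumZr//; last first.
    by move=> s; rewrite mule_ge0 ?muE_ge0 ?mu_pow_ge0.
  over.
rewrite [RHS]esum_exchange; last first.
  by move=> y s; rewrite !mule_ge0 ?muE_ge0 ?mu_pow_ge0.
apply: eq_esum => s _; rewrite -esumZl ?muE_ge0//.
  by apply: eq_esum => y _; rewrite muleA.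
by move=> y; rewrite mule_ge0 ?mu_pow_ge0.
Qed.

Lemma greenE x y : G x y = \esum_(n in [set: nat]) mu_pow mu n x y.
Proof. by rewrite /green nneseries_esumT// => n; exact: mu_pow_ge0. Qed.

Lemma green_ge0 x y : 0 <= G x y.
Proof. by rewrite greenE; apply: esumT_ge0 => n; exact: mu_pow_ge0. Qed.

Lemma green_invariant g x y : G (g * x)%g (g * y)%g = G x y.
Proof. by rewrite !greenE; apply: eq_esum => n _; rewrite mu_pow_invariant. Qed.

(** The term of time 0 is the point mass, and the later terms are split at their first step; off the
    diagonal this is harmonicity. *)
Lemma green_step x y : G x y =
  (if x == y then 1 else 0) + \esum_(s in [set: Gam]) ((mu s)%:E * G (x * s)%g y).
Proof.
have p0 n : 0 <= mu_pow mu n x y by exact: mu_pow_ge0.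
rewrite /green nneseries_recl//.
congr (_ + _); rewrite -(nneseries_addn 1)//.
rewrite nneseries_esumT//.
under eq_esum do rewrite addn1 mu_powS.
rewrite esum_exchange; last by move=> *; rewrite mule_ge0 ?muE_ge0 ?mu_pow_ge0.
apply: eq_esum => s _; rewrite esumZl ?muE_ge0//; last first.
  by move=> n; exact: mu_pow_ge0.
by rewrite -greenE.
Qed.

Lemma mu_pow_prod (l : seq Gam) x : (forall s, s \in l -> (0 < mu s)%R) ->
  0 < mu_pow mu (size l) x (x * \prod_(s <- l) s)%g.
Proof.
elim: l x => [|s l IH] x hl.
  by rewrite big_nil mulg1 /= eqxx.
rewrite big_cons mu_powS mulgA.
have hs : (0 < mu s)%R by apply: hl; rewrite mem_head.
apply: (@lt_le_trans _ _ ((mu s)%:E * mu_pow mu (size l) (x * s)%g (x * s * \prod_(s <- l) s)%g)).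
  by rewrite mule_gt0 ?lte_fin// IH// => t tl; apply: hl; rewrite inE tl orbT.
apply: (@term_le_esum _ _ (fun t => (mu t)%:E * mu_pow mu (size l) (x * t)%g (x * s * \prod_(s <- l) s)%g)) => t.
by rewrite mule_ge0 ?muE_ge0 ?mu_pow_ge0.
Qed.

Lemma mu_pow_gt0 x y : exists n, 0 < mu_pow mu n x y.
Proof.
have [l [_ hl E]] := rw_generates hmu (x^-1 * y)%g.
exists (size l); have := @mu_pow_prod l x hl.
by rewrite -E mulVKg.
Qed.

Lemma green_gt0 x y : 0 < G x y.
Proof.
have [n hn] := mu_pow_gt0 x y; apply: (lt_le_trans hn); rewrite greenE.
by apply: (@term_le_esum _ _ (fun n => mu_pow mu n x y)) => m; exact: mu_pow_ge0.
Qed.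

Hypothesis htrans : transient mu.

Lemma greenR_E x y : G x y = (greenR mu x y)%:E.
Proof.
rewrite /greenR fineK// ge0_fin_numE ?green_ge0//; exact: htrans.
Qed.

Lemma greenR_gt0 x y : (0 < greenR mu x y)%R.
Proof. by rewrite -lte_fin -greenR_E green_gt0. Qed.

Lemma greenR_invariant g x y : greenR mu (g * x)%g (g * y)%g = greenR mu x y.
Proof. by rewrite /greenR green_invariant. Qed.

End WalkTheory.

Section RealContinuity.
Variables (R : realType) (T : topologicalType).
Implicit Types (f g : T -> R).

Lemma continuous_cst_real (c : R) : continuous (fun _ : T => c).
Proof. by move=> x; exact: cst_continuous. Qed.

Lemma continuous_add_real f g : continuous f -> continuous g ->
  continuous (fun x => f x + g x).
Proof. by move=> cf cg x; apply: continuousD; [exact: cf|exact: cg]. Qed.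

Lemma continuous_sub_real f g : continuous f -> continuous g ->
  continuous (fun x => f x - g x).
Proof. by move=> cf cg x; apply: continuousB; [exact: cf|exact: cg]. Qed.

Lemma continuous_mul_real f g : continuous f -> continuous g ->
  continuous (fun x => f x * g x).
Proof. by move=> cf cg x; apply: (@continuousM R T); [exact: cf|exact: cg]. Qed.

Lemma continuous_sum_real (I : Type) (F : seq I) (f : I -> T -> R) :
  (forall i, continuous (f i)) -> continuous (fun x => \sum_(i <- F) f i x).
Proof.
move=> cf; elim: F => [|i F IH].
  rewrite (_ : (fun _ => _) = (fun=> 0)); first exact: continuous_cst_real.
  by apply/funext => y; rewrite big_nil.
rewrite (_ : (fun _ => _) = (fun y => f i y + \sum_(i <- F) f i y)).
  exact: continuous_add_real.
by apply/funext => y; rewrite big_cons.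
Qed.
End RealContinuity.

Section FiniteSums.
Variables (R : realType) (T : choiceType).
Implicit Types (F : seq T) (a : T -> R).

Lemma ler_sum_subset F1 F2 a : (forall x, 0 <= a x) -> uniq F1 ->
  {subset F1 <= F2} -> \sum_(x <- F1) a x <= \sum_(x <- F2) a x.
Proof.
move=> a0; elim: F1 F2 => [|x F1 IH] F2 /=.
  by rewrite big_nil sumr_ge0.
move=> /andP[xF1 uF1] sub; have xF2 : x \in F2 by apply: sub; rewrite mem_head.
rewrite big_cons (big_rem x xF2)/= lerD2l IH// => y yF1.
have yx : y != x by apply: contraNneq xF1 => <-.
have : y \in F2 by apply: sub; rewrite inE yF1 orbT.
by rewrite (perm_mem (perm_to_rem xF2)) inE (negPf yx).
Qed.

(** A state commutes with finite sums only, so infinite sums are replaced by these two bounds on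
    their finite parts. *)
Lemma esumEFin_sums a : (forall x, 0 <= a x) ->
  (\esum_(x in [set: T]) (a x)%:E < +oo)%E ->
  let t := fine (\esum_(x in [set: T]) (a x)%:E) in
  (forall F, uniq F -> \sum_(x <- F) a x <= t) /\
  forall e : R, 0 < e -> exists2 F, uniq F & t - \sum_(x <- F) a x <= e.
Proof.
move=> a0 fin t.
have tE : (\esum_(x in [set: T]) (a x)%:E = t%:E)%E.
  by rewrite fineK// ge0_fin_numE// esumT_ge0// => x; rewrite lee_fin.
have bnd F : uniq F -> \sum_(x <- F) a x <= t.
  by move=> uF; rewrite -lee_fin -tE -sumEFin; apply: sum_le_esum => // x; rewrite lee_fin.
split=> // e e0; apply: contrapT => H.
have : (t%:E <= (t - e)%:E)%E.
  rewrite -tE; apply: esum_le_sums => F uF; rewrite sumEFin lee_fin.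
  rewrite leNgt; apply/negP => h; apply: H; exists F => //; lra.
by rewrite lee_fin; lra.
Qed.

Lemma esumEFin_eq a (c : R) : (forall x, 0 <= a x) ->
  (forall F, uniq F -> \sum_(x <- F) a x <= c) ->
  (forall e : R, 0 < e -> exists2 F, uniq F & c - \sum_(x <- F) a x <= e) ->
  (\esum_(x in [set: T]) (a x)%:E = c%:E)%E.
Proof.
move=> a0 H1 H2; apply/eqP; rewrite eq_le; apply/andP; split.
  by apply: esum_le_sums => F uF; rewrite sumEFin lee_fin H1.
apply/lee_addgt0Pr => e e0; have [F uF HF] := H2 e e0.
apply: (@le_trans _ _ ((\sum_(x <- F) a x)%:E + e%:E)%E).
  by rewrite -EFinD lee_fin; lra.
by rewrite leeD2r// -sumEFin; apply: sum_le_esum => // x; rewrite lee_fin.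
Qed.

End FiniteSums.

(** * Harnack bounds and the kernels on the boundary *)

Section KernelTheory.
Variables (R : realType) (Gam : groupType) (mu : Gam -> R).
Hypotheses (hmu : random_walk mu) (htrans : transient mu).
Variables (S : seq Gam) (d : Gam -> Gam -> nat) (hd : is_word_metric S d).
Variables (C : R) (hC : 0 < C) (hharnack : harnack mu d C).
Hypothesis hmoment : moment_condition mu d C.
Local Notation K := (martin_kernel mu).
Local Notation g1 := (greenR mu).
Implicit Types (g h s x y : Gam).

Lemma word_metric_eq x y x' y' : (x^-1 * y = x'^-1 * y')%g -> d x y = d x' y'.
Proof.
have le a b a' b' : (a^-1 * b = a'^-1 * b')%g -> (d a b <= d a' b')%N.
  move=> E; have [l [<- lS lE]] := wm_attained hd a' b'.
  by apply: (wm_minimal hd) => //; rewrite E.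
by move=> E; apply/eqP; rewrite eqn_leq !le.
Qed.

Lemma kernel_gt0 g h : 0 < K g h.
Proof. by rewrite divr_gt0// greenR_gt0. Qed.

Lemma kernel1 h : K 1%g h = 1.
Proof. by rewrite /martin_kernel divff// gt_eqF// greenR_gt0. Qed.

Lemma kernel_le g h : K g h <= C ^+ d g 1%g.
Proof. exact: hharnack. Qed.

Lemma kernel_ge g h : (C ^+ d 1%g g)^-1 <= K g h.
Proof.
rewrite -[leRHS]invrK lef_pV2 ?posrE ?exprn_gt0 ?invr_gt0 ?kernel_gt0//.
by rewrite /martin_kernel invf_div; exact: hharnack.
Qed.

(** The distance from [g s] to [g] is that from [s] to [e] by left invariance, so the Harnack factor
    depends on the step alone. *)
Lemma kernel_mul_le g s h : K (g * s)%g h <= C ^+ d s 1%g * K g h.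
Proof.
have -> : d s 1%g = d (g * s)%g g.
  by apply: word_metric_eq; rewrite mulg1 invgM -mulgA mulVg mulg1.
rewrite /martin_kernel mulrA ler_pM2r ?invr_gt0 ?greenR_gt0//.
by rewrite -ler_pdivrMr ?greenR_gt0//; exact: hharnack.
Qed.

Lemma kernel_cocycle g x h : K x (g * h)%g * K g^-1%g h = K (g^-1 * x)%g h.
Proof.
rewrite /martin_kernel.
have -> : g1 x (g * h)%g = g1 (g^-1 * x)%g h.
  by rewrite -(greenR_invariant hmu g (g^-1 * x)%g h) mulVKg.
have -> : g1 1%g (g * h)%g = g1 g^-1%g h.
  by rewrite -(greenR_invariant hmu g g^-1%g h) mulgV.
by field; rewrite !gt_eqF ?greenR_gt0.
Qed.

Definition moment_sum : R := fine (\esum_(g in [set: Gam]) (mu g * C ^+ d g 1%g)%:E).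

(** By the Harnack inequality, the steps outside [F] contribute at most this multiple of [K g] to
    the mean value at [g]. *)
Definition moment_tail (F : seq Gam) : R :=
  moment_sum - \sum_(s <- F) mu s * C ^+ d s 1%g.

Lemma moment_term_ge0 s : 0 <= mu s * C ^+ d s 1%g.
Proof. by rewrite mulr_ge0 ?mu_ge0// exprn_ge0// ltW. Qed.

Lemma moment_tail_small (e : R) : 0 < e -> exists2 F, uniq F & moment_tail F <= e.
Proof. by have [_ h] := esumEFin_sums moment_term_ge0 hmoment; exact: h. Qed.

Lemma moment_tail_mono F F' : uniq F -> {subset F <= F'} ->
  moment_tail F' <= moment_tail F.
Proof.
move=> uF sub; rewrite lerD2l lerN2.
by apply: ler_sum_subset => // s; exact: moment_term_ge0.
Qed.

Lemma kernel_step_le F g h : uniq F -> g != h ->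
  \sum_(s <- F) mu s * K (g * s)%g h <= K g h.
Proof.
move=> uF gh.
rewrite /martin_kernel.
under eq_bigr do rewrite mulrA.
rewrite -mulr_suml ler_pM2r ?invr_gt0 ?greenR_gt0//.
rewrite -lee_fin -greenR_E// green_step// (negPf gh) add0e -sumEFin.
under eq_bigr do rewrite EFinM -greenR_E//.
by apply: sum_le_esum => // s; rewrite mule_ge0 ?muE_ge0 ?green_ge0.
Qed.

(** The bound is uniform in [h], hence a closed condition that passes to boundary points. The
    restriction [g != h] leaves out the point mass in [green_step]. *)
Lemma kernel_step_ge F g h : uniq F -> g != h ->
  K g h - \sum_(s <- F) mu s * K (g * s)%g h <= moment_tail F * K g h.
Proof.
move=> uF gh.
rewrite lerBlDr -[in leRHS]/(K g h).
have G0 x y : 0 < g1 x y by exact: greenR_gt0.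
suff : g1 g h <= moment_tail F * g1 g h + \sum_(s <- F) mu s * g1 (g * s)%g h.
  move=> H; have : g1 g h / g1 1%g h <= (moment_tail F * g1 g h +
      \sum_(s <- F) mu s * g1 (g * s)%g h) / g1 1%g h.
    by rewrite ler_pM2r ?invr_gt0.
  rewrite mulrDl mulr_suml -mulrA => /le_trans; apply.
  by rewrite lerD2l; apply: ler_sum => s _; rewrite mulrA.
rewrite -lee_fin -[in X in (X <= _)%E]greenR_E// green_step// (negPf gh) add0e.
apply: esum_le_sums => F' uF'.
under eq_bigr do rewrite greenR_E// -EFinM.
rewrite sumEFin lee_fin.
rewrite (bigID (fun s => s \in F))/= addrC lerD//; last first.
  rewrite -big_filter; apply: ler_sum_subset.
  - by move=> s; rewrite mulr_ge0 ?(mu_ge0 hmu)// (ltW (G0 _ _)).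
  - exact: filter_uniq.
  - by move=> s; rewrite mem_filter => /andP[].
apply: (@le_trans _ _ (\sum_(s <- F' | s \notin F) (mu s * C ^+ d s 1%g) * g1 g h)).
  apply: ler_sum => s _; rewrite -mulrA ler_wpM2l ?mu_ge0//.
  have := kernel_mul_le g s h.
  by rewrite /martin_kernel mulrA ler_pM2r// invr_gt0.
rewrite -mulr_suml ler_pM2r// /moment_tail lerBrDl.
have [H _] := esumEFin_sums moment_term_ge0 hmoment.
have := H (F ++ [seq s <- F' | s \notin F]).
rewrite big_cat/= big_filter; apply.
rewrite cat_uniq uF filter_uniq// andbT; apply/hasPn => s.
by rewrite mem_filter => /andP[].
Qed.

Variable W : martin_compactification mu.

(* A boundary point is a limit of group elements different from any given one. *)
Lemma boundary_closure_ge0 (phi : W -> R) g : continuous phi ->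
  (forall h, g != h -> 0 <= phi (mc_emb W h)) ->
  forall xi, ~ range (mc_emb W) xi -> 0 <= phi xi.
Proof.
move=> cphi H xi hxi; rewrite leNgt; apply/negP => neg.
pose O := (phi @^-1` [set x | x < 0]) `&` ~` [set mc_emb W g].
have oO : open O.
  apply: openI.
    by apply: open_comp; [move=> x _; exact: cphi|exact: open_lt].
  apply: closed_openC; apply: accessible_closed_set1.
  exact: hausdorff_accessible (@metric_hausdorff _ _).
have [] := @mc_emb_dense _ _ _ W O _ oO.
  exists xi; split => //; rewrite /setC/= => E; apply: hxi; exists g => //.
move=> x [[neg' ne] [h _ hE]]; subst x.
have gh : g != h by apply/eqP => gh; apply: ne; rewrite gh.
by move: neg'; rewrite /= ltNge H.
Qed.

Lemma boundary_closure_eq (phi psi : W -> R) : continuous phi -> continuous psi ->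
  (forall h, phi (mc_emb W h) = psi (mc_emb W h)) ->
  forall xi, ~ range (mc_emb W) xi -> phi xi = psi xi.
Proof.
move=> cphi cpsi H xi hxi; apply/eqP; rewrite eq_le -!(subr_ge0 _ (_ xi)).
apply/andP; split.
  apply: (@boundary_closure_ge0 (fun x : W => psi x - phi x : R) 1%g _ _ xi hxi).
    by move=> x; apply: continuousB; [exact: cpsi|exact: cphi].
  by move=> h _; rewrite H subrr.
apply: (@boundary_closure_ge0 (fun x : W => phi x - psi x : R) 1%g _ _ xi hxi).
  by move=> x; apply: continuousB; [exact: cphi|exact: cpsi].
by move=> h _; rewrite H subrr.
Qed.

Local Notation Kb := (@bd_kernel R Gam mu W).
Implicit Types (xi : boundary W).

Lemma bd_valP xi : ~ range (mc_emb W) (bd_val xi).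
Proof. by have /set_mem := valP xi. Qed.

Lemma bd_kernel1 xi : Kb 1%g xi = 1.
Proof.
rewrite /bd_kernel.
apply: (@boundary_closure_eq (@mc_kernel _ _ _ W 1%g) (fun=> 1 : R) _ _ _ _ (@bd_valP xi)).
- exact: mc_kernel_continuous.
- exact: continuous_cst_real.
- by move=> h; rewrite mc_kernelE kernel1.
Qed.

Lemma bd_kernel_le g xi : Kb g xi <= C ^+ d g 1%g.
Proof.
rewrite -subr_ge0.
rewrite /bd_kernel.
apply: (@boundary_closure_ge0 (fun x : W => C ^+ d g 1%g - mc_kernel g x : R) g _ _ _ (@bd_valP xi)).
- apply: continuous_sub_real; first exact: continuous_cst_real.
  exact: mc_kernel_continuous.
- by move=> h _; rewrite mc_kernelE subr_ge0 kernel_le.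
Qed.

Lemma bd_kernel_ge g xi : (C ^+ d 1%g g)^-1 <= Kb g xi.
Proof.
rewrite -subr_ge0.
rewrite /bd_kernel.
apply: (@boundary_closure_ge0 (fun x : W => mc_kernel g x - (C ^+ d 1%g g)^-1 : R) g _ _ _ (@bd_valP xi)).
- apply: continuous_sub_real; last exact: continuous_cst_real.
  exact: mc_kernel_continuous.
- by move=> h _; rewrite mc_kernelE subr_ge0 kernel_ge.
Qed.

Lemma bd_kernel_gt0 g xi : 0 < Kb g xi.
Proof. by rewrite (lt_le_trans _ (bd_kernel_ge _ _))// invr_gt0 exprn_gt0. Qed.

Lemma bd_kernel_cocycle g x xi :
  Kb x (bd_act g xi) * Kb g^-1%g xi = Kb (g^-1 * x)%g xi.
Proof.
rewrite /bd_kernel.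
apply: (@boundary_closure_eq (fun z : W => mc_kernel x (mc_act g z) * mc_kernel g^-1%g z : R)
  (@mc_kernel _ _ _ W (g^-1 * x)%g) _ _ _ _ (@bd_valP xi)).
- apply: continuous_mul_real; last exact: mc_kernel_continuous.
  move=> z; apply: continuous_comp; first exact: mc_act_continuous.
  exact: mc_kernel_continuous.
- exact: mc_kernel_continuous.
- by move=> h; rewrite mc_act_emb !mc_kernelE kernel_cocycle.
Qed.

Lemma continuous_kernel_sum (F : seq Gam) g :
  continuous (fun x : W => \sum_(s <- F) mu s * mc_kernel (g * s)%g x).
Proof.
apply: continuous_sum_real => s; apply: continuous_mul_real.
  exact: continuous_cst_real.
exact: mc_kernel_continuous.
Qed.

Lemma bd_kernel_step_le F g xi : uniq F ->
  \sum_(s <- F) mu s * Kb (g * s)%g xi <= Kb g xi.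
Proof.
move=> uF; rewrite -subr_ge0.
rewrite /bd_kernel.
apply: (@boundary_closure_ge0 (fun x : W => mc_kernel g x -
  \sum_(s <- F) mu s * mc_kernel (g * s)%g x : R) g _ _ _ (@bd_valP xi)).
- apply: continuous_sub_real; first exact: mc_kernel_continuous.
  exact: continuous_kernel_sum.
- move=> h gh; rewrite mc_kernelE subr_ge0.
  by under eq_bigr do rewrite mc_kernelE; exact: kernel_step_le.
Qed.

Lemma bd_kernel_step_ge F g xi : uniq F ->
  Kb g xi - \sum_(s <- F) mu s * Kb (g * s)%g xi <= moment_tail F * Kb g xi.
Proof.
move=> uF; rewrite -subr_ge0.
rewrite /bd_kernel.
apply: (@boundary_closure_ge0 (fun x : W => moment_tail F * mc_kernel g x -
  (mc_kernel g x - \sum_(s <- F) mu s * mc_kernel (g * s)%g x) : R) g _ _ _ (@bd_valP xi)).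
- apply: continuous_sub_real.
    by apply: continuous_mul_real; [exact: continuous_cst_real|exact: mc_kernel_continuous].
  apply: continuous_sub_real; first exact: mc_kernel_continuous.
  exact: continuous_kernel_sum.
- move=> h gh; rewrite mc_kernelE subr_ge0.
  by under eq_bigr do rewrite mc_kernelE; exact: kernel_step_ge.
Qed.

Lemma bd_kernel_separates xi eta : (forall g, Kb g xi = Kb g eta) -> xi = eta.
Proof.
move=> H; apply: val_inj.
by apply: (@mc_kernel_separates _ _ _ W) => //; exact: bd_valP.
Qed.

Lemma bd_kernel_continuous g : continuous (Kb g).
Proof.
move=> xi; apply: (@continuous_comp _ _ _ (@bd_val R Gam mu W) (mc_kernel g)).
  exact: initial_continuous.
exact: mc_kernel_continuous.
Qed.

End KernelTheory.

(** * The kernel at the limit point of the walk *)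

Section Potential.
Variables (R : realType) (Gam : groupType) (mu : Gam -> R).
Hypotheses (hmu : random_walk mu) (htrans : transient mu).
Local Open Scope ereal_scope.
Local Notation G := (green mu).
Local Notation step := (step mu).
Implicit Types (f : Gam -> \bar R) (x y : Gam).

(** The potential truncated at time [n]: the expected sum of [f] over the positions at times below
    [n]. *)
Definition psum f n x := \sum_(k < n) iter k step f x.

Lemma psum_ge0 f n x : (forall y, 0 <= f y) -> 0 <= psum f n x.
Proof. by move=> f0; apply: sume_ge0 => k _; exact: iter_step_ge0. Qed.

Lemma step_sum f (F : seq nat) (g : nat -> Gam -> \bar R) x :
  (forall n y, 0 <= g n y) ->
  step (fun y => \sum_(n <- F) g n y) x = \sum_(n <- F) step (g n) x.
Proof.
move=> g0; rewrite /step -esum_sum; last first.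
  by move=> i j _ _; rewrite mule_ge0 ?muE_ge0.
by apply: eq_esum => s _; rewrite ge0_sume_distrr.
Qed.

Lemma psumS f n x : (forall y, 0 <= f y) -> psum f n.+1 x = f x + step (psum f n) x.
Proof.
move=> f0; rewrite /psum big_ord_recl /=; congr (_ + _).
rewrite -(big_mkord xpredT (fun k => step (iter k step f) x)).
under [in RHS]eq_fun do rewrite -(big_mkord xpredT (fun k => iter k step f _)).
by rewrite step_sum// => k y; exact: iter_step_ge0.
Qed.

Lemma psum_add f n m x : (forall y, 0 <= f y) ->
  psum f (n + m) x = psum f n x + iter n step (psum f m) x.
Proof.
move=> f0; elim: n x => [|n IH] x; first by rewrite /psum add0n big_ord0 add0e.
rewrite addSn !psumS// -addeA; congr (_ + _).
rewrite -stepD//; try by move=> y; (exact: psum_ge0 || (apply: iter_step_ge0 => // z; exact: psum_ge0)).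
by apply: eq_esum => s _; rewrite IH.
Qed.

Lemma le_psum f f' n x : (forall y, f y <= f' y) -> psum f n x <= psum f' n x.
Proof. by move=> ff'; apply: lee_sum => k _; exact: le_iter_step. Qed.

Lemma green_potential f x : (forall y, 0 <= f y) ->
  \esum_(y in [set: Gam]) (G x y * f y) = \sum_(0 <= n <oo) iter n step f x.
Proof.
move=> f0; rewrite nneseries_esumT; last by move=> n; exact: iter_step_ge0.
under [RHS]eq_esum do rewrite iter_stepE//.
rewrite esum_exchange; last by move=> *; rewrite mule_ge0 ?mu_pow_ge0.
by apply: eq_esum => y _; rewrite greenE// esumZr// => n; exact: mu_pow_ge0.
Qed.

Lemma psum_le_potential f n x : (forall y, 0 <= f y) ->
  psum f n x <= \esum_(y in [set: Gam]) (G x y * f y).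
Proof.
move=> f0; rewrite green_potential// /psum.
rewrite -(big_mkord xpredT (fun k => iter k step f x)).
by apply: nneseries_lim_ge => k _ _; exact: iter_step_ge0.
Qed.

Lemma potential_le f x (c : \bar R) : (forall y, 0 <= f y) ->
  (forall n, psum f n x <= c) -> \esum_(y in [set: Gam]) (G x y * f y) <= c.
Proof.
move=> f0 H; rewrite green_potential//.
apply: lime_le; first by apply: is_cvg_nneseries => n _ _; exact: iter_step_ge0.
apply: nearW => n; have := H n; rewrite /psum.
by rewrite -(big_mkord xpredT (fun k => iter k step f x)).
Qed.

Lemma iter_step_green n x z : iter n step (G^~ z) x = \sum_(n <= k <oo) mu_pow mu k x z.
Proof.
have p0 k y : 0 <= mu_pow mu k y z by exact: mu_pow_ge0.
elim: n x => [|n IH] x //=.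
rewrite /step.
under eq_esum do rewrite IH -(nneseries_addn n)// nneseries_esumT// -esumZl ?muE_ge0//.
rewrite esum_exchange; last by move=> *; rewrite mule_ge0 ?muE_ge0.
rewrite -(nneseries_addn n.+1)// nneseries_esumT//.
by apply: eq_esum => k _; rewrite addnS mu_powS.
Qed.

(** [n] applications of the Markov operator delete the first [n] terms of the convergent Green
    series. *)
Lemma iter_step_green_small x z (e : R) : (0 < e)%R ->
  exists n, iter n step (G^~ z) x <= e%:E.
Proof.
move=> e0.
have fin : \sum_(0 <= k <oo) mu_pow mu k x z < +oo by exact: htrans.
have p0 k : 0 <= mu_pow mu k x z by exact: mu_pow_ge0.
have := @nneseries_tail_cvg R (fun k => mu_pow mu k x z) xpredT fin (fun k _ => p0 k).
have e0' : 0 < e%:E by rewrite lte_fin.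
move=> H.
have /fine_cvgP[_ /cvgrPdist_lt /(_ e e0)[N _ /(_ N (leqnn N))]] := H.
rewrite /= sub0r normrN => h; exists N; rewrite iter_step_green.
have t0 : 0 <= \sum_(N <= k <oo) mu_pow mu k x z.
  by apply: nneseries_ge0 => k _ _.
have tfin : \sum_(N <= k <oo) mu_pow mu k x z < +oo.
  apply: le_lt_trans fin; rewrite [leRHS](nneseries_split 0 N)//.
  by rewrite add0n leeDr// sume_ge0.
move: h; rewrite ger0_norm ?fine_ge0// => h.
by rewrite -[leLHS]fineK ?ge0_fin_numE// lee_fin ltW.
Qed.

(* A superharmonic function dominated by a multiple of a Green function is the
   potential of its charge rho. *)
Section Charge.
Variables (w : Gam -> R) (k : R) (z : Gam).
Hypotheses (w0 : forall y, (0 <= w y)%R) (k0 : (0 <= k)%R).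
Hypothesis w_super : forall y, step (EFin \o w) y <= (w y)%:E.
Hypothesis w_green : forall y, (w y)%:E <= k%:E * G y z.

Definition charge_of y : \bar R := (w y)%:E - step (EFin \o w) y.

Lemma step_w_fin y : step (EFin \o w) y \is a fin_num.
Proof.
rewrite ge0_fin_numE; first by rewrite (le_lt_trans (w_super y))// ltry.
by apply: step_ge0 => // x; rewrite lee_fin.
Qed.

Lemma charge_of_ge0 y : 0 <= charge_of y.
Proof. by rewrite sube_ge0 ?w_super// step_w_fin. Qed.

Lemma charge_ofE y : (w y)%:E = charge_of y + step (EFin \o w) y.
Proof. by rewrite subeK// step_w_fin. Qed.

(** The Riesz decomposition truncated at time [n], obtained by iterating [w = rho + P w]. *)
Lemma charge_psum n x : (w x)%:E = psum charge_of n x + iter n step (EFin \o w) x.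
Proof.
have wE0 y : 0 <= (EFin \o w) y by rewrite lee_fin.
elim: n x => [|n IH] x; first by rewrite /psum big_ord0 add0e.
rewrite psumS; last exact: charge_of_ge0.
rewrite charge_ofE -[RHS]addeA; congr (_ + _).
rewrite /= -stepD//; last 2 first.
- by move=> y; apply: psum_ge0; exact: charge_of_ge0.
- by move=> y; exact: iter_step_ge0.
by apply: eq_esum => s _; rewrite -IH.
Qed.

Lemma charge_potential x : \esum_(y in [set: Gam]) (G x y * charge_of y) = (w x)%:E.
Proof.
have wE0 y : 0 <= (EFin \o w) y by rewrite lee_fin.
apply/eqP; rewrite eq_le; apply/andP; split.
  apply: potential_le => [|n]; first exact: charge_of_ge0.
  by rewrite (charge_psum n x) leeDl// iter_step_ge0.
(* The remainder of the truncated decomposition is dominated by [k] times a tail of the Green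
   series; dividing by [k + 1] keeps the choice valid for [k = 0]. *)
apply/lee_addgt0Pr => e e0.
have k1 : (0 < k + 1)%R by rewrite ltr_wpDl.
have [n hn] := @iter_step_green_small x z (e / (k + 1))%R (divr_gt0 e0 k1).
rewrite (charge_psum n x) leeD//.
  by apply: psum_le_potential; exact: charge_of_ge0.
apply: (@le_trans _ _ (iter n step (fun y => k%:E * G y z) x)).
  exact: le_iter_step.
have -> : iter n step (fun y => k%:E * G y z) x = k%:E * iter n step (G^~ z) x.
  rewrite !iter_stepE//; last 2 first.
  - by move=> y; exact: green_ge0.
  - by move=> y; rewrite mule_ge0 ?green_ge0 ?lee_fin.
  rewrite -esumZl ?lee_fin//; last by move=> y; rewrite mule_ge0 ?green_ge0 ?mu_pow_ge0.
  by apply: eq_esum => y _; rewrite muleCA.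
apply: (@le_trans _ _ (k%:E * (e / (k + 1))%:E)).
  by rewrite lee_wpmul2l// lee_fin.
rewrite -EFinM lee_fin mulrCA ger_pMr// ler_pdivrMr// mul1r lerDl//.
Qed.

End Charge.
End Potential.

(** * Hitting probabilities and the limit of the kernel *)

Section Hitting.
Variables (R : realType) (Gam : groupType) (mu : Gam -> R).
Hypotheses (hmu : random_walk mu) (htrans : transient mu).
Local Open Scope ereal_scope.
Local Notation G := (green mu).
Local Notation step := (step mu).
Local Notation K := (martin_kernel mu).

(** A minimum of two superharmonic functions is superharmonic. *)
Lemma min_green_superharmonic (k : R) (z y : Gam) : (0 <= k)%R ->
  step (EFin \o (fun y => Num.min 1 (k * greenR mu y z))%R) y
  <= (Num.min 1 (k * greenR mu y z))%:E.
Proof.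
move=> k0; set w := (fun y => _)%R.
have h1 : step (EFin \o w) y <= 1.
  rewrite -[leRHS](step_cst hmu y lee01); apply: le_step => // x.
  by rewrite /= lee_fin ge_min lexx.
have h2 : step (EFin \o w) y <= (k * greenR mu y z)%:E.
  rewrite EFinM -greenR_E//.
  apply: (@le_trans _ _ (step (fun x => k%:E * G x z) y)).
    apply: le_step => // x; rewrite greenR_E// -EFinM lee_fin.
    by rewrite ge_min lexx orbT.
  rewrite /step; under eq_esum do rewrite muleCA.
  rewrite esumZl ?lee_fin//; last by move=> s; rewrite mule_ge0 ?muE_ge0 ?green_ge0.
  rewrite lee_wpmul2l ?lee_fin// [leRHS]green_step// leeDr//.
  by case: ifP.
by rewrite /Num.min; case: ifP.
Qed.

(* Probability that the walk started at x visits A within the first m steps. *)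
Fixpoint hit (A : set Gam) m (x : Gam) : \bar R :=
  if x \in A then 1 else if m is m'.+1 then step (hit A m') x else 0.

Lemma hit_ge0 A m x : 0 <= hit A m x.
Proof.
elim: m x => [|m IH] x /=; case: ifP => // _; exact: step_ge0.
Qed.

Section Domination.
Variables (w : Gam -> R) (A : set Gam).
Hypotheses (w0 : forall y, (0 <= w y)%R) (w1 : forall y, (w y <= 1)%R).
Hypothesis w_super : forall y, step (EFin \o w) y <= (w y)%:E.
Local Notation rho := (charge_of mu w).
Let f y := if y \in A then rho y else 0.

Let rho0 y : 0 <= rho y. Proof. exact: charge_of_ge0. Qed.
Let f0 y : 0 <= f y. Proof. by rewrite /f; case: ifP. Qed.

(** No charge is collected before the first visit to [A], and from there on at most [w <= 1] is. *)
Lemma psum_charge_hit m x : psum mu f m x <= hit A m x.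
Proof.
have le1 n y : psum mu f n y <= 1.
  apply: (@le_trans _ _ (psum mu rho n y)).
    by apply: le_psum => // z; rewrite /f; case: ifP.
  apply: (@le_trans _ _ (w y)%:E); last by rewrite lee_fin.
  rewrite (charge_psum hmu w0 w_super n y) leeDl//; exact: iter_step_ge0.
elim: m x => [|m IH] x; first by rewrite {1}/psum big_ord0 hit_ge0.
rewrite /=; case: ifPn => xA; first exact: le1.
by rewrite psumS// {1}/f (negPf xA) add0e; apply: le_step.
Qed.

End Domination.

(** The last hypothesis is convergence of [K(g, .)] to [c] along the walk, stated through hitting
    probabilities bounded uniformly in the horizon [m], so that the argument takes place on the
    group alone. *)
Lemma kernel_limit_one (g : Gam) (c Mb : R) : (0 <= c)%R -> (0 <= Mb)%R ->
  (forall y, (K g y <= Mb)%R) ->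
  (forall eps : R, (0 < eps)%R -> forall e : R, (0 < e)%R -> exists N, forall m,
     iter N step (hit [set y | (eps <= `|K g y - c|)%R] m) 1%g <= e%:E) ->
  c = 1%R.
Proof.
move=> c0 Mb0 KMb H.
have main eps e : (0 < eps)%R -> (0 < e)%R -> (e < 1)%R ->
    (1 <= c + eps + Mb * (2 * e))%R /\ (c <= 1 + eps + c * (2 * e))%R.
  move=> eps0 e0 e1.
  have [N HN] := H eps eps0 e e0.
  set A := [set y | _] in HN.
  (* A finite set that carries all but [e] of the law of the walk at time [N]. *)
  have [F uF HF] : exists2 F : seq Gam, uniq F &
      (1 - e)%:E <= \sum_(y <- F) mu_pow mu N 1%g y.
    apply: contrapT => nF.
    have : \esum_(y in [set: Gam]) mu_pow mu N 1%g y <= (1 - e)%:E.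
      apply: esum_le_sums => F uF; rewrite leNgt; apply/negP => h.
      by apply: nF; exists F => //; exact: ltW.
    by rewrite mu_pow_sum1// lee_fin; lra.
  pose F' := [:: 1%g, g & F].
  (* Large enough for [k G(y, e) >= 1] on [F'], so that [w] equals 1 at [e], at [g] and on [F]. *)
  pose k : R := (\sum_(y <- F') (greenR mu y 1%g)^-1)%R.
  have inv0 y : (0 <= (greenR mu y 1%g)^-1)%R by rewrite invr_ge0 ltW// greenR_gt0.
  have k0 : (0 <= k)%R by rewrite sumr_ge0.
  have kF y : y \in F' -> (1 <= k * greenR mu y 1%g)%R.
    move=> yF; rewrite -ler_pdivrMr ?greenR_gt0// mul1r /k (big_rem y yF)/=.
    by rewrite lerDl sumr_ge0.
  pose w y := (Num.min 1 (k * greenR mu y 1%g))%R.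
  have wF y : y \in F' -> w y = 1%R by move=> /kF h; rewrite /w min_l.
  have w0 y : (0 <= w y)%R.
    by rewrite le_min ler01 mulr_ge0// ltW// greenR_gt0.
  have w1 y : (w y <= 1)%R by rewrite ge_min lexx.
  have ws y : step (EFin \o w) y <= (w y)%:E by exact: min_green_superharmonic.
  have wg y : (w y)%:E <= k%:E * G y 1%g.
    by rewrite greenR_E// -EFinM lee_fin ge_min lexx orbT.
  pose rho := charge_of mu w.
  have rho0 y : 0 <= rho y by exact: charge_of_ge0.
  pose f y := if y \in A then rho y else 0.
  have f0 y : 0 <= f y by rewrite /f; case: ifP.
  have wE0 y : 0 <= (EFin \o w) y by rewrite lee_fin.
  have potw x : \esum_(y in [set: Gam]) (G x y * rho y) = (w x)%:E.
    exact: (charge_potential hmu htrans w0 k0 ws wg).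
  have PN : (1 - e)%:E <= iter N step (EFin \o w) 1%g.
    rewrite iter_stepE//; apply: (le_trans HF).
    apply: (@le_trans _ _ (\sum_(y <- F) (mu_pow mu N 1%g y * (EFin \o w) y))).
      rewrite !big_seq; apply: lee_sum => y yF /=.
      by rewrite wF ?mule1// !inE yF !orbT.
    by apply: sum_le_esum => // y; rewrite mule_ge0 ?mu_pow_ge0.
  (* As [w = 1] on [F], the operator applied [N] times still leaves [1 - e] of [w(e) = 1], so at
     most [e] of the charge is met before time [N]. *)
  have SN : psum mu rho N 1%g <= e%:E.
    have := charge_psum hmu w0 ws N 1%g; rewrite wF ?mem_head// => E.
    have : psum mu rho N 1%g + (1 - e)%:E <= 1.
      by rewrite E leeD2l.
    rewrite -leeBrDr// -EFinB; congr (_ <= _%:E); lra.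
  (* The charge met in [A] is at most [e] before time [N], and at most the probability [e] of
     visiting [A] afterwards. *)
  have lamA : \esum_(y in [set: Gam]) (G 1%g y * f y) <= (2 * e)%:E.
    apply: potential_le => // M.
    apply: (@le_trans _ _ (psum mu f (N + M) 1%g)).
      rewrite addnC psum_add// leeDl// iter_step_ge0// => y; exact: psum_ge0.
    rewrite psum_add// mulr_natl mulr2n EFinD leeD//.
      by apply: le_trans SN; apply: le_psum => // y; rewrite /f; case: ifP.
    apply: le_trans (HN M); apply: le_iter_step => // y.
    exact: psum_charge_hit.
  have GK y : G g y = (K g y)%:E * G 1%g y.
    by rewrite !greenR_E// -EFinM /martin_kernel divfK// gt_eqF// greenR_gt0.
  have K0 y : (0 <= K g y)%R by rewrite ltW// kernel_gt0.
  have pot_g := potw g; have pot_1 := potw 1%g.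
  rewrite wF ?inE ?eqxx ?orbT// in pot_g.
  rewrite wF ?inE ?eqxx ?orbT// in pot_1.
  have Gr0 y : 0 <= G 1%g y * rho y by rewrite mule_ge0// green_ge0.
  have Gf0 y : 0 <= G 1%g y * f y by rewrite mule_ge0// green_ge0.
  have E1 a : (0 <= a)%R ->
      \esum_(y in [set: Gam]) (a%:E * (G 1%g y * rho y)) = a%:E.
    by move=> a0; rewrite esumZl ?lee_fin// pot_1 mule1.
  have E2 a : (0 <= a)%R ->
      \esum_(y in [set: Gam]) (a%:E * (G 1%g y * f y)) <= (a * (2 * e))%:E.
    by move=> a0; rewrite esumZl ?lee_fin// EFinM lee_wpmul2l// lee_fin.
  have ce0 : (0 <= c + eps)%R by rewrite addr_ge0// ltW.
  split; rewrite -lee_fin.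
    rewrite -[leLHS]pot_g.
    apply: (@le_trans _ _ (\esum_(y in [set: Gam])
        ((c + eps)%:E * (G 1%g y * rho y) + Mb%:E * (G 1%g y * f y)))).
      apply: le_esumT => y; rewrite GK -muleA /f.
      have [yA|yA] := boolP (y \in A).
        rewrite (@le_trans _ _ (Mb%:E * (G 1%g y * rho y)))//.
          by rewrite lee_wpmul2r// lee_fin.
        by rewrite leeDr// mule_ge0// lee_fin addr_ge0// ltW.
      rewrite mule0 mule0 adde0 lee_wpmul2r// lee_fin.
      move: yA; rewrite notin_setE /A /= => /negP; rewrite -ltNge ltr_norml.
      by move=> /andP[_]; lra.
    rewrite esumDT; last 2 first.
    - by move=> y; rewrite mule_ge0// lee_fin addr_ge0// ltW.
    - by move=> y; rewrite mule_ge0// lee_fin.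
    by rewrite (E1 _ ce0) [in leRHS]EFinD; apply: leeD2l => //; exact: E2.
  rewrite -(E1 _ c0).
  apply: (@le_trans _ _ (\esum_(y in [set: Gam])
      (G g y * rho y + (eps%:E * (G 1%g y * rho y) + c%:E * (G 1%g y * f y))))).
    apply: le_esumT => y; rewrite GK -muleA /f.
    have [yA|yA] := boolP (y \in A).
      apply: (@le_trans _ _ (eps%:E * (G 1%g y * rho y) + c%:E * (G 1%g y * rho y))).
        by rewrite leeDr// mule_ge0// lee_fin ltW.
      by rewrite leeDr// mule_ge0// lee_fin.
    rewrite mule0 mule0 adde0 -ge0_muleDl ?lee_fin// ?(ltW eps0)//.
    rewrite lee_wpmul2r// -EFinD lee_fin.
    move: yA; rewrite notin_setE /A /= => /negP; rewrite -ltNge ltr_norml.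
    by move=> /andP[+ _]; lra.
  rewrite esumDT; last 2 first.
  - by move=> y; rewrite mule_ge0// green_ge0.
  - by move=> y; rewrite adde_ge0// mule_ge0// lee_fin// ltW.
  rewrite pot_g esumDT; last 2 first.
  - by move=> y; rewrite mule_ge0// lee_fin ltW.
  - by move=> y; rewrite mule_ge0// lee_fin.
  rewrite (E1 _ (ltW eps0)) -addrA [in leRHS]EFinD; apply: leeD2l => //.
  by rewrite EFinD; apply: leeD2l => //; exact: E2.
apply/eqP; rewrite eq_le; apply/andP; split.
  apply/ler_addgt0Pl => eps eps0.
  have k1 : (0 < 2 * (c + Mb + 1))%R by lra.
  (* Half of [eps] pays for the oscillation of [K(g, .)] off [A], the other half for the mass [2 e]
     in [A], where [K(g, .)] is at most [Mb]. *)
  pose e := (Num.min (eps / 2 / (2 * (c + Mb + 1))) (2^-1))%R.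
  have e0 : (0 < e)%R by rewrite lt_min invr_gt0 ltr0n andbT !divr_gt0.
  have e1 : (e < 1)%R by rewrite gt_min; apply/orP; right; rewrite invf_lt1// ltr1n.
  have ee : (e * (2 * (c + Mb + 1)) <= eps / 2)%R.
    by rewrite -ler_pdivlMr// ge_min lexx.
  have [_ h] := main (eps / 2)%R e (divr_gt0 eps0 (ltr0n R 2)) e0 e1.
  have : (0 <= e * Mb)%R by rewrite mulr_ge0// ltW.
  lra.
apply/ler_addgt0Pl => eps eps0.
have k1 : (0 < 2 * (c + Mb + 1))%R by lra.
pose e := (Num.min (eps / 2 / (2 * (c + Mb + 1))) (2^-1))%R.
have e0 : (0 < e)%R by rewrite lt_min invr_gt0 ltr0n andbT !divr_gt0.
have e1 : (e < 1)%R by rewrite gt_min; apply/orP; right; rewrite invf_lt1// ltr1n.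
have ee : (e * (2 * (c + Mb + 1)) <= eps / 2)%R.
  by rewrite -ler_pdivlMr// ge_min lexx.
have [h _] := main (eps / 2)%R e (divr_gt0 eps0 (ltr0n R 2)) e0 e1.
have : (0 <= e * c)%R by rewrite mulr_ge0// ltW.
lra.
Qed.

End Hitting.

(** * Sample paths of the walk *)

Section WalkPaths.
Variables (R : realType) (Gam : groupType) (mu : Gam -> R).
Hypothesis hmu : random_walk mu.
Variables (dd : measure_display) (Om : measurableType dd) (P : probability Om R).
Variable s : nat -> Om -> Gam.
Hypothesis hs : iid_steps mu P s.
Local Notation step := (step mu).
Local Open Scope ereal_scope.

Definition pos n (w : Om) : Gam := (\prod_(0 <= k < n) s k w)%g.

Lemma posS n w : pos n.+1 w = (pos n w * s n w)%g.
Proof. by rewrite /pos big_nat_recr. Qed.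

Lemma measurable_step n (B : set Gam) : measurable (s n @^-1` B).
Proof. exact: steps_measurable hs n B. Qed.

Lemma measurable_pos n (B : set Gam) : measurable (pos n @^-1` B).
Proof.
elim: n B => [|n IH] B.
  have [B1|B1] := pselect (B 1%g).
    rewrite (_ : _ @^-1` _ = setT)//; apply/seteqP; split => // w _.
    by rewrite /preimage /= /pos big_geq.
  rewrite (_ : _ @^-1` _ = set0)//; apply/seteqP; split => // w.
  by rewrite /preimage /= /pos big_geq.
rewrite (_ : pos n.+1 @^-1` B = \bigcup_(g in [set: Gam])
    ((pos n @^-1` [set g]) `&` (s n @^-1` [set h | B (g * h)%g]))).
  apply: countable_bigcupT_measurable; first exact: rw_countable hmu.
  by move=> g; apply: measurableI; [exact: IH|exact: measurable_step].
apply/seteqP; split => w.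
  rewrite /preimage /= posS => h; exists (pos n w) => //.
by move=> [g _ [/= <-]]; rewrite /preimage /= posS.
Qed.

(** Paths whose first steps are prescribed; their probabilities factor, which replaces conditioning
    on the past. *)
Definition cyl (l : seq Gam) : set Om :=
  [set w | forall j, (j < size l)%N -> s j w = nth 1%g l j].

Lemma cylE l : cyl l =
  \bigcap_(n in [set` iota 0 (size l)]) (s n @^-1` [set nth 1%g l n]).
Proof.
apply/seteqP; split => w /= h j.
  by rewrite /= mem_iota add0n => /andP[_]; exact: h.
by move=> jl; apply: (h j); rewrite /= mem_iota add0n.
Qed.

Lemma measurable_cyl l : measurable (cyl l).
Proof.
rewrite cylE; apply: fin_bigcap_measurable; first exact: finite_seq.
by move=> n _; exact: measurable_step.
Qed.

Lemma prob_cyl l : P (cyl l) = \prod_(n <- iota 0 (size l)) (mu (nth 1%g l n))%:E.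
Proof.
rewrite cylE (steps_independent hs) ?iota_uniq//.
by apply: eq_bigr => n _; rewrite (steps_distribution hs).
Qed.

Lemma prob_cyl_rcons l g : P (cyl (rcons l g)) = P (cyl l) * (mu g)%:E.
Proof.
rewrite !prob_cyl size_rcons -addn1 iotaD big_cat/= add0n big_seq1.
rewrite nth_rcons ltnn eqxx; congr (_ * _).
rewrite !big_seq; apply: eq_bigr => n; rewrite mem_iota add0n => /andP[_ nl].
by rewrite nth_rcons nl.
Qed.

Lemma cyl_rcons l g w : cyl (rcons l g) w <-> cyl l w /\ s (size l) w = g.
Proof.
split=> [h|[h1 h2] j].
  split; last by rewrite h ?size_rcons// nth_rcons ltnn eqxx.
  by move=> j jl; rewrite h ?size_rcons 1?ltnW// nth_rcons jl.
rewrite size_rcons ltnS leq_eqVlt nth_rcons => /predU1P[->|jl].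
  by rewrite ltnn eqxx.
by rewrite jl h1.
Qed.

Lemma pos_cyl l w : cyl l w -> pos (size l) w = (\prod_(x <- l) x)%g.
Proof.
move=> h; rewrite /pos (big_nth 1%g) !big_nat; apply: eq_bigr => j.
by move=> /andP[_ /h].
Qed.

Definition visits (A : set Gam) N m : set Om :=
  \bigcup_(n in [set n | (N <= n <= N + m)%N]) (pos n @^-1` A).

Lemma measurable_visits A N m : measurable (visits A N m).
Proof. by apply: bigcup_measurable => n _; exact: measurable_pos. Qed.

Lemma sum_cyl_le l (E : set Om) (F : seq Gam) : measurable E -> uniq F ->
  \sum_(g <- F) P (cyl (rcons l g) `&` E) <= P (cyl l `&` E).
Proof.
move=> mE uF.
have mF (F' : seq Gam) : measurable (cyl l `&` E `&` (s (size l) @^-1` [set` F'])).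
  apply: measurableI; last exact: measurable_step.
  by apply: measurableI => //; exact: measurable_cyl.
apply: (@le_trans _ _ (P (cyl l `&` E `&` (s (size l) @^-1` [set` F])))); last first.
  apply: le_measure; rewrite ?inE//.
    by apply: measurableI => //; exact: measurable_cyl.
elim: F uF => [_|g F IH /= /andP[gF uF]]; first by rewrite big_nil.
rewrite big_cons.
have -> : cyl l `&` E `&` (s (size l) @^-1` [set` g :: F]) =
    (cyl (rcons l g) `&` E) `|` (cyl l `&` E `&` (s (size l) @^-1` [set` F])).
  apply/seteqP; split => w.
    rewrite /preimage /= inE => -[[h1 h2] /orP[/eqP h3|h3]].
      by left; split => //; apply/cyl_rcons.
    by right.
  rewrite /preimage /= => -[[/cyl_rcons[h1 h2] h3]|[[h1 h2] h3]].
    by rewrite inE h2 eqxx.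
  by rewrite inE h3 orbT.
rewrite measureU//; last 2 first.
- by apply: measurableI => //; exact: measurable_cyl.
- apply/seteqP; split => // w; rewrite /preimage /=.
  move=> [[/cyl_rcons[h1 h2] h3] [_ h4]].
  by move: gF; rewrite -h2 h4.
by rewrite leeD2l// IH.
Qed.

(** A Markov property in cylinder form. The prefix [l] and the delay [j] are what the induction
    needs, and an inequality suffices, so only finitely many next steps are ever added up. *)
Lemma hit_le_visits A m j l :
  P (cyl l) * iter j step (hit mu A m) (\prod_(x <- l) x)%g
  <= P (cyl l `&` visits A (size l + j) m).
Proof.
(* Lowers the delay by one: average over the step that follows the prefix. *)
have next A' m' j' : (forall l, P (cyl l) * iter j' step (hit mu A' m') (\prod_(x <- l) x)%g
      <= P (cyl l `&` visits A' (size l + j') m')) ->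
    forall l, P (cyl l) * iter j'.+1 step (hit mu A' m') (\prod_(x <- l) x)%g
      <= P (cyl l `&` visits A' (size l + j'.+1) m').
  move=> IH l'; set h := iter j' step (hit mu A' m').
  have h0 y : 0 <= h y.
    by apply: iter_step_ge0 => // z; exact: hit_ge0.
  rewrite (_ : iter j'.+1 step (hit mu A' m') (\prod_(x <- l') x)%g =
    \esum_(g in [set: Gam]) ((mu g)%:E * h (\prod_(x <- l') x * g)%g))//.
  rewrite -esumZl//; last by move=> g; rewrite mule_ge0 ?muE_ge0.
  apply: esum_le_sums => F uF.
  apply: le_trans (sum_cyl_le l' (measurable_visits A' (size l' + j'.+1) m') uF).
  apply: lee_sum => g _; rewrite muleA -prob_cyl_rcons.
  have := IH (rcons l' g); rewrite -cats1 big_cat big_seq1 size_cat addn1 addSnnS.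
  by [].
elim: m j l => [|m IHm] j; elim: j => [|j IHj] l.
- rewrite /= addn0; case: ifPn => [xA|_]; last by rewrite mule0.
  rewrite mule1 le_measure// ?inE; [exact: measurable_cyl| |].
    by apply: measurableI; [exact: measurable_cyl|exact: measurable_visits].
  move=> w hw; split => //; exists (size l) => /=; first by rewrite leqnn addn0 leqnn.
  by rewrite /preimage /= pos_cyl//; exact/set_mem.
- exact: next.
- rewrite /= addn0; case: ifPn => [xA|_].
    rewrite mule1 le_measure// ?inE; [exact: measurable_cyl| |].
      by apply: measurableI; [exact: measurable_cyl|exact: measurable_visits].
    move=> w hw; split => //; exists (size l) => /=; first by rewrite leqnn leq_addr.
    by rewrite /preimage /= pos_cyl//; exact/set_mem.
  (* Off [A], hitting within [m + 1] steps is hitting within [m] steps after a delay of one, and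
     that window of times lies in the required one. *)
  apply: (le_trans (IHm 1%N l)).
  rewrite le_measure// ?inE; [| |].
  + by apply: measurableI; [exact: measurable_cyl|exact: measurable_visits].
  + by apply: measurableI; [exact: measurable_cyl|exact: measurable_visits].
  + move=> w [h1 [n /= /andP[n1 n2] h2]]; split => //; exists n => //=.
    by rewrite (leq_trans _ n1) ?leq_addr// (leq_trans n2)// addn1 addSnnS.
- exact: next.
Qed.
End WalkPaths.

(** * Topology of the Martin boundary *)

Section BoundaryTopology.
Variables (R : realType) (Gam : groupType) (mu : Gam -> R).
Variable W : martin_compactification mu.

Lemma bd_val_inj : injective (@bd_val R Gam mu W).
Proof. exact: val_inj. Qed.

Lemma bd_val_continuous : continuous (@bd_val R Gam mu W).
Proof. exact: initial_continuous. Qed.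

Lemma boundary_closed1 (xi : boundary W) : closed [set xi].
Proof.
have -> : [set xi] = @bd_val _ _ _ W @^-1` [set bd_val xi].
  by apply/seteqP; split => eta /=; [move=> ->|exact: bd_val_inj].
apply: preimage_closed; first by move=> eta _; exact: bd_val_continuous.
apply: accessible_closed_set1; apply: hausdorff_accessible.
exact: metric_hausdorff.
Qed.

(** A cluster point in the compactification cannot be a group element, as these are isolated. *)
Lemma boundary_compact : compact [set: boundary W].
Proof.
move=> F PF _.
have [p [_ clp]] := @mc_compact _ _ _ W (@bd_val _ _ _ W @ F) _ filterT.
have pb : boundary_set p.
  move=> -[g _ gp]; have op : nbhs p [set p].
    by apply: open_nbhs_nbhs; split => //; rewrite -gp; exact: mc_emb_open.
  have [_ [[eta _ <-] /= etap]] := clp (range (@bd_val _ _ _ W)) _ (filterS (fun eta _ => imageP _ I) filterT) op.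
  by have := set_mem (valP eta); apply; exists g => //; rewrite gp.
pose q : boundary W := exist _ p (mem_set pb).
exists q; split => // A B FA.
rewrite nbhsE => -[B' [[V oV <-] Vp] B'B].
have nV : nbhs p V by apply: open_nbhs_nbhs; split.
have FV : (@bd_val _ _ _ W @ F) (@bd_val _ _ _ W @` A).
  by apply: (@filterS _ F _ A _ _ FA) => eta Aeta; exists eta.
have [_ [[eta Aeta <-] Veta]] := clp _ _ FV nV.
by exists eta; split => //; exact: B'B.
Qed.

End BoundaryTopology.

Section HarmonicPoint.
Variables (R : realType) (Gam : groupType) (mu : Gam -> R).
Hypotheses (hmu : random_walk mu) (htrans : transient mu).
Local Notation step := (step mu).

(** The events of visiting [A] after time [N] decrease to a null event, so continuity from above
    makes their probabilities small, whatever the horizon [m]. *)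
Lemma eventually_not_visits (dd : measure_display) (Om : measurableType dd)
    (P : probability Om R) (s : nat -> Om -> Gam) (A : set Gam) :
  iid_steps mu P s ->
  {ae P, forall w, exists N, forall n, (N <= n)%N -> ~ A (pos s n w)} ->
  forall e : R, 0 < e -> exists N, forall m, (P (visits s A N m) <= e%:E)%E.
Proof.
move=> hs ae e e0.
pose E N : set Om := \bigcup_(n in [set n | (N <= n)%N]) (pos s n @^-1` A).
have mE N : measurable (E N).
  by apply: bigcup_measurable => n _; exact: (measurable_pos hmu hs).
have mEE : measurable (\bigcap_N E N).
  by apply: bigcapT_measurable.
have E0 : P (\bigcap_N E N) = 0%E.
  have [B [mB PB HB]] := ae.
  apply/eqP; rewrite eq_le measure_ge0 andbT -PB le_measure// ?inE//.
  move=> w hw; apply: HB => -[N HN].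
  by have [n /= Nn An] := hw N I; exact: HN An.
have dec : {homo E : n m / (n <= m)%N >-> (m <= n)%O}.
  move=> n m nm; apply/subsetPset => w [k /= mk Ak].
  by exists k => //=; exact: leq_trans mk.
have fin : (P (E 0%N) < +oo)%E by rewrite (le_lt_trans (probability_le1 _ _))// ltry.
have cv : (P \o E) n @[n --> \oo] --> 0%E by rewrite -E0; exact: nonincreasing_cvg_mu.
have [N _ /(_ N (leqnn N)) HN] : \forall N \near \oo, (P (E N) < e%:E)%E.
  have e0E : (0 < e%:E)%E by rewrite lte_fin.
  apply: (cv [set y | (y < e%:E)%E]); apply: open_nbhs_nbhs; split => //.
  exact: open_ereal_lt_ereal.
exists N => m; rewrite (le_trans _ (ltW HN))// le_measure// ?inE//.
  exact: (measurable_visits hmu hs).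
by move=> w [n /= /andP[Nn _] An]; exists n.
Qed.

Variables (S : seq Gam) (d : Gam -> Gam -> nat) (hd : is_word_metric S d).
Variables (C : R) (hC : 0 < C) (hharnack : harnack mu d C).
Variable W : martin_compactification mu.

Lemma kernel_harmonic_point (nu : set (boundary W) -> \bar R) (xi0 : boundary W) :
  is_harmonic_measure nu -> nu [set xi0] = 1%E -> forall g, bd_kernel g xi0 = 1.
Proof.
move=> [dd [Om [P [s [X [hs mX aeX nuE]]]]]] nu1 g.
have bxi : borel [set xi0].
  rewrite -[[set xi0]]setCK -[~` ~` _]setTD; apply: sigma_algebraCD.
  apply: sub_sigma_algebra; apply: closed_openC; exact: boundary_closed1.
have mXxi := mX _ bxi.
have PX : P (X @^-1` [set xi0]) = 1%E by rewrite -nuE.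
have aeXxi : {ae P, forall w, X w = xi0}.
  exists (~` (X @^-1` [set xi0])); split => //.
    exact: measurableC.
  by rewrite probability_setC// PX subee.
set c := bd_kernel g xi0.
have c0 : 0 <= c by exact: ltW (bd_kernel_gt0 hmu htrans hC hharnack g xi0).
apply: (@kernel_limit_one _ _ mu hmu htrans g c (C ^+ d g 1%g)) => //.
- by rewrite exprn_ge0// ltW.
- by move=> y; exact: kernel_le.
move=> eps eps0 e e0; set A := [set y | _].
have ev : {ae P, forall w, exists N, forall n, (N <= n)%N -> ~ A (pos s n w)}.
  apply: filterS2 aeX aeXxi => w cv Xw.
  have cK : (fun n => mc_kernel g (mc_emb W (pos s n w))) @ \oo --> c.
    rewrite /c /bd_kernel -Xw.
    apply: (@cvg_comp _ _ _ _ (mc_kernel g) _ _ _ cv).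
    exact: mc_kernel_continuous.
  have /cvgrPdist_lt /(_ eps eps0)[N _ HN] := cK.
  exists N => n Nn; rewrite /A /=.
  have := HN n Nn; rewrite /= mc_kernelE distrC => h1 h2.
  by move: (le_lt_trans h2 h1); rewrite ltxx.
have [N HN] := eventually_not_visits hs ev e0.
exists N => m; apply: le_trans (HN m).
have := hit_le_visits hmu hs A m N [::]; rewrite big_nil /= add0n.
have -> : cyl s [::] = setT by apply/seteqP; split.
by rewrite probability_setT mul1e setTI.
Qed.

End HarmonicPoint.

(** By the cocycle identity all kernels equal 1 at the translate of [xi0] too, and the kernels
    separate boundary points. *)
Lemma act_of_kernel_one (R : realType) (Gam : groupType) (mu : Gam -> R)
    (W : martin_compactification mu) : random_walk mu -> transient mu ->
  forall xi0 : boundary W, (forall g, bd_kernel g xi0 = 1) ->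
  forall g, bd_act g xi0 = xi0.
Proof.
move=> hmu htrans xi0 K1 g; apply: bd_kernel_separates => x.
by have := bd_kernel_cocycle hmu htrans g x xi0; rewrite !K1 mulr1.
Qed.

(** * Concentration of KMS states *)

Section L2Norm.
Variables (R : realType) (I : choiceType).
Local Notation normc := ComplexField.Normc.normc.
Implicit Types (psi : I -> R[i]) (c : R).

Definition l2sq psi : \bar R := \esum_(i in [set: I]) (normc (psi i) ^+ 2)%:E.

Lemma l2sq_ge0 psi : (0 <= l2sq psi)%E.
Proof. by apply: esumT_ge0 => i; rewrite lee_fin sqr_ge0. Qed.

Lemma normc_sqr (z : R[i]) : normc z ^+ 2 = complex.Re z ^+ 2 + complex.Im z ^+ 2.
Proof. by case: z => a b /=; rewrite sqr_sqrtr// addr_ge0 ?sqr_ge0. Qed.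

Lemma l2norm_le psi c : 0 <= c -> (l2norm psi <= c%:E)%E = (l2sq psi <= (c ^+ 2)%:E)%E.
Proof.
move=> c0; rewrite /l2norm.
rewrite (_ : \esum_(i in _) _ = l2sq psi); last first.
  by apply: eq_esum => i _; rewrite normc_sqr.
case: (l2sq psi) (l2sq_ge0 psi) => [r r0| _|//].
- rewrite poweR_EFin lee_fin powR12_sqrt// lee_fin.
  by rewrite -[in LHS](ger0_norm c0) -sqrtr_sqr ler_sqrt// sqr_ge0.
- by rewrite poweRE/= invr_eq0 pnatr_eq0/= leye_eq.
Qed.

Lemma l2_opnorm_le (T : (I -> R[i]) -> I -> R[i]) c : 0 <= c ->
  (forall psi, (l2sq psi <= 1)%E -> (l2sq (T psi) <= (c ^+ 2)%:E)%E) ->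
  (l2_opnorm T <= c%:E)%E.
Proof.
move=> c0 H; apply: ge_ereal_sup => _ [psi /= hpsi <-].
rewrite l2norm_le//; apply: H.
by move: hpsi; rewrite l2norm_le// expr1n.
Qed.

Lemma l2_opnorm_ge (T : (I -> R[i]) -> I -> R[i]) psi c : 0 <= c ->
  (l2_opnorm T <= c%:E)%E -> (l2sq psi <= 1)%E -> (l2sq (T psi) <= (c ^+ 2)%:E)%E.
Proof.
move=> c0 H hpsi; rewrite -l2norm_le//; apply: le_trans H.
by apply: ereal_sup_ubound; exists psi => //=; rewrite l2norm_le// expr1n.
Qed.

End L2Norm.

Section ComplexContinuity.
Variables (R : realType) (T : topologicalType).
Local Notation normc := ComplexField.Normc.normc.
Implicit Types (f : T -> R[i]^o) (r : T -> R).

Definition rfun r : T -> R[i]^o := fun x => (r x)%:C.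

Lemma continuousC_eps f : continuous f <->
  forall x (e : R), 0 < e -> \forall y \near x, normc (f x - f y) <= e.
Proof.
split=> [cf x e e0|H x].
  have /cvg_nrm /(_ e e0) := cf x.
  by apply: filterS => y; rewrite nrm_normc.
by apply/cvg_nrm => e e0; under eq_near do rewrite nrm_normc; exact: H.
Qed.

Lemma continuous_rfun r : continuous r -> continuous (rfun r).
Proof.
move=> cr; apply/continuousC_eps => x e e0.
have /cvgrPdist_le /(_ e e0) := cr x.
by apply: filterS => y; rewrite /rfun -rmorphB normcR.
Qed.

Lemma continuousC_cst (c : R[i]) : continuous ((fun=> c) : T -> R[i]^o).
Proof. by move=> x; exact: cst_continuous. Qed.

Lemma continuousC_mul f g : continuous f -> continuous g ->
  continuous (fun x => f x * g x : R[i]^o).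
Proof. by move=> cf cg x; apply: (@continuousM R[i] T); [exact: cf|exact: cg]. Qed.

Lemma normcJ (z : R[i]) : normc (conjc z) = normc z.
Proof. by case: z => a b /=; rewrite sqrrN. Qed.

Lemma continuousC_conj f : continuous f -> continuous (fun x => conjc (f x) : R[i]^o).
Proof.
move=> /continuousC_eps cf; apply/continuousC_eps => x e e0.
by apply: filterS (cf x e e0) => y; rewrite -rmorphB normcJ.
Qed.

Lemma continuousC_normc f : continuous f -> continuous (fun x => normc (f x) : R).
Proof.
move=> /continuousC_eps cf x; apply/cvgrPdist_le => e e0.
apply: filterS (cf x e e0) => y; apply: le_trans.
rewrite ler_norml; apply/andP; split.
  rewrite lerNl opprB lerBlDr -(normcN (f x - f y)) opprB.
  by rewrite -{1}(subrK (f x) (f y)) ler_normcD.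
by rewrite lerBlDr -{1}(subrK (f y) (f x)) ler_normcD.
Qed.

End ComplexContinuity.

(** * Functions in the crossed product and their expectations *)

Section CrossedProductCalculus.
Variables (R : realType) (Gam : groupType) (X : topologicalType).
Variables (act : Gam -> X -> X) (A : cstarAlgType R).
Variables (pi : (X -> R[i]^o) -> A) (U : Gam -> A).
Hypothesis hA : reduced_crossed_product act pi U.
Local Notation normc := ComplexField.Normc.normc.
Implicit Types (f : X -> R[i]^o) (r : X -> R).

(** In the regular representation [pi f] is a multiplication operator. *)
Lemma pi_bound f M : 0 <= M -> continuous f -> (forall x, normc (f x) <= M) ->
  nrm (pi f) <= M.
Proof.
move=> M0 cf fM.
have := @cp_norm _ _ _ _ _ _ _ hA 1 (fun=> f) (fun=> 1%g) (fun=> cf).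
rewrite /cp_sum big_ord1 (cp_U1 hA) cmul1r -lee_fin => ->.
apply: l2_opnorm_le => // psi psi1; apply: (@le_trans _ _ ((M ^+ 2)%:E * l2sq psi)%E).
  rewrite /l2sq -esumZl ?lee_fin ?sqr_ge0//; last first.
    by move=> p; rewrite lee_fin sqr_ge0.
  apply: le_esumT => -[h x]; rewrite -EFinM lee_fin /cp_regular big_ord1 /=.
  rewrite invg1 mul1g ComplexField.Normc.normcM exprMn ler_wpM2r ?sqr_ge0//.
  by rewrite lerXn2r// nnegrE ?normc_ge0.
by rewrite -[leRHS]mule1 lee_wpmul2l// lee_fin sqr_ge0.
Qed.

Lemma piB f1 f2 : continuous f1 -> continuous f2 ->
  pi (fun x => f1 x - f2 x) = pi f1 - pi f2.
Proof.
move=> cf1 cf2; have cN : continuous (fun x => -1 * f2 x : R[i]^o).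
  exact: (@continuousC_mul _ _ (fun=> -1) f2 (@continuousC_cst R X (-1)) cf2).
rewrite -(scaleN1r (pi f2)) -(cp_piZ hA)// -(cp_piD hA cf1 cN).
by congr pi; apply/funext => x; rewrite mulN1r.
Qed.

Lemma pi_cst (c : R[i]) : pi (fun=> c) = c *: cone.
Proof.
rewrite -(cp_pi1 hA) -(cp_piZ hA); last exact: continuousC_cst.
by congr pi; apply/funext => x; rewrite mulr1.
Qed.

Variables (omega : A -> R[i]^o) (homega : is_state omega).

(** Plays the role of the integral of [r] for the restriction of [omega] to functions, taken as a
    real number. *)
Definition expect r : R := complex.Re (omega (pi (rfun r))).

Lemma expectD r1 r2 : continuous r1 -> continuous r2 ->
  expect (fun x => r1 x + r2 x) = expect r1 + expect r2.
Proof.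
move=> c1 c2; rewrite /expect -raddfD/= -(stD homega) -(cp_piD hA); try exact: continuous_rfun.
by congr (complex.Re (omega (pi _))); apply/funext => x; rewrite /rfun rmorphD.
Qed.

Lemma expectZ (c : R) r : continuous r -> expect (fun x => c * r x) = c * expect r.
Proof.
move=> cr; rewrite /expect.
have -> : rfun (fun x => c * r x) = (fun x => c%:C * rfun r x).
  by apply/funext => x; rewrite /rfun rmorphM.
rewrite (cp_piZ hA) ?(stZ homega); last exact: continuous_rfun.
by case: (omega _) => a b /=; rewrite mul0r subr0.
Qed.

Lemma expectB r1 r2 : continuous r1 -> continuous r2 ->
  expect (fun x => r1 x - r2 x) = expect r1 - expect r2.
Proof.
move=> c1 c2; rewrite -[- expect r2]mulN1r -expectZ// -expectD//.
  by congr expect; apply/funext => x; rewrite mulN1r.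
by apply: continuous_mul_real => //; exact: continuous_cst_real.
Qed.

Lemma expect_cst (c : R) : expect (fun=> c) = c.
Proof.
rewrite /expect /rfun pi_cst (stZ homega); have [_ _ ->] := homega.
by rewrite mulr1.
Qed.

Lemma expect_ge0 r : continuous r -> (forall x, 0 <= r x) -> 0 <= expect r.
Proof.
move=> cr r0; pose s x := Num.sqrt (r x).
have cs : continuous s.
  by move=> x; apply: continuous_comp; [exact: cr|exact: sqrt_continuous].
rewrite /expect; have <- : cstar (pi (rfun s)) ** pi (rfun s) = pi (rfun r).
  rewrite -(cp_pi_star hA) -?(cp_piM hA); try exact: continuous_rfun.
    congr pi; apply/funext => x.
    by rewrite /rfun conjc_real -rmorphM -expr2 sqr_sqrtr.
  by apply: continuousC_conj; exact: continuous_rfun.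
by have [] := st_pos homega (pi (rfun s)).
Qed.

Lemma expect_le r1 r2 : continuous r1 -> continuous r2 ->
  (forall x, r1 x <= r2 x) -> expect r1 <= expect r2.
Proof.
move=> c1 c2 r12; rewrite -subr_ge0 -expectB//; apply: expect_ge0.
  exact: continuous_sub_real.
by move=> x; rewrite subr_ge0.
Qed.

Lemma expect_sum (I : Type) (F : seq I) (r : I -> X -> R) :
  (forall i, continuous (r i)) ->
  expect (fun x => \sum_(i <- F) r i x) = \sum_(i <- F) expect (r i).
Proof.
move=> cr; elim: F => [|i F IH].
  rewrite big_nil -[RHS](expect_cst 0); congr expect.
  by apply/funext => x; rewrite big_nil.
rewrite big_cons -IH -expectD//; last exact: continuous_sum_real.
by congr expect; apply/funext => x; rewrite big_cons.
Qed.

End CrossedProductCalculus.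

(** * Concentration of a state at one point *)

Section Concentration.
Variables (R : realType) (Gam : groupType) (X : topologicalType).
Variables (act : Gam -> X -> X) (A : cstarAlgType R).
Variables (pi : (X -> R[i]^o) -> A) (U : Gam -> A).
Hypothesis hA : reduced_crossed_product act pi U.
Variables (omega : A -> R[i]^o) (homega : is_state omega).
Hypothesis compactX : compact [set: X].
Local Notation normc := ComplexField.Normc.normc.
Local Notation expect := (expect pi omega).

Definition null_function (r : X -> R) :=
  [/\ continuous r, forall x, 0 <= r x & expect r = 0].

Lemma null_functionD r1 r2 : null_function r1 -> null_function r2 ->
  null_function (fun x => r1 x + r2 x).
Proof.
move=> [c1 p1 n1] [c2 p2 n2]; split; first exact: continuous_add_real.
  by move=> x; rewrite addr_ge0.
by rewrite (expectD hA homega c1 c2) n1 n2 addr0.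
Qed.

Lemma null_functionZ c r : 0 <= c -> null_function r ->
  null_function (fun x => c * r x).
Proof.
move=> c0 [c1 p1 n1]; split.
- by apply: continuous_mul_real => //; exact: continuous_cst_real.
- by move=> x; rewrite mulr_ge0.
- by rewrite (expectZ hA homega c c1) n1 mulr0.
Qed.

Lemma null_function0 : null_function (fun=> 0).
Proof.
split => //; first exact: continuous_cst_real.
exact: (expect_cst hA homega).
Qed.

Variable x0 : X.
Hypothesis null_away : forall x, x <> x0 -> exists2 e, null_function e & 0 < e x.

(** It suffices to find, for each [delta], a null function [e] with [h <= delta + e] everywhere.
    Locally a multiple of one null function does this, and compactness adds up finitely many. *)
Lemma expect_concentrated (h : X -> R) : continuous h -> (forall x, 0 <= h x) -> h x0 = 0 ->
  expect h = 0.
Proof.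
move=> ch h0 hx0; apply/eqP; rewrite eq_le (expect_ge0 hA homega ch h0) andbT.
apply/ler_addgt0Pl => delta d0; rewrite addr0.
suff [e [ce _ ne] he] : exists2 e, null_function e & forall x, h x <= delta + e x.
  rewrite -[delta]addr0 -ne -[X in _ <= X + _](expect_cst hA homega delta).
  rewrite -(expectD hA homega)//; last exact: continuous_cst_real.
  apply: (expect_le hA homega) => //.
  by apply: continuous_add_real => //; exact: continuous_cst_real.
have /compact_near_coveringP cov := compactX.
(* The filter of sufficiently large null functions; sums of null functions are upper bounds, so it
   is one. The near-covering form of compactness then yields a single [e] for all points. *)
pose G : set_system (X -> R) := [set S | exists2 e, null_function e &
  forall e', null_function e' -> (forall x, e x <= e' x) -> S e'].
have FG : Filter G.
  split.
  - by exists (fun=> 0) => //; exact: null_function0.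
  - move=> P Q [e1 n1 H1] [e2 n2 H2]; exists (fun x => e1 x + e2 x).
      exact: null_functionD.
    have [[_ p1 _] [_ p2 _]] := (n1, n2).
    move=> e' n' le'; split; [apply: H1 => // x|apply: H2 => // x].
      by rewrite (le_trans _ (le' x))// lerDl.
    by rewrite (le_trans _ (le' x))// lerDr.
  - by move=> P Q PQ [e ne He]; exists e => // e' n' le'; apply: PQ; exact: He.
(* At [x0] nothing is needed since [h] vanishes there; elsewhere the null function is rescaled to
   reach [h x]. *)
have loc x : exists2 e, null_function e & h x < delta + e x.
  have [->|/eqP xx0] := eqVneq x x0.
    by exists (fun=> 0); [exact: null_function0|rewrite hx0 addr0].
  have [e ne ex] := null_away xx0; exists (fun y => h x / e x * e y).
    by apply: null_functionZ => //; rewrite divr_ge0// ltW.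
  by rewrite -mulrA mulVf ?gt_eqF// mulr1 ltrDr.
suff key : forall x, [set: X] x ->
    \forall x' \near x & e \near G, h x' <= delta + (e : X -> R) x'.
  have [e ne He] := cov _ G (fun e x => h x <= delta + e x) FG key.
  by exists e => // x; exact: (He e ne (fun x => lexx _) x I).
move=> x _; have [e ne hx] := loc x.
exists ([set y | h y < delta + e y], [set e' | null_function e' /\ forall y, e y <= e' y]) => /=.
  split; last by exists e.
  have [ce _ _] := ne.
  have cd : continuous (fun y => delta + e y - h y).
    apply: continuous_sub_real => //; apply: continuous_add_real => //.
    exact: continuous_cst_real.
  have d1 : 0 < delta + e x - h x by rewrite subr_gt0.
  by apply: filterS (cvgr_gt _ (cd x) _ d1) => y /=; rewrite subr_gt0.
by move=> [y e'] /= [hy [n' le']]; rewrite (le_trans (ltW hy))// lerD2l.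
Qed.

Lemma state_concentrated (f : X -> R[i]^o) a : continuous f -> omega (pi f ** a) = f x0 * omega a.
Proof.
move=> cf; pose f0 x : R[i]^o := f x - f x0.
have cc : continuous ((fun=> f x0) : X -> R[i]^o) by exact: continuousC_cst.
have cf0 : continuous f0.
  by move=> x; apply: continuousB; [exact: cf|exact: cc].
have E : pi f = pi f0 + f x0 *: cone.
  rewrite -(pi_cst hA) -(cp_piD hA)//; congr pi.
  by apply/funext => x; rewrite /f0 subrK.
rewrite E cmulDl (stD homega) cmulZl cmul1l (stZ homega).
suff -> : omega (pi f0 ** a) = 0 by rewrite add0r.
have := cauchy_schwarz homega (cstar (pi f0)) a; rewrite cstarK.
have cJ := continuousC_conj cf0.
have -> : pi f0 ** cstar (pi f0) = pi (rfun (fun x => normc (f0 x) ^+ 2)).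
  rewrite -(cp_pi_star hA)// -(cp_piM hA)//; congr pi; apply/funext => x.
  rewrite /rfun; case: (f0 x) => p q; apply/eqP.
  by rewrite eq_complex normc_sqr /=; apply/andP; split; apply/eqP; ring.
have := @expect_concentrated (fun x => normc (f0 x) ^+ 2).
rewrite {1}/expect => ->.
- rewrite mul0r => h; apply: ComplexField.Normc.eq0_normc.
  by apply/eqP; rewrite -sqrf_eq0 eq_le h sqr_ge0.
- have cn := continuousC_normc cf0.
  by under eq_fun do rewrite expr2; exact: continuous_mul_real.
- by move=> x; rewrite sqr_ge0.
- by rewrite /f0 subrr ComplexField.Normc.normc0 expr0n.
Qed.

End Concentration.

(** * Complex exponentials and their derivatives in norm *)

Section ComplexExponential.
Variable R : realType.
Local Notation normc := ComplexField.Normc.normc.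
Local Notation Re := complex.Re.
Local Notation Im := complex.Im.
Implicit Types (z w : R[i]).

Definition cexp w : R[i] := (expR (Re w) * cos (Im w)) +i* (expR (Re w) * sin (Im w)).

Lemma cexpD z w : cexp (z + w) = cexp z * cexp w.
Proof.
case: z w => [a b] [c d]; rewrite /cexp /= expRD cosD sinD.
by apply/eqP; rewrite eq_complex /=; apply/andP; split; apply/eqP; ring.
Qed.

Lemma normc_cexp w : normc (cexp w) = expR (Re w).
Proof.
rewrite /= !exprMn -mulrDr cos2Dsin2 mulr1 sqrtr_sqr.
by rewrite ger0_norm ?expR_ge0.
Qed.

Lemma abs_sin_le (b : R) : `|sin b| <= `|b|.
Proof.
have [c _ E] := @MVT_sym _ sin cos 0 b (fun x _ => is_derive_sin x).
rewrite sin0 !subr0 in E; rewrite E normrM ler_piMl// ler_norml.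
by rewrite cos_geN1 cos_le1.
Qed.

Lemma cos_half_sin (b : R) : cos b = 1 - 2 * sin (b / 2) ^+ 2.
Proof.
have {1}-> : b = b / 2 + b / 2 by rewrite -splitr.
have := cos2Dsin2 (b / 2); rewrite cosD -!expr2 => E.
lra.
Qed.

Lemma abs_cos_sub1_le (b : R) : `|cos b - 1| <= b ^+ 2 / 2.
Proof.
rewrite cos_half_sin addrAC subrr add0r normrN normrM normrX ger0_norm//.
have := abs_sin_le (b / 2); rewrite normrM [`|2^-1|]ger0_norm ?invr_ge0// => h.
have : `|sin (b / 2)| ^+ 2 <= (`|b| / 2) ^+ 2.
  by rewrite lerXn2r// nnegrE ?divr_ge0.
have -> : (`|b| / 2) ^+ 2 = b ^+ 2 / 4.
  by rewrite -[in RHS](real_normK (num_real b)); field.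
lra.
Qed.

Lemma abs_sin_sub_le (b : R) : `|b| <= 2^-1 -> `|sin b - b| <= b ^+ 2.
Proof.
move=> b2.
have h (x : R) : x \in `[Num.min 0 b, Num.max 0 b] ->
    is_derive x (1:R) (fun x => sin x - x) (cos x - 1).
  by move=> _; exact: (is_deriveB (is_derive_sin x) (is_derive_id x 1)).
have [c cb] := MVT_sym h; rewrite sin0 !subr0 => ->.
have cb1 : `|c| <= `|b|.
  move: cb; rewrite in_itv/=.
  case: (leP 0 b) => [b0|/ltW b0]; first by case/andP=> c0 cb; rewrite !ger0_norm.
  by case/andP=> bc c0; rewrite !ler0_norm// lerN2.
rewrite normrM -(real_normK (num_real b)) expr2 ler_wpM2r//.
apply: le_trans (abs_cos_sub1_le c) _.
rewrite -(real_normK (num_real c)) ler_pdivrMr//.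
by have := normr_ge0 c; have := normr_ge0 b; nra.
Qed.

Lemma abs_expR_sub1_le (a : R) : `|a| <= 2^-1 -> `|expR a - 1 - a| <= 2 * a ^+ 2.
Proof.
rewrite ler_norml => /andP[a1 a2].
have l := expR_ge1Dx a.
have l' := expR_ge1Dx (- a); rewrite expRN in l'.
have e0 : 0 < expR a := expR_gt0 a.
have : expR a * (1 - a) <= 1.
  by rewrite -[leRHS](mulfV (lt0r_neq0 e0)) ler_wpM2l// ltW.
set E := expR a in l e0 * => u.
rewrite ler_norml; apply/andP; split; first by nra.
by nra.
Qed.

(** An explicit constant makes the remainder uniform over boundary points, which gives a derivative
    in the norm of the algebra. *)
Lemma cexp_quadratic w : normc w <= 2^-1 ->
  normc (cexp w - 1 - w) <= 4 * normc w ^+ 2.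
Proof.
case: w => a b ab; have ha := le_trans (normc_Re (a +i* b)) ab.
have hb := le_trans (normc_Im (a +i* b)) ab.
rewrite /= in ha hb; rewrite normc_sqr.
apply: le_trans (normc_le_ReIm _) _; rewrite /= subr0.
have e1 := abs_expR_sub1_le ha; have s1 := abs_sin_sub_le hb.
have c1 := abs_cos_sub1_le b; have s2 := abs_sin_le b.
have sa : a ^+ 2 <= 2^-1 * `|a|.
  by rewrite -real_normK ?num_real// expr2 ler_wpM2r.
have ea : `|expR a - 1| <= 2 * `|a|.
  have := ler_normD (expR a - 1 - a) a; rewrite subrK; lra.
have e2 : expR a <= 2.
  have := ler_norm (expR a - 1); have : `|a| <= 2^-1 by []. lra.
have r1 : `|expR a * cos b - 1 - a| <= 2 * a ^+ 2 + b ^+ 2.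
  have -> : expR a * cos b - 1 - a = (expR a - 1 - a) + expR a * (cos b - 1) by ring.
  apply: le_trans (ler_normD _ _) _; apply: lerD => //.
  rewrite normrM ger0_norm ?expR_ge0//.
  have -> : b ^+ 2 = 2 * (b ^+ 2 / 2) by field.
  by apply: ler_pM => //; exact: expR_ge0.
have r2 : `|expR a * sin b - b| <= 2 * (`|a| * `|b|) + b ^+ 2.
  have -> : expR a * sin b - b = (expR a - 1) * sin b + (sin b - b) by ring.
  apply: le_trans (ler_normD _ _) _; apply: lerD => //.
  by rewrite normrM mulrA; apply: ler_pM.
have am : 2 * (`|a| * `|b|) <= a ^+ 2 + b ^+ 2.
  rewrite -(real_normK (num_real a)) -(real_normK (num_real b)) -subr_ge0.
  have -> : `|a| ^+ 2 + `|b| ^+ 2 - 2 * (`|a| * `|b|) = (`|a| - `|b|) ^+ 2 by ring.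
  exact: sqr_ge0.
have := sqr_ge0 a; have := sqr_ge0 b; lra.
Qed.

End ComplexExponential.

Lemma continuousC_sub (R : realType) (T : topologicalType) (f g : T -> R[i]^o) :
  continuous f -> continuous g -> continuous (fun x => f x - g x : R[i]^o).
Proof. by move=> cf cg x; apply: continuousB; [exact: cf|exact: cg]. Qed.

Section ExponentialFamily.
Variables (R : realType) (Gam : groupType) (X : topologicalType).
Variables (act : Gam -> X -> X) (A : cstarAlgType R).
Variables (pi : (X -> R[i]^o) -> A) (U : Gam -> A).
Hypothesis hA : reduced_crossed_product act pi U.
Local Notation normc := ComplexField.Normc.normc.
Local Notation normcM := ComplexField.Normc.normcM.

Lemma cexp_sub1_le (w : R[i]) : normc w <= 2^-1 -> normc (cexp w - 1) <= 3 * normc w.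
Proof.
move=> w2; have := ler_normcD (cexp w - 1 - w) w; rewrite subrK.
have := cexp_quadratic w2; have := normc_ge0 w; nra.
Qed.

Lemma continuous_cexp (f : X -> R[i]^o) : continuous f ->
  continuous (fun x => cexp (f x) : R[i]^o).
Proof.
move=> /continuousC_eps cf; apply/continuousC_eps => x e e0.
set k := expR (complex.Re (f x)); have k0 : 0 < k by exact: expR_gt0.
have m0 : 0 < Num.min 2^-1 (e / (3 * k)).
  by rewrite lt_min invr_gt0 ltr0n /= divr_gt0// mulr_gt0.
apply: filterS (cf x _ m0) => y; rewrite le_min => /andP[h1 h2].
have -> : cexp (f x) - cexp (f y) = - (cexp (f x) * (cexp (f y - f x) - 1)).
  by rewrite mulrBr -cexpD mulr1 opprB [f x + _]addrC subrK.
rewrite normcN normcM normc_cexp -/k.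
have h3 : normc (f y - f x) <= 2^-1 by rewrite -normcN opprB.
apply: (@le_trans _ _ (k * (3 * normc (f y - f x)))).
  by rewrite ler_wpM2l ?(ltW k0)// cexp_sub1_le.
by rewrite mulrA mulrC [k * 3]mulrC -ler_pdivlMr ?mulr_gt0// -normcN opprB.
Qed.

Variables (L : X -> R) (M : R).
Hypotheses (cL : continuous L) (LM : forall x, `|L x| <= M) (M0 : 0 < M).

Let nu x : R[i]^o := (0 -i* L x).

(** For [L = ln K] this is [pi (K^(-iz))]: the factor of the flow for real [z], and [K^beta] for
    [z = i beta]. *)
Definition pi_exp (z : R[i]) : A := pi (fun x => cexp (z * (0 -i* L x))).

Lemma continuous_negi : continuous nu.
Proof.
have -> : nu = (fun x => - 'i%C * rfun L x).
  apply/funext => x; apply/eqP; rewrite eq_complex /=.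
  by apply/andP; split; apply/eqP; ring.
apply: (@continuousC_mul _ _ (fun=> - 'i%C) (rfun L)); last exact: continuous_rfun.
exact: (@continuousC_cst R X (- 'i%C)).
Qed.

Lemma continuous_zmul (z : R[i]) : continuous (fun x => z * nu x : R[i]^o).
Proof.
apply: (@continuousC_mul _ _ (fun=> z) nu); last exact: continuous_negi.
exact: (@continuousC_cst R X z).
Qed.

Lemma normc_negi x : normc (nu x) <= M.
Proof. by rewrite /= expr0n add0r sqrrN sqrtr_sqr. Qed.

Lemma pi_exp_vdiff z :
  vdiff (pi_exp : R[i]^o -> A) z (pi (fun x => nu x * cexp (z * nu x))).
Proof.
(* The real part of [z nu x] is [Im z] times [L x], so [k] bounds the modulus of the exponential at
   [z]. *)
move=> e e0; set k := expR (`|complex.Im z| * M).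
have k0 : 0 < k by exact: expR_gt0.
have kM : 0 < k * (4 * M ^+ 2) by rewrite mulr_gt0// mulr_gt0// exprn_gt0.
exists (Num.min (2^-1 / M) (e / (k * (4 * M ^+ 2)))).
  by rewrite lt_min !divr_gt0// invr_gt0 ltr0n.
move=> w; rewrite lt_min ltr_pdivlMr// ltr_pdivlMr// => /andP[h1 h2].
set h := w - z in h1 h2 *.
have ce (v : R[i]) : continuous (fun x => cexp (v * nu x) : R[i]^o).
  by apply: continuous_cexp; exact: continuous_zmul.
have cn : continuous (fun x => nu x * cexp (z * nu x) : R[i]^o).
  exact: (continuousC_mul continuous_negi (ce z)).
have ch : continuous (fun x => h * (nu x * cexp (z * nu x)) : R[i]^o).
  exact: (@continuousC_mul _ _ (fun=> h) _ (@continuousC_cst R X h) cn).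
have cB : continuous (fun x => cexp (w * nu x) - cexp (z * nu x) : R[i]^o).
  exact: (continuousC_sub (ce w) (ce z)).
have cB' : continuous (fun x => cexp (w * nu x) - cexp (z * nu x) - h * (nu x * cexp (z * nu x)) : R[i]^o).
  exact: (continuousC_sub cB ch).
have E3 := cp_piZ hA h cn; have E2 := piB hA (ce w) (ce z).
have E1 := piB hA cB ch; rewrite E2 E3 in E1; rewrite /pi_exp -E1.
apply: (pi_bound hA) => // [|x]; first by rewrite mulr_ge0 ?normc_ge0// ltW.
have -> : cexp (w * nu x) - cexp (z * nu x) - h * (nu x * cexp (z * nu x)) =
   cexp (z * nu x) * (cexp (h * nu x) - 1 - h * nu x).
  have -> : w * nu x = z * nu x + h * nu x by rewrite /h; ring.
  by rewrite cexpD; ring.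
rewrite normcM normc_cexp.
have nh : normc (h * nu x) <= normc h * M.
  by rewrite normcM ler_wpM2l ?normc_ge0// normc_negi.
apply: (@le_trans _ _ (k * (4 * (normc h * M) ^+ 2))).
  apply: ler_pM; rewrite ?expR_ge0 ?normc_ge0//.
    rewrite /k ler_expR; case: (z) => a b /=.
    rewrite mulr0 sub0r mulrN opprK (le_trans (ler_norm _))// normrM.
    by rewrite ler_wpM2l.
  apply: le_trans (cexp_quadratic _) _; first exact: le_trans nh (ltW h1).
  by rewrite ler_wpM2l// lerXn2r// nnegrE ?normc_ge0// mulr_ge0 ?normc_ge0// ltW.
have -> : k * (4 * (normc h * M) ^+ 2) = normc h * (k * (4 * M ^+ 2)) * normc h by ring.
by rewrite ler_wpM2r ?normc_ge0// ltW.
Qed.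

Lemma derivable_mul_pi_exp (a : A) (z : R[i]^o) :
  derivable (fun z : R[i]^o => a ** pi_exp z) z (1 : R[i]^o).
Proof.
apply/vdiff_derivable; exists (a ** pi (fun x => nu x * cexp (z * nu x))).
move=> e e0; have n0 : 0 < nrm a + 1 by rewrite ltr_wpDl// nrm_ge0.
have [d d0 H] := pi_exp_vdiff z (divr_gt0 e0 n0).
exists d => // w wd; rewrite -cmulZr -!cmulBr.
apply: le_trans (nrmM _ _) _.
apply: (@le_trans _ _ ((nrm a + 1) * (e / (nrm a + 1) * normc (w - z)))).
  by apply: ler_pM; rewrite ?nrm_ge0 ?lerDl//; exact: H.
by rewrite mulrA mulrCA mulfV ?gt_eqF// mulr1.
Qed.

End ExponentialFamily.

Section StrictBernoulli.
Variable R : realType.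

Lemma expR_gt1D (x : R) : x != 0 -> 1 + x < expR x.
Proof.
move=> x0; have e0 : 0 < expR (x / 2) := expR_gt0 _.
have h : 1 + x / 2 <= expR (x / 2) := expR_ge1Dx _.
have {2}-> : x = x / 2 + x / 2 by rewrite -splitr.
rewrite expRD; have [h1|h1] := leP (1 + x / 2) 0; first by nra.
have x2 : 0 < x ^+ 2 by rewrite lt_def sqrf_eq0 x0 sqr_ge0.
by nra.
Qed.

(** Strict convexity or concavity of the power [b] of [exp r] about 1; the factor [b (b - 1)] has
    the sign of the second derivative and makes one statement of the three ranges of [b]. *)
Lemma bernoulli_strict (b r : R) : b != 0 -> b != 1 -> r != 0 ->
  0 < b * (b - 1) * (expR (b * r) - 1 - b * (expR r - 1)).
Proof.
move=> b0 b1 r0.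
have E1 : expR r = expR (b * r) * expR ((1 - b) * r).
  by rewrite -expRD; congr expR; ring.
have E2 : 1 = expR (b * r) * expR (- (b * r)) by rewrite -expRD subrr expR0.
have E3 : expR (b * r) = expR r * expR ((b - 1) * r).
  by rewrite -expRD; congr expR; ring.
have E4 : 1 = expR r * expR (- r) by rewrite -expRD subrr expR0.
have p1 : 0 < expR (b * r) := expR_gt0 _.
have p2 : 0 < expR r := expR_gt0 _.
have nb : b * r != 0 by rewrite mulf_neq0.
have nb1 : (b - 1) * r != 0 by rewrite mulf_neq0// subr_eq0.
have nb2 : (1 - b) * r != 0 by rewrite mulf_neq0// subr_eq0 eq_sym.
have [bn|bp|] := ltgtP b 0; last by move/eqP; rewrite (negbTE b0).
  have l1 := expR_gt1D nb; have l2 := expR_gt1D r0.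
  rewrite mulr_gt0//; first by nra.
  by nra.
have [bs|bl|] := ltgtP b 1; last by move/eqP; rewrite (negbTE b1).
  (* For [0 < b < 1]: the tangent of [exp] at [b r], evaluated at [r] and at 0 and averaged with
     weights [b] and [1 - b]. *)
  have l1 : expR (b * r) * (1 + (1 - b) * r) < expR r.
    by rewrite E1 ltr_pM2l// expR_gt1D.
  have l2 : expR (b * r) * (1 - b * r) < 1.
    by rewrite [ltRHS]E2 ltr_pM2l// expR_gt1D// oppr_eq0.
  have q1 : b * (expR (b * r) * (1 + (1 - b) * r)) < b * expR r by rewrite ltr_pM2l.
  have q2 : (1 - b) * (expR (b * r) * (1 - b * r)) < (1 - b) * 1.
    by rewrite ltr_pM2l// subr_gt0.
  have E5 : b * (expR (b * r) * (1 + (1 - b) * r)) +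
      (1 - b) * (expR (b * r) * (1 - b * r)) = expR (b * r) by ring.
  have -> : b * (b - 1) * (expR (b * r) - 1 - b * (expR r - 1)) =
    b * (1 - b) * (b * (expR r - 1) - (expR (b * r) - 1)) by ring.
  by rewrite mulr_gt0// ?mulr_gt0// ?subr_gt0//; lra.
(* For [b > 1]: the tangent of [exp] at [r], evaluated at [b r] and at 0. *)
have l1 : expR r * (1 + (b - 1) * r) < expR (b * r).
  by rewrite E3 ltr_pM2l// expR_gt1D.
have l2 : expR r * (1 - r) < 1.
  by rewrite [ltRHS]E4 ltr_pM2l// expR_gt1D// oppr_eq0.
rewrite mulr_gt0//; first by nra.
have : (b - 1) * (expR r * (1 - r)) < (b - 1) * 1 by rewrite ltr_pM2l// subr_gt0.
by nra.
Qed.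

End StrictBernoulli.

(** * The KMS condition for the flow of the Martin kernel *)

Section MartinFlow.
Variables (R : realType) (Gam : groupType) (mu : Gam -> R).
Hypotheses (hmu : random_walk mu) (htrans : transient mu).
Variables (S : seq Gam) (d : Gam -> Gam -> nat) (hd : is_word_metric S d).
Variables (C : R) (hC : 0 < C) (hharnack : harnack mu d C).
Hypothesis hmoment : moment_condition mu d C.
Variable W : martin_compactification mu.
Variables (A : cstarAlgType R) (pi : (boundary W -> R[i]^o) -> A) (U : Gam -> A).
Hypothesis hA : reduced_crossed_product (@bd_act R Gam mu W) pi U.
Variables (alpha : R -> A -> A) (halpha : is_martin_flow pi U alpha).
Variables (beta : R).
Local Notation normc := ComplexField.Normc.normc.
Local Notation K := (@bd_kernel R Gam mu W).

Definition kernel_pow (b : R) (g : Gam) (x : boundary W) : R := expR (b * ln (K g x)).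

Lemma K_gt0 g x : 0 < K g x.
Proof. exact: (bd_kernel_gt0 hmu htrans hC hharnack). Qed.

Lemma kernel_pow_gt0 b g x : 0 < kernel_pow b g x.
Proof. exact: expR_gt0. Qed.

Lemma kernel_pow1 g x : kernel_pow 1 g x = K g x.
Proof. by rewrite /kernel_pow mul1r lnK// posrE K_gt0. Qed.

Lemma kernel_powD a b g x : kernel_pow (a + b) g x = kernel_pow a g x * kernel_pow b g x.
Proof. by rewrite /kernel_pow mulrDl expRD. Qed.

Lemma continuous_ln_kernel g : continuous (fun x => ln (K g x)).
Proof.
move=> x; apply: continuous_comp; first exact: bd_kernel_continuous.
by apply: continuous_ln; exact: K_gt0.
Qed.

Lemma continuous_kernel_pow b g : continuous (kernel_pow b g).
Proof.
move=> x; apply: continuous_comp; last exact: continuous_expR.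
apply: continuous_mul_real; first exact: continuous_cst_real.
exact: continuous_ln_kernel.
Qed.

Lemma ln_kernel_bounded g : exists2 M : R, 0 < M & forall x, `|ln (K g x)| <= M.
Proof.
exists (`|ln (C ^+ d g 1%g)| + `|ln (C ^- d 1%g g)| + 1) => [|x].
  by rewrite ltr_wpDl// addr_ge0.
have l1 : ln (K g x) <= ln (C ^+ d g 1%g).
  by rewrite ler_ln ?posrE ?K_gt0 ?exprn_gt0//; exact: (bd_kernel_le hharnack).
have l2 : ln (C ^- d 1%g g) <= ln (K g x).
  rewrite ler_ln ?posrE ?K_gt0 ?invr_gt0 ?exprn_gt0//.
  exact: (bd_kernel_ge hmu htrans hC hharnack).
have := ler_norm (ln (C ^+ d g 1%g)); have := ler_norm (- ln (C ^- d 1%g g)).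
rewrite normrN => h1 h2.
have := normr_ge0 (ln (C ^+ d g 1%g)); have := normr_ge0 (ln (C ^- d 1%g g)).
by move=> h3 h4; rewrite ler_norml; apply/andP; split; lra.
Qed.

Lemma continuous_one : continuous ((fun=> 1) : boundary W -> R[i]^o).
Proof. exact: continuousC_cst. Qed.

Lemma martin_extension f g : continuous f ->
  analytic_extension alpha (pi f ** U g)
    (fun z => pi f ** U g ** pi_exp pi (fun x => ln (K g^-1%g x)) z).
Proof.
move=> cf; split=> [t|z].
  have [_ E] := halpha; rewrite (E t f g cf) /pi_exp.
  congr (_ ** pi _); apply/funext => x; rewrite /pow_Nit /cexp /=.
  rewrite !mulr0 mul0r subr0 addr0 expR0 !mul1r mulrN cosN sinN.
  by [].
have [M M0 HM] := ln_kernel_bounded g^-1%g.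
exact: (derivable_mul_pi_exp hA (@continuous_ln_kernel g^-1%g) HM M0).
Qed.

Lemma martin_analytic f g : continuous f -> analytic alpha (pi f ** U g).
Proof. by move=> cf; eexists; exact: martin_extension. Qed.

Lemma pi_exp_imag g : pi_exp pi (fun x => ln (K g x)) (0 +i* beta) =
  pi (rfun (kernel_pow beta g)).
Proof.
congr pi; apply/funext => x; rewrite /cexp /rfun /kernel_pow /=.
rewrite !mul0r !mulr0 mulrN sub0r opprK addr0 cos0 sin0 mulr1 mulr0.
by [].
Qed.

Variables (omega : {ptws A -> R[i]^o}) (homega : kms_states alpha beta omega).

Lemma kms_monomial f g f' g' : continuous f -> continuous f' ->
  omega ((pi f ** U g) ** (pi f' ** U g')) =
  omega ((pi f' ** U g') ** (pi f ** U g ** pi (rfun (kernel_pow beta g^-1%g)))).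
Proof.
move=> cf cf'; have [_ H] := homega.
rewrite -pi_exp_imag.
exact: (H _ _ _ (martin_extension g cf) (martin_analytic g' cf')).
Qed.

Lemma expect_kernel_pow g : expect pi omega (kernel_pow beta g) = 1.
Proof.
(* The flow attaches to a unitary the kernel of its inverse, so starting from the unitary of [g^-1]
   produces [K g]. *)
have := kms_monomial g^-1%g g continuous_one continuous_one.
rewrite (cp_pi1 hA) !cmul1l invgK cmulA -!(cp_UM hA) mulVg mulgV (cp_U1 hA) cmul1l.
have [[_ _ w1] _] := homega.
by rewrite w1 /expect => <-.
Qed.

End MartinFlow.

(** * Concentration for inverse temperatures other than 0 and 1 *)

Section KmsConcentration.
Variables (R : realType) (Gam : groupType) (mu : Gam -> R).
Hypotheses (hmu : random_walk mu) (htrans : transient mu).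
Variables (S : seq Gam) (d : Gam -> Gam -> nat) (hd : is_word_metric S d).
Variables (C : R) (hC : 0 < C) (hharnack : harnack mu d C).
Hypothesis hmoment : moment_condition mu d C.
Variable W : martin_compactification mu.
Variables (A : cstarAlgType R) (pi : (boundary W -> R[i]^o) -> A) (U : Gam -> A).
Hypothesis hA : reduced_crossed_product (@bd_act R Gam mu W) pi U.
Variables (alpha : R -> A -> A) (halpha : is_martin_flow pi U alpha).
Variables (beta : R).
Variables (omega : {ptws A -> R[i]^o}) (homega : kms_states alpha beta omega).
Variables (xi0 : boundary W) (K_xi0 : forall g, bd_kernel g xi0 = 1).
Local Notation K := (@bd_kernel R Gam mu W).
Local Notation expect := (expect pi omega).
Local Notation tail := (moment_tail mu d C).

Let omega_state : is_state omega. Proof. exact: homega.1. Qed.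
Let Kgt0 g x : 0 < K g x. Proof. exact: (K_gt0 hmu htrans hC hharnack). Qed.
Let Kpow1 g x : kernel_pow 1 g x = K g x.
Proof. exact: (kernel_pow1 hmu htrans hC hharnack). Qed.
Let Kpow_cont b g : continuous (@kernel_pow _ _ _ W b g).
Proof. exact: (continuous_kernel_pow hmu htrans hC hharnack). Qed.
Let K_cont g : continuous (K g). Proof. exact: bd_kernel_continuous. Qed.
Let expect_pow g : expect (kernel_pow beta g) = 1.
Proof. exact: (expect_kernel_pow hmu htrans hC hharnack hA halpha homega). Qed.
Let mu_pos g : 0 <= mu g. Proof. exact: (mu_ge0 hmu). Qed.

(* The kernel at [xi0] is constantly 1, so the tail also bounds [1 - \sum_F mu]. *)
Lemma step_defect F g x : uniq F ->
  `|\sum_(s <- F) mu s * (K (g * s)%g x - K g x)| <= tail F * K g x.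
Proof.
move=> uF.
have -> : \sum_(s <- F) mu s * (K (g * s)%g x - K g x) =
    \sum_(s <- F) mu s * K (g * s)%g x - (\sum_(s <- F) mu s) * K g x.
  by rewrite mulr_suml -sumrB; apply: eq_bigr => s _; rewrite mulrBr.
have a1 := bd_kernel_step_le hmu htrans g x uF.
have a2 := bd_kernel_step_ge hmu htrans hd hC hharnack hmoment g x uF.
have b1 := bd_kernel_step_le hmu htrans 1%g xi0 uF.
have b2 := bd_kernel_step_ge hmu htrans hd hC hharnack hmoment 1%g xi0 uF.
have Q1 : \sum_(s <- F) mu s * K (1 * s)%g xi0 = \sum_(s <- F) mu s.
  by apply: eq_bigr => s _; rewrite K_xi0 mulr1.
rewrite Q1 !K_xi0 ?mulr1 in b1 b2.
have k0 := Kgt0 g x; set k := K g x in a1 a2 k0 *.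
set P := \sum_(s <- F) mu s * K (g * s)%g x in a1 a2 *.
set Q := \sum_(s <- F) mu s in b1 b2 *.
by rewrite ler_norml; apply/andP; split; nra.
Qed.

(** The distance from [k^beta] to its tangent at [K g], evaluated at [K (g s)]; the factor in front
    makes it nonnegative for every [beta]. *)
Definition convexity_gap g s x := beta * (beta - 1) * (kernel_pow beta (g * s)%g x
  - kernel_pow beta g x - beta * (kernel_pow (beta - 1) g x * (K (g * s)%g x - K g x))).

Lemma convexity_gapE g s x : convexity_gap g s x = kernel_pow beta g x *
  (beta * (beta - 1) * (expR (beta * (ln (K (g * s)%g x) - ln (K g x))) - 1
   - beta * (expR (ln (K (g * s)%g x) - ln (K g x)) - 1))).
Proof.
rewrite /convexity_gap.
have -> : kernel_pow (beta - 1) g x * (K (g * s)%g x - K g x) =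
    kernel_pow beta g x * (expR (ln (K (g * s)%g x) - ln (K g x)) - 1).
  have e1 : expR (ln (K (g * s)%g x) - ln (K g x)) * K g x = K (g * s)%g x.
    by rewrite -{2}(lnK (Kgt0 g x)) -expRD subrK lnK// posrE.
  have e2 : kernel_pow beta g x = kernel_pow (beta - 1) g x * K g x.
    by rewrite -Kpow1 -kernel_powD subrK.
  by move: e1; set E := expR _ => e1; rewrite e2 -e1; ring.
have -> : kernel_pow beta (g * s)%g x = kernel_pow beta g x *
    expR (beta * (ln (K (g * s)%g x) - ln (K g x))).
  by rewrite /kernel_pow -expRD; congr expR; ring.
ring.
Qed.

Lemma continuous_convexity_gap g s : continuous (convexity_gap g s).
Proof.
apply: continuous_mul_real; first exact: continuous_cst_real.
apply: continuous_sub_real; first by apply: continuous_sub_real; exact: Kpow_cont.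
apply: continuous_mul_real; first exact: continuous_cst_real.
apply: continuous_mul_real; first exact: Kpow_cont.
by apply: continuous_sub_real; exact: K_cont.
Qed.

Lemma convexity_gap_gt0 g s x : beta != 0 -> beta != 1 ->
  K (g * s)%g x <> K g x -> 0 < convexity_gap g s x.
Proof.
move=> b0 b1 Kx; rewrite convexity_gapE mulr_gt0 ?kernel_pow_gt0//.
apply: bernoulli_strict => //; rewrite subr_eq0; apply: contra_not_neq Kx => E.
by apply: ln_inj E; rewrite posrE Kgt0.
Qed.

Lemma convexity_gap_ge0 g s x : beta != 0 -> beta != 1 -> 0 <= convexity_gap g s x.
Proof.
move=> b0 b1; have [E|/eqP Kx] := eqVneq (K (g * s)%g x) (K g x).
  by rewrite convexity_gapE E subrr !mulr0 expR0 !subrr !mulr0 subr0 !mulr0.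
by rewrite ltW// convexity_gap_gt0.
Qed.

(** All [K^beta] have expectation 1, so the zeroth-order terms cancel. The first-order terms add up
    to [K^(beta-1)] times the mean value defect, which is at most [tail F] times [K^beta], again of
    expectation 1. *)
Lemma expect_convexity_gap_sum F g : uniq F ->
  \sum_(s <- F) mu s * expect (convexity_gap g s) <=
  `|beta * (beta - 1) * beta| * tail F.
Proof.
move=> uF; pose D x := \sum_(s <- F) mu s * (K (g * s)%g x - K g x).
have cD1 s : continuous (fun x => mu s * (K (g * s)%g x - K g x)).
  apply: continuous_mul_real; first exact: continuous_cst_real.
  by apply: continuous_sub_real; exact: K_cont.
have cD : continuous D by exact: continuous_sum_real.
have cE s : continuous (fun x => kernel_pow (beta - 1) g x * (K (g * s)%g x - K g x)).
  apply: continuous_mul_real; first exact: Kpow_cont.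
  by apply: continuous_sub_real; exact: K_cont.
have cF : continuous (fun x => kernel_pow (beta - 1) g x * D x).
  by apply: continuous_mul_real => //; exact: Kpow_cont.
have gapE s : expect (convexity_gap g s) = - (beta * (beta - 1) * beta) *
    expect (fun x => kernel_pow (beta - 1) g x * (K (g * s)%g x - K g x)).
  rewrite /convexity_gap (expectZ hA omega_state); last first.
    apply: continuous_sub_real; first by apply: continuous_sub_real; exact: Kpow_cont.
    by apply: continuous_mul_real => //; exact: continuous_cst_real.
  rewrite (expectB hA omega_state); last first.
  - by apply: continuous_mul_real => //; exact: continuous_cst_real.
  - by apply: continuous_sub_real; exact: Kpow_cont.
  rewrite (expectB hA omega_state) ?expect_pow ?subrr ?sub0r; try exact: Kpow_cont.
  by rewrite (expectZ hA omega_state)//; ring.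
have -> : \sum_(s <- F) mu s * expect (convexity_gap g s) =
    - (beta * (beta - 1) * beta) * expect (fun x => kernel_pow (beta - 1) g x * D x).
  have -> : (fun x => kernel_pow (beta - 1) g x * D x) =
      (fun x => \sum_(s <- F) mu s * (kernel_pow (beta - 1) g x * (K (g * s)%g x - K g x))).
    by apply/funext => x; rewrite /D mulr_sumr; apply: eq_bigr => s _; ring.
  rewrite (expect_sum hA omega_state); last first.
    by move=> s; apply: continuous_mul_real => //; exact: continuous_cst_real.
  rewrite mulr_sumr; apply: eq_bigr => s _.
  by rewrite gapE (expectZ hA omega_state)//; ring.
apply: le_trans (ler_norm _) _; rewrite normrM normrN ler_wpM2l//.
have cT : continuous (fun x : boundary W => tail F * kernel_pow beta g x).
  by apply: continuous_mul_real; [exact: continuous_cst_real|exact: Kpow_cont].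
have ET : expect (fun x : boundary W => tail F * kernel_pow beta g x) = tail F.
  by rewrite (expectZ hA omega_state) ?expect_pow ?mulr1//; exact: Kpow_cont.
have bnd x : `|kernel_pow (beta - 1) g x * D x| <= tail F * kernel_pow beta g x.
  rewrite normrM ger0_norm ?(ltW (kernel_pow_gt0 _ _ _))//.
  have -> : tail F * kernel_pow beta g x = kernel_pow (beta - 1) g x * (tail F * K g x).
    by rewrite -Kpow1 mulrCA -kernel_powD subrK.
  by rewrite ler_wpM2l ?(ltW (kernel_pow_gt0 _ _ _))// step_defect.
rewrite ler_norml -{1 2}ET; apply/andP; split.
  rewrite -[- expect _]mulN1r -(expectZ hA omega_state)//; apply: (expect_le hA omega_state) => //.
    by apply: continuous_mul_real => //; exact: continuous_cst_real.
  by move=> x; have := bnd x; rewrite ler_norml mulN1r => /andP[].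
apply: (expect_le hA omega_state) => // x.
by have := bnd x; rewrite ler_norml => /andP[].
Qed.

Lemma null_convexity_gap g s : beta != 0 -> beta != 1 -> 0 < mu s ->
  null_function pi omega (convexity_gap g s).
Proof.
move=> b0 b1 ms; have c0 : continuous (convexity_gap g s) by exact: continuous_convexity_gap.
split=> //; first by move=> x; exact: convexity_gap_ge0.
have e0 t : 0 <= expect (convexity_gap g t).
  apply: (expect_ge0 hA omega_state); first exact: continuous_convexity_gap.
  by move=> x; exact: convexity_gap_ge0.
apply/eqP; rewrite eq_le e0 andbT -(pmulr_rle0 _ ms).
apply/ler_addgt0Pl => e epos; rewrite addr0.
pose c : R := `|beta * (beta - 1) * beta|.
have cge0 : 0 <= c by exact: normr_ge0.
have c1 : 0 < c + 1 by rewrite ltr_wpDl.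
have [F uF tF] := moment_tail_small hmu hC hmoment (divr_gt0 epos c1).
(* Adding [s] to [F] does not increase the tail, and as every gap has nonnegative expectation, the
   term of [s] alone is below the bound for the sum. *)
have uF' := undup_uniq (s :: F).
have tF' : tail (undup (s :: F)) <= e / (c + 1).
  have sub : {subset F <= undup (s :: F)}.
    by move=> t tF'; rewrite mem_undup inE tF' orbT.
  exact: le_trans (moment_tail_mono hmu d hC uF sub) tF.
have sF : s \in undup (s :: F) by rewrite mem_undup inE eqxx.
have := expect_convexity_gap_sum g uF'; rewrite (big_rem s)//= => H.
have p : 0 <= \sum_(t <- rem s (undup (s :: F))) mu t * expect (convexity_gap g t).
  by apply: sumr_ge0 => t _; rewrite mulr_ge0.
have h1 : c * tail (undup (s :: F)) <= c * (e / (c + 1)) by rewrite ler_wpM2l.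
have e0' : 0 <= e by exact: ltW.
have h2 : c * (e / (c + 1)) <= e.
  by rewrite mulrA ler_pdivrMr// mulrC ler_wpM2l// lerDl.
by move: H; rewrite -/c => H; lra.
Qed.

(** If no gap is positive at [x], then [K(., x)] is invariant under right multiplication by the
    support of [mu]; the support generates the group, so [K(., x) = 1] and [x = xi0]. *)
Lemma null_away_ne1 x : beta != 0 -> beta != 1 -> x <> xi0 ->
  exists2 e, null_function pi omega e & 0 < e x.
Proof.
move=> b0 b1 xx0.
have [[g [s [ms Kx]]]|H] := pselect (exists g s, 0 < mu s /\ K (g * s)%g x <> K g x).
  by exists (convexity_gap g s); [exact: null_convexity_gap|exact: convexity_gap_gt0].
exfalso; apply: xx0; apply: bd_kernel_separates => g; rewrite K_xi0.
have inv h s : 0 < mu s -> K (h * s)%g x = K h x.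
  by move=> ms; apply: contrapT => Kx; apply: H; exists h, s.
have invs (l : seq Gam) : (forall t, t \in l -> 0 < mu t) ->
    forall h, K (h * (\prod_(y <- l) y))%g x = K h x.
  elim: l => [|s l IH] lmu h; first by rewrite big_nil mulg1.
  rewrite big_cons mulgA IH ?inv//; first by apply: lmu; rewrite inE eqxx.
  by move=> t tl; apply: lmu; rewrite inE tl orbT.
have [l [_ lmu ->]] := rw_generates hmu g.
by rewrite -(mul1g (\prod_(y <- l) y)%g) invs// (bd_kernel1 hmu htrans).
Qed.

End KmsConcentration.

(** * Concentration for inverse temperature 1 *)

Section KmsOne.
Variables (R : realType) (Gam : groupType) (mu : Gam -> R).
Hypotheses (hmu : random_walk mu) (htrans : transient mu).
Variables (S : seq Gam) (d : Gam -> Gam -> nat) (hd : is_word_metric S d).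
Variables (C : R) (hC : 0 < C) (hharnack : harnack mu d C).
Hypothesis hmoment : moment_condition mu d C.
Variable W : martin_compactification mu.
Variables (A : cstarAlgType R) (pi : (boundary W -> R[i]^o) -> A) (U : Gam -> A).
Hypothesis hA : reduced_crossed_product (@bd_act R Gam mu W) pi U.
Variables (omega : A -> R[i]^o) (omega_state : is_state omega).
Variables (xi0 : boundary W) (K_xi0 : forall g, bd_kernel g xi0 = 1).
Hypothesis hxi0 : minimal_boundary xi0.
Local Notation K := (@bd_kernel R Gam mu W).
Local Notation expect := (expect pi omega).
Local Notation tail := (moment_tail mu d C).
Hypothesis expect_kernel : forall g, expect (K g) = 1.

Let Kgt0 g x : 0 < K g x. Proof. exact: (K_gt0 hmu htrans hC hharnack). Qed.
Let K_cont g : continuous (K g). Proof. exact: bd_kernel_continuous. Qed.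
Let mu_pos g : 0 <= mu g. Proof. exact: (mu_ge0 hmu). Qed.

(** An average of kernels with weight [a]. The defect of the mean value over a finite [F] is at most
    [tail F] times the kernel uniformly on the boundary, which justifies taking the infinite sum out
    of the state. *)
Lemma weighted_kernel_harmonic (a : boundary W -> R) : continuous a ->
  (forall x, 0 <= a x) -> 0 < expect a ->
  normalized_harmonic mu (fun g => expect (fun x => a x * K g x) / expect a).
Proof.
move=> ca a0 ma.
have cg g : continuous (fun x => a x * K g x).
  by apply: continuous_mul_real => //; exact: K_cont.
have pos g : 0 <= expect (fun x => a x * K g x).
  by apply: (expect_ge0 hA omega_state) => // x; rewrite mulr_ge0// ltW.
split=> [g||g]; first by rewrite divr_ge0// ltW.
  rewrite (_ : (fun x => _) = a) ?divff ?gt_eqF//.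
  by apply/funext => x; rewrite (bd_kernel1 hmu htrans) mulr1.
have sumE F : \sum_(s <- F) mu s * (expect (fun x => a x * K (g * s)%g x) / expect a) =
    expect (fun x => a x * \sum_(s <- F) mu s * K (g * s)%g x) / expect a.
  rewrite (_ : (fun x => _) = (fun x => \sum_(s <- F) mu s * (a x * K (g * s)%g x))).
    rewrite (expect_sum hA omega_state); last first.
      by move=> s; apply: continuous_mul_real => //; exact: continuous_cst_real.
    rewrite mulr_suml; apply: eq_bigr => s _.
    by rewrite (expectZ hA omega_state)// mulrA.
  by apply/funext => x; rewrite mulr_sumr; apply: eq_bigr => s _; rewrite mulrCA.
have cS F : continuous (fun x => a x * \sum_(s <- F) mu s * K (g * s)%g x).
  apply: continuous_mul_real => //; apply: continuous_sum_real => s.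
  by apply: continuous_mul_real; [exact: continuous_cst_real|exact: K_cont].
apply: esumEFin_eq.
- by move=> s; rewrite mulr_ge0// divr_ge0// ltW.
- move=> F uF; rewrite sumE ler_pM2r ?invr_gt0//.
  apply: (expect_le hA omega_state) => // x; rewrite ler_wpM2l//.
  exact: (bd_kernel_step_le hmu htrans).
move=> e e0; set c := expect (fun x => a x * K g x) / expect a.
have c0 : 0 <= c by rewrite divr_ge0// ltW.
have c1 : 0 < c + 1 by rewrite ltr_wpDl.
have [F uF tF] := moment_tail_small hmu hC hmoment (divr_gt0 e0 c1).
exists F => //; rewrite sumE.
have H : (1 - tail F) * expect (fun x => a x * K g x) <=
    expect (fun x => a x * \sum_(s <- F) mu s * K (g * s)%g x).
  rewrite -(expectZ hA omega_state)//; apply: (expect_le hA omega_state) => //.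
    by apply: continuous_mul_real => //; exact: continuous_cst_real.
  move=> x; rewrite mulrCA ler_wpM2l//.
  have := bd_kernel_step_ge hmu htrans hd hC hharnack hmoment g x uF; lra.
have : (1 - tail F) * c <= expect (fun x => a x * \sum_(s <- F) mu s * K (g * s)%g x) / expect a.
  by rewrite /c mulrA ler_pM2r ?invr_gt0.
have : tail F * c <= e.
  apply: (@le_trans _ _ (e / (c + 1) * c)); first by rewrite ler_wpM2r.
  by rewrite mulrAC ler_pdivrMr// ler_wpM2l ?(ltW e0)// lerDl.
lra.
Qed.

(** The partition [1 = a + (1 - a)] writes the constant 1, the kernel at [xi0], as a convex
    combination of two normalized harmonic functions; by extremality both are 1. *)
Lemma expect_weighted_kernel (a : boundary W -> R) g : continuous a ->
  (forall x, 0 <= a x <= 1) -> 0 < expect a < 1 ->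
  expect (fun x => a x * K g x) = expect a.
Proof.
move=> ca a01 /andP[m0 m1].
have cb : continuous (fun x => 1 - a x).
  by apply: continuous_sub_real => //; exact: continuous_cst_real.
have eb : expect (fun x => 1 - a x) = 1 - expect a.
  rewrite (expectB hA omega_state)//; last exact: continuous_cst_real.
  by rewrite (expect_cst hA omega_state).
have b0 : 0 < expect (fun x => 1 - a x) by rewrite eb subr_gt0.
have ha := weighted_kernel_harmonic ca (fun x => (andP (a01 x)).1) m0.
have hb := @weighted_kernel_harmonic (fun x => 1 - a x) cb _ b0.
have [_ /(_ _ _ (expect a) ha (hb _))] := hxi0.
case.
- by move=> x; rewrite subr_ge0; have /andP[] := a01 x.
- by rewrite m0.
- apply/funext => h; rewrite K_xi0 eb.
  have cg (b : boundary W -> R) : continuous b -> continuous (fun x => b x * K h x).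
    by move=> c; apply: continuous_mul_real => //; exact: K_cont.
  set P := expect (fun x => a x * K h x); set Q := expect (fun x => (1 - a x) * K h x).
  have E : P + Q = 1.
    rewrite -(expect_kernel h) -(expectD hA omega_state (cg _ ca) (cg _ cb)).
    by congr expect; apply/funext => x; ring.
  change (1 = expect a * (P / expect a) + (1 - expect a) * (Q / (1 - expect a))).
  by rewrite ![_ * (_ / _)]mulrC !divfK// gt_eqF// subr_gt0.
move=> /(congr1 (fun f => f g)) /= + _; rewrite K_xi0 => E.
by rewrite -[RHS]mul1r -E divfK ?gt_eqF.
Qed.

Lemma null_away_1 x : x <> xi0 -> exists2 e, null_function pi omega e & 0 < e x.
Proof.
move=> xx0.
have [g Kx] : exists g, K g x != 1.
  apply: contrapT => H; apply: xx0; apply: bd_kernel_separates => g.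
  by rewrite K_xi0; apply/eqP/negPn/negP => Kx; apply: H; exists g.
exists (fun y => (K g y - 1) * (K g y - 1)); last first.
  by rewrite -expr2 lt_def sqr_ge0 sqrf_eq0 subr_eq0 Kx.
have c1 : continuous (fun y => K g y - 1).
  by apply: continuous_sub_real; [exact: K_cont|exact: continuous_cst_real].
split; first exact: continuous_mul_real.
  by move=> y; rewrite -expr2 sqr_ge0.
pose M := C ^+ d g 1%g + 1; have M1 : 1 <= M by rewrite lerDr exprn_ge0// ltW.
have M0 : 0 < M by exact: lt_le_trans M1.
have KM y : `|K g y - 1| <= M.
  have k0 := Kgt0 g y; have := bd_kernel_le hharnack g y.
  by rewrite ler_norml => k1; apply/andP; split; rewrite /M; lra.
(* An affine function of [K g] of expectation 1/2; the bound [M] on [K g - 1] keeps it between 1/4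
   and 3/4. Then [a K g] has the expectation of [a] exactly when [(K g - 1)^2] has expectation 0. *)
pose a y := 2^-1 + (4 * M)^-1 * (K g y - 1).
have c2 : continuous (fun y => (4 * M)^-1 * (K g y - 1)).
  by apply: continuous_mul_real => //; exact: continuous_cst_real.
have ca : continuous a.
  by apply: continuous_add_real => //; exact: continuous_cst_real.
have E1 : expect (fun y => K g y - 1) = 0.
  rewrite (expectB hA omega_state (@K_cont g) (@continuous_cst_real _ _ 1)).
  by rewrite expect_kernel (expect_cst hA omega_state) subrr.
have Ea : expect a = 2^-1.
  rewrite (expectD hA omega_state)//; last exact: continuous_cst_real.
  by rewrite (expect_cst hA omega_state) (expectZ hA omega_state)// E1 mulr0 addr0.
have a01 y : 0 <= a y <= 1.
  have M4 : 0 < 4 * M by rewrite mulr_gt0.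
  have : `|(4 * M)^-1 * (K g y - 1)| <= 4^-1.
    rewrite normrM gtr0_norm ?invr_gt0// mulrC ler_pdivrMr//.
    by rewrite mulrA mulVf ?mul1r// pnatr_eq0.
  by rewrite ler_norml /a => /andP[h1 h2]; apply/andP; split; lra.
have := expect_weighted_kernel g ca a01; rewrite Ea => H.
have {}H : expect (fun y => a y * K g y) = 2^-1 by apply: H; apply/andP; split; lra.
have c3 : continuous (fun y => (K g y - 1) * (K g y - 1)) by exact: continuous_mul_real.
have c4 : continuous (fun y => (4 * M)^-1 * ((K g y - 1) * (K g y - 1))).
  by apply: continuous_mul_real => //; exact: continuous_cst_real.
have c5 : continuous (fun y => 2^-1 * K g y).
  by apply: continuous_mul_real; [exact: continuous_cst_real|exact: K_cont].
have aE : (fun y => a y * K g y) = (fun y => (2^-1 * K g y +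
    (4 * M)^-1 * (K g y - 1)) + (4 * M)^-1 * ((K g y - 1) * (K g y - 1))).
  by apply/funext => y; rewrite /a; ring.
have c6 : continuous (fun y => 2^-1 * K g y + (4 * M)^-1 * (K g y - 1)).
  exact: continuous_add_real.
move: H; rewrite aE (expectD hA omega_state c6 c4) (expectD hA omega_state c5 c2).
rewrite !(expectZ hA omega_state)// ?E1 ?expect_kernel; try exact: K_cont.
rewrite mulr0 addr0 mulr1 => /eqP; rewrite -subr_eq0 addrAC subrr add0r.
rewrite mulf_eq0 invr_eq0 mulf_eq0 (gt_eqF M0) orbF pnatr_eq0 /=.
by move/eqP.
Qed.

End KmsOne.

Lemma kms_concentrated (R : realType) (Gam : groupType) (mu : Gam -> R)
    (S : seq Gam) (d : Gam -> Gam -> nat) (C : R)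
    (W : martin_compactification mu) (A : cstarAlgType R)
    (pi : (boundary W -> R[i]^o) -> A) (U : Gam -> A) (alpha : R -> A -> A)
    (beta : R) (omega : {ptws A -> R[i]^o}) (xi0 : boundary W) :
  random_walk mu -> transient mu -> is_word_metric S d -> 0 < C ->
  harnack mu d C -> moment_condition mu d C ->
  reduced_crossed_product (@bd_act R Gam mu W) pi U -> is_martin_flow pi U alpha ->
  beta != 0 -> kms_states alpha beta omega ->
  (forall g, bd_kernel g xi0 = 1) -> minimal_boundary xi0 ->
  forall (f : boundary W -> R[i]^o) (a : A), continuous f ->
  omega (pi f ** a) = f xi0 * omega a.
Proof.
move=> hmu htrans hd hC hh hm hA halpha b0 homega K1 hxi0 f a cf.
have hs := homega.1.
apply: (state_concentrated hA hs (@boundary_compact _ _ _ W) _ a cf) => x xx0.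
have [b1|b1] := eqVneq beta 1; last first.
  exact: (null_away_ne1 hmu htrans hd hC hh hm hA halpha homega K1 b0 b1 xx0).
apply: (null_away_1 hmu htrans hd hC hh hm hA hs K1 hxi0 _ xx0) => g.
rewrite -[RHS](expect_kernel_pow hmu htrans hC hh hA halpha homega g) b1.
by congr expect; apply/funext => y; rewrite (kernel_pow1 hmu htrans hC hh).
Qed.

(** * Evaluation at a fixed point, and the theorem *)

Section L2Fibres.
Variables (R : realType).
Local Notation normc := ComplexField.Normc.normc.

Lemma esum_pair (S T : choiceType) (f : S -> T -> \bar R) :
  (forall x y, (0 <= f x y)%E) ->
  (\esum_(p in [set: S * T]) f p.1 p.2 = \esum_(y in [set: T]) \esum_(x in [set: S]) f x y)%E.
Proof.
move=> f0; rewrite -esum_exchange// esum_esum//; congr esum.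
by apply/seteqP; split.
Qed.

Lemma l2sq_fibres (I X : choiceType) (psi : I * X -> R[i]) :
  l2sq psi = (\esum_(x in [set: X]) l2sq (fun h => psi (h, x)))%E.
Proof.
rewrite /l2sq -(esum_pair (f := fun h x => (normc (psi (h, x)) ^+ 2)%:E)).
  by apply: eq_esum => -[h x].
by move=> h x; rewrite lee_fin sqr_ge0.
Qed.

Lemma l2sqZ (I : choiceType) (k : R) (psi : I -> R[i]) :
  l2sq (fun i => k%:C * psi i) = ((k ^+ 2)%:E * l2sq psi)%E.
Proof.
rewrite /l2sq -esumZl ?lee_fin ?sqr_ge0//; last by move=> i; rewrite lee_fin sqr_ge0.
apply: eq_esum => i _.
by rewrite ComplexField.Normc.normcM normcR exprMn real_normK ?num_real.
Qed.

(** Normalizing by [r + e] in place of [r] covers the zero vector; then [e] tends to 0. *)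
Lemma l2_opnorm_bound (I : choiceType) (T : (I -> R[i]) -> I -> R[i]) (N : R) psi :
  0 <= N -> (forall (k : R) phi, T (fun i => k%:C * phi i) = fun i => k%:C * T phi i) ->
  (l2_opnorm T <= N%:E)%E -> (l2sq psi < +oo)%E ->
  (l2sq (T psi) <= (N ^+ 2)%:E * l2sq psi)%E.
Proof.
move=> N0 TZ TN; case E : (l2sq psi) (l2sq_ge0 psi) => [r| |]// r0 _.
rewrite lee_fin in r0.
have H e : 0 < e -> (l2sq (T psi) <= (N ^+ 2 * (r + e))%:E)%E.
  move=> e0; have re : 0 < r + e by rewrite ltr_wpDl.
  pose k : R := (Num.sqrt (r + e))^-1.
  have k2 : k ^+ 2 = (r + e)^-1 by rewrite exprVn sqr_sqrtr// ltW.
  have : (l2sq (fun i => k%:C * psi i)%R <= 1)%E.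
    by rewrite l2sqZ E -EFinM lee_fin k2 mulrC ler_pdivrMr// mul1r lerDl ltW.
  move=> /(l2_opnorm_ge N0 TN); rewrite TZ l2sqZ k2.
  case: (l2sq (T psi)) (l2sq_ge0 (T psi)) => [q _| _|//].
    by rewrite -EFinM !lee_fin mulrC ler_pdivrMr.
  by rewrite gt0_muley ?lte_fin ?invr_gt0// leye_eq.
case E2 : (l2sq (T psi)) (l2sq_ge0 (T psi)) H => [q| |]//= q0 H; last first.
  by have := H 1 ltr01; rewrite leye_eq.
rewrite -EFinM lee_fin; apply/ler_addgt0Pl => e e0.
have n1 : 0 < N ^+ 2 + 1 by rewrite ltr_wpDl// sqr_ge0.
have := H (e / (N ^+ 2 + 1)) (divr_gt0 e0 n1); rewrite lee_fin => h.
apply: (le_trans h); rewrite mulrDr addrC lerD2r mulrA ler_pdivrMr//.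
by rewrite mulrC ler_wpM2l ?(ltW e0)// lerDl.
Qed.

End L2Fibres.

(** * Comparison of the two regular representations *)

Section FixedPointHoms.
Variables (R : realType) (Gam : groupType) (X : topologicalType).
Variables (act : Gam -> X -> X) (act_continuous : forall g, continuous (act g)).
Variables (A B : cstarAlgType R).
Variables (pi : (X -> R[i]^o) -> A) (U : Gam -> A) (u : Gam -> B).
Hypothesis hA : reduced_crossed_product act pi U.
Hypothesis hB : reduced_group_algebra u.
Local Notation normc := ComplexField.Normc.normc.

Lemma pi_U_swap (f : X -> R[i]^o) g : continuous f ->
  U g ** pi f = pi (fun x => f (act g^-1%g x)) ** U g.
Proof.
move=> cf; rewrite -(cp_covariant hA)// -cmulA (cp_U_star hA) -(cp_UM hA).
by rewrite mulVg (cp_U1 hA) cmul1r.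
Qed.

Lemma continuous_act_comp (f : X -> R[i]^o) g : continuous f ->
  continuous (fun x => f (act g x) : R[i]^o).
Proof. by move=> cf x; apply: continuous_comp; [exact: act_continuous|exact: cf]. Qed.

Lemma monomialM (f f' : X -> R[i]^o) g g' : continuous f -> continuous f' ->
  (pi f ** U g) ** (pi f' ** U g') =
  pi (fun x => f x * f' (act g^-1%g x)) ** U (g * g')%g.
Proof.
move=> cf cf'; rewrite cmulA -(cmulA (pi f)) pi_U_swap// (cmulA (pi f)).
have ca : continuous (fun x => f' (act g^-1%g x)) by exact: continuous_act_comp.
by rewrite (cp_piM hA cf ca) (cp_UM hA) cmulA.
Qed.

Lemma monomial_star (f : X -> R[i]^o) g : continuous f ->
  cstar (pi f ** U g) = pi (fun x => conjc (f (act g x))) ** U g^-1%g.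
Proof.
move=> cf; have cj : continuous (fun x => conjc (f x) : R[i]^o) by exact: continuousC_conj.
by rewrite cstarM (cp_U_star hA) -(cp_pi_star hA cf) (pi_U_swap _ cj) invgK.
Qed.

Lemma crossed_product_dense (a : A) (e : R) : 0 < e ->
  exists (I : finType) (f : I -> X -> R[i]^o) (g : I -> Gam),
    (forall i, continuous (f i)) /\ nrm (a - \sum_i pi (f i) ** U (g i)) <= e.
Proof.
move=> e0; have [_ [n [f [g [cf ->]]]] h] := dense_nrm (cp_dense hA) a e0.
by exists 'I_n, f, g.
Qed.

Lemma group_algebra_dense (b : B) (e : R) : 0 < e ->
  exists (I : finType) (c : I -> R[i]) (g : I -> Gam),
    nrm (b - \sum_i c i *: u (g i)) <= e.
Proof.
move=> e0; have [_ [n [c [g ->]]] h] := dense_nrm (rg_dense hB) b e0.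
by exists 'I_n, c, g.
Qed.

(** Any finite type may index a sum, so that sums and products of two expressions are indexed by sum
    and product types. *)
Definition evaluation_graph (x0 : X) (a : A) (b : B) :=
  exists (I : finType) (f : I -> X -> R[i]^o) (g : I -> Gam),
  [/\ forall i, continuous (f i), a = \sum_i pi (f i) ** U (g i)
    & b = \sum_i f i x0 *: u (g i)].

Definition inclusion_graph (b : B) (a : A) :=
  exists (I : finType) (c : I -> R[i]) (g : I -> Gam),
  b = \sum_i c i *: u (g i) /\ a = \sum_i c i *: U (g i).

Lemma evaluation_graph_le (x0 : X) a b : (forall g, act g x0 = x0) ->
  evaluation_graph x0 a b -> nrm b <= nrm a.
Proof.
move=> fix0 [I [f [g [cf -> ->]]]].
pose f' (i : 'I_#|I|) := f (enum_val i); pose g' (i : 'I_#|I|) := g (enum_val i).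
have cf' i : continuous (f' i) by exact: cf.
have := cp_norm hA g' cf'; have := rg_norm hB (fun i => f' i x0) g'.
rewrite (big_enum_val (A := I) (fun i => f i x0 *: u (g i))).
rewrite (big_enum_val (A := I) (fun i => pi (f i) ** U (g i))) /cp_sum => Eb Ea.
rewrite -lee_fin /nrm Eb; apply: l2_opnorm_le; first exact: nrm_ge0.
have {}Ea : (l2_opnorm (cp_regular act f' g') <= (nrm (\sum_i pi (f' i) ** U (g' i)))%:E)%E.
  by rewrite -Ea.
move=> psi psi1.
(* An isometry onto the fibre over [x0]. There the coefficient [f (h x0)] is [f x0] for all [h], so
   it intertwines the two representations. *)
pose emb (phi : Gam -> R[i]) (p : Gam * X) : R[i] := if p.2 == x0 then phi p.1 else 0.
have embE phi : l2sq (emb phi) = l2sq phi.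
  rewrite l2sq_fibres -[RHS](@esum_delta _ _ x0 (fun=> l2sq phi)); last first.
    by move=> _; exact: l2sq_ge0.
  apply: eq_esum => x _; rewrite eq_sym /emb /=; case: eqP => // _.
  rewrite /l2sq esum1// => h _.
  by rewrite ComplexField.Normc.normc0 expr0n.
have := l2_opnorm_ge (nrm_ge0 _) Ea (_ : (l2sq (emb psi) <= 1)%E).
rewrite embE => /(_ psi1); rewrite -embE; congr (_ <= _)%E.
congr l2sq; apply/funext => -[h x]; rewrite /emb /cp_regular /group_regular /=.
case: eqP => [->|_]; first by apply: eq_bigr => i _; rewrite fix0.
by apply: big1 => i _; rewrite mulr0.
Qed.

(** Constant functions act on every fibre over a point of [X] as the group algebra does, so the
    bound is applied fibre by fibre and summed. *)
Lemma inclusion_graph_le b a : inclusion_graph b a -> nrm a <= nrm b.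
Proof.
move=> [I [c [g [-> ->]]]].
pose c' (i : 'I_#|I|) := c (enum_val i); pose g' (i : 'I_#|I|) := g (enum_val i).
have cc i : continuous ((fun=> c' i) : X -> R[i]^o) by exact: continuousC_cst.
have := cp_norm hA g' cc; have := rg_norm hB c' g'.
rewrite (big_enum_val (A := I) (fun i => c i *: u (g i))).
rewrite (big_enum_val (A := I) (fun i => c i *: U (g i))) /cp_sum => Eb.
under eq_bigr do rewrite (pi_cst hA) cmulZl cmul1l.
move=> Ea; rewrite -lee_fin /nrm Ea; apply: l2_opnorm_le; first exact: nrm_ge0.
have {}Eb : (l2_opnorm (group_regular c' g') <= (nrm (\sum_i c' i *: u (g' i)))%:E)%E.
  by rewrite -Eb.
move=> psi psi1; set N := nrm _ in Eb *.
have N0 : 0 <= N by exact: nrm_ge0.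
have TZ (k : R) phi : group_regular c' g' (fun i => k%:C * phi i) =
    fun i => k%:C * group_regular c' g' phi i.
  apply/funext => h; rewrite /group_regular mulr_sumr; apply: eq_bigr => i _.
  by rewrite mulrCA.
apply: (@le_trans _ _ ((N ^+ 2)%:E * l2sq psi)%E); last first.
  by rewrite -[leRHS]mule1 lee_wpmul2l// lee_fin sqr_ge0.
rewrite !l2sq_fibres -esumZl ?lee_fin ?sqr_ge0//; last by move=> x; exact: l2sq_ge0.
apply: le_esumT => x; apply: (l2_opnorm_bound (T := group_regular c' g')) => //.
apply: (@le_lt_trans _ _ 1%E); last exact: ltry.
apply: le_trans psi1; rewrite [leRHS]l2sq_fibres.
by apply: (@term_le_esum _ _ (fun x => l2sq (fun h => psi (h, x)))) => y; exact: l2sq_ge0.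
Qed.

End FixedPointHoms.

Section FixedPointHomsExist.
Variables (R : realType) (Gam : groupType) (X : topologicalType).
Variables (act : Gam -> X -> X) (act_continuous : forall g, continuous (act g)).
Variables (A B : cstarAlgType R).
Variables (pi : (X -> R[i]^o) -> A) (U : Gam -> A) (u : Gam -> B).
Hypothesis hA : reduced_crossed_product act pi U.
Hypothesis hB : reduced_group_algebra u.

Lemma evaluation_hom (x0 : X) : (forall g, act g x0 = x0) ->
  exists phi : A -> B, star_hom phi /\
    forall f g, continuous f -> phi (pi f ** U g) = f x0 *: u g.
Proof.
move=> fix0.
have [phi [hphi E]] : exists phi : A -> B, star_hom phi /\
    (forall a b, evaluation_graph pi U u x0 a b -> phi a = b).
  apply: star_hom_extension.
  - move=> _ _ _ _ [I [f [g [cf -> ->]]]] [J [f' [g' [cf' -> ->]]]].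
    exists (I + J)%type, (fun k => match k with inl i => f i | inr j => f' j end),
      (fun k => match k with inl i => g i | inr j => g' j end).
    by split; [case|rewrite big_sumType|rewrite big_sumType].
  - move=> z _ _ [I [f [g [cf -> ->]]]].
    exists I, (fun i x => z * f i x), g; split.
    + move=> i; exact: (@continuousC_mul _ _ (fun=> z) (f i) (@continuousC_cst R X z) (cf i)).
    + by rewrite scaler_sumr; apply: eq_bigr => i _; rewrite (cp_piZ hA)// cmulZl.
    + by rewrite scaler_sumr; apply: eq_bigr => i _; rewrite scalerA.
  - move=> _ _ _ _ [I [f [g [cf -> ->]]]] [J [f' [g' [cf' -> ->]]]].
    have ca i j : continuous (fun x => f i x * f' j (act (g i)^-1%g x) : R[i]^o).
      have c2 : continuous (fun x => f' j (act (g i)^-1%g x) : R[i]^o).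
        exact: (@continuous_act_comp _ _ _ _ act_continuous _ _ (cf' j)).
      exact: (continuousC_mul (cf i) c2).
    exists (I * J)%type, (fun p x => f p.1 x * f' p.2 (act (g p.1)^-1%g x)),
      (fun p => g p.1 * g' p.2)%g; split.
    + by move=> [i j]; exact: ca.
    + rewrite -(pair_big xpredT xpredT (fun i j =>
        pi (fun x => f i x * f' j (act (g i)^-1%g x)) ** U (g i * g' j)%g)) /=.
      rewrite (big_morph (fun a => a ** _) (fun a b => cmulDl a b _) (cmul0l _)).
      apply: eq_bigr => i _; rewrite (big_morph _ (cmulDr _) (cmul0r _)).
      by apply: eq_bigr => j _; rewrite (monomialM act_continuous hA).
    + rewrite -(pair_big xpredT xpredT (fun i j =>
        (f i x0 * f' j (act (g i)^-1%g x0)) *: u (g i * g' j)%g)) /=.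
      rewrite (big_morph (fun a => a ** _) (fun a b => cmulDl a b _) (cmul0l _)).
      apply: eq_bigr => i _; rewrite (big_morph _ (cmulDr _) (cmul0r _)).
      by apply: eq_bigr => j _; rewrite fix0 (rg_uM hB) cmulZl cmulZr scalerA.
  - move=> _ _ [I [f [g [cf -> ->]]]].
    exists I, (fun i x => conjc (f i (act (g i) x))), (fun i => (g i)^-1%g); split.
    + by move=> i; apply: continuousC_conj; exact: (@continuous_act_comp _ _ _ _ act_continuous _ _ (cf i)).
    + rewrite (big_morph _ (@cstarD R A) (cstar0 A)); apply: eq_bigr => i _.
      by rewrite (monomial_star hA).
    + rewrite (big_morph _ (@cstarD R B) (cstar0 B)); apply: eq_bigr => i _.
      by rewrite cstarZ (rg_u_star hB) fix0.
  - exists 'I_1, (fun=> fun=> 1), (fun=> 1%g); split.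
    + by move=> _; exact: continuousC_cst.
    + by rewrite big_ord1 (cp_pi1 hA) (cp_U1 hA) cmul1l.
    + by rewrite big_ord1 (rg_u1 hB) scale1r.
  - by move=> a b; exact: (evaluation_graph_le hA hB fix0).
  - move=> a e e0; have [I [f [g [cf h]]]] := crossed_product_dense hA a e0.
    by eexists; exists (\sum_i f i x0 *: u (g i)); split; [exists I, f, g|exact: h].
exists phi; split=> // f g cf; apply: E.
by exists 'I_1, (fun=> f), (fun=> g); split; rewrite ?big_ord1.
Qed.

Lemma inclusion_hom : exists iota : B -> A, star_hom iota /\
  forall g, iota (u g) = U g.
Proof.
have [phi [hphi E]] : exists phi : B -> A, star_hom phi /\
    (forall b a, inclusion_graph U u b a -> phi b = a).
  apply: star_hom_extension.
  - move=> _ _ _ _ [I [f [g [-> ->]]]] [J [f' [g' [-> ->]]]].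
    exists (I + J)%type, (fun k => match k with inl i => f i | inr j => f' j end),
      (fun k => match k with inl i => g i | inr j => g' j end).
    by split; rewrite big_sumType.
  - move=> z _ _ [I [f [g [-> ->]]]].
    exists I, (fun i => z * f i), g.
    by split; rewrite scaler_sumr; apply: eq_bigr => i _; rewrite scalerA.
  - move=> _ _ _ _ [I [f [g [-> ->]]]] [J [f' [g' [-> ->]]]].
    exists (I * J)%type, (fun p => f p.1 * f' p.2), (fun p => g p.1 * g' p.2)%g; split.
    + rewrite -(pair_big xpredT xpredT (fun i j => (f i * f' j) *: u (g i * g' j)%g)) /=.
      rewrite (big_morph (fun a => a ** _) (fun a b => cmulDl a b _) (cmul0l _)).
      apply: eq_bigr => i _; rewrite (big_morph _ (cmulDr _) (cmul0r _)).
      by apply: eq_bigr => j _; rewrite (rg_uM hB) cmulZl cmulZr scalerA.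
    + rewrite -(pair_big xpredT xpredT (fun i j => (f i * f' j) *: U (g i * g' j)%g)) /=.
      rewrite (big_morph (fun a => a ** _) (fun a b => cmulDl a b _) (cmul0l _)).
      apply: eq_bigr => i _; rewrite (big_morph _ (cmulDr _) (cmul0r _)).
      by apply: eq_bigr => j _; rewrite (cp_UM hA) cmulZl cmulZr scalerA.
  - move=> _ _ [I [f [g [-> ->]]]].
    exists I, (fun i => conjc (f i)), (fun i => (g i)^-1%g); split.
    + rewrite (big_morph _ (@cstarD R B) (cstar0 B)); apply: eq_bigr => i _.
      by rewrite cstarZ (rg_u_star hB).
    + rewrite (big_morph _ (@cstarD R A) (cstar0 A)); apply: eq_bigr => i _.
      by rewrite cstarZ (cp_U_star hA).
  - exists 'I_1, (fun=> 1), (fun=> 1%g); rewrite !big_ord1 !scale1r.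
    by rewrite (rg_u1 hB) (cp_U1 hA).
  - by move=> b a; exact: (inclusion_graph_le hA hB).
  - move=> b e e0; have [I [c [g h]]] := group_algebra_dense hB b e0.
    by eexists; exists (\sum_i c i *: U (g i)); split; [exists I, c, g|exact: h].
exists phi; split=> // g; apply: E.
by exists 'I_1, (fun=> 1), (fun=> g); rewrite !big_ord1 !scale1r.
Qed.

End FixedPointHomsExist.

(** * Bounded maps determined on generators *)

Section BoundedExtensionality.
Variables (R : realType) (Gam : groupType) (X : topologicalType).
Variables (act : Gam -> X -> X) (A B : cstarAlgType R) (V : normedModType R[i]).
Variables (pi : (X -> R[i]^o) -> A) (U : Gam -> A) (u : Gam -> B).

Record bounded_linear (E : normedModType R[i]) (L : E -> V) : Prop := {
  blD : forall a b, L (a + b) = L a + L b;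
  blZ : forall (z : R[i]) a, L (z *: a) = z *: L a;
  bl_bound : exists2 K : R, 0 <= K & forall a, nrm (L a) <= K * nrm a
}.

Lemma bl0 (E : normedModType R[i]) (L : E -> V) : bounded_linear L -> L 0 = 0.
Proof. by move=> h; rewrite -(scale0r (0 : E)) (blZ h) scale0r. Qed.

Lemma blB (E : normedModType R[i]) (L : E -> V) a b : bounded_linear L ->
  L (a - b) = L a - L b.
Proof. by move=> h; rewrite -scaleN1r (blD h) (blZ h) scaleN1r. Qed.

Lemma bounded_linear_ext (E : normedModType R[i]) (L M : E -> V) (D : set E) :
  bounded_linear L -> bounded_linear M ->
  (forall a (e : R), 0 < e -> exists2 a', D a' & nrm (a - a') <= e) ->
  (forall a, D a -> L a = M a) -> L = M.
Proof.
move=> hL hM dD LM; apply/funext => a; apply: nrm_le_eps => e e0.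
have [[K K0 LK] [K' K'0 MK]] := (bl_bound hL, bl_bound hM).
have k0 : 0 < K + K' + 1 by rewrite ltr_wpDl ?addr_ge0.
have [a' Da' h] := dD a _ (divr_gt0 e0 k0).
rewrite (le_trans (ler_nrm_dist _ (L a') _))// -(blB _ _ hL).
rewrite (LM _ Da') (nrmB (M a')) -(blB _ _ hM).
apply: le_trans (lerD (LK _) (MK _)) _; rewrite -mulrDl.
apply: (@le_trans _ _ ((K + K' + 1) * (e / (K + K' + 1)))).
  by apply: ler_pM; rewrite ?addr_ge0 ?nrm_ge0 ?lerDl.
by rewrite mulrCA mulfV ?gt_eqF// mulr1.
Qed.

Lemma crossed_product_ext (L M : A -> V) : reduced_crossed_product act pi U ->
  bounded_linear L -> bounded_linear M ->
  (forall f g, continuous f -> L (pi f ** U g) = M (pi f ** U g)) -> L = M.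
Proof.
move=> hA hL hM LM.
pose D : set A := fun a => exists (I : finType) (f : I -> X -> R[i]^o) (g : I -> Gam),
  (forall i, continuous (f i)) /\ a = \sum_i pi (f i) ** U (g i).
apply: (bounded_linear_ext (D := D) hL hM).
  move=> a e e0; have [I [f [g [cf h]]]] := crossed_product_dense hA a e0.
  by exists (\sum_i pi (f i) ** U (g i)) => //; exists I, f, g.
move=> _ [I [f [g [cf ->]]]].
rewrite (big_morph L (blD hL) (bl0 hL)) (big_morph M (blD hM) (bl0 hM)).
by apply: eq_bigr => i _; exact: LM.
Qed.

Lemma group_algebra_ext (L M : B -> V) : reduced_group_algebra u ->
  bounded_linear L -> bounded_linear M -> (forall g, L (u g) = M (u g)) -> L = M.
Proof.
move=> hB hL hM LM.
pose D : set B := fun b => exists (I : finType) (c : I -> R[i]) (g : I -> Gam),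
  b = \sum_i c i *: u (g i).
apply: (bounded_linear_ext (D := D) hL hM).
  move=> a e e0; have [I [f [g h]]] := group_algebra_dense hB a e0.
  by exists (\sum_i f i *: u (g i)) => //; exists I, f, g.
move=> _ [I [f [g ->]]].
rewrite (big_morph L (blD hL) (bl0 hL)) (big_morph M (blD hM) (bl0 hM)).
by apply: eq_bigr => i _; rewrite (blZ hL) (blZ hM) LM.
Qed.

End BoundedExtensionality.

Section BoundedExamples.
Variables (R : realType) (A B D : cstarAlgType R).

Lemma star_hom_bounded (phi : A -> B) : star_hom phi -> bounded_linear phi.
Proof. by move=> h; split; [exact: shD|exact: shZ|exists 1 => // a]; rewrite mul1r; exact: star_hom_contraction. Qed.

Lemma state_bounded (omega : A -> R[i]^o) : is_state omega -> bounded_linear omega.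
Proof.
move=> h; split=> [a b|z a|]; [exact: stD|exact: stZ|exists 1 => // a].
by rewrite nrm_normc mul1r; exact: state_contraction.
Qed.

Lemma bounded_linear_comp (V : normedModType R[i]) (L : B -> V) (phi : A -> B) :
  bounded_linear L -> bounded_linear phi -> bounded_linear (L \o phi).
Proof.
move=> hL hp; split=> [a b|z a|] /=.
- by rewrite (blD hp) (blD hL).
- by rewrite (blZ hp) (blZ hL).
- have [[K K0 LK] [K' K'0 pK]] := (bl_bound hL, bl_bound hp).
  exists (K * K') => [|a]; first exact: mulr_ge0.
  by apply: le_trans (LK _) _; rewrite -mulrA ler_wpM2l.
Qed.

Lemma state_comp (omega : B -> R[i]^o) (phi : A -> B) : star_hom phi ->
  is_state omega -> is_state (fun a => omega (phi a)).
Proof.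
move=> h [lin pos one]; split.
- by move=> k a b; rewrite (shD h) (shZ h) lin.
- by move=> a; rewrite (shM h) (sh_star h) pos.
- by rewrite (sh1 h).
Qed.

Lemma flow_star_hom (alpha : R -> A -> A) t : is_flow alpha -> star_hom (alpha t).
Proof.
move=> h; have lin := flow_linear h t.
have lD a b : alpha t (a + b) = alpha t a + alpha t b.
  by have := lin 1 a b; rewrite !scale1r.
have l0 : alpha t 0 = 0.
  by apply: (addrI (alpha t 0)); rewrite -lD !addr0.
split=> //.
- by move=> z a; have := lin z a 0; rewrite l0 !addr0.
- by move=> a b; exact: (flowM h).
- by move=> a; exact: (flow_star h).
(* The image of the unit is an identity for the image of [alpha t], and the unit itself lies in that
   image. *)
have E : alpha t (alpha (- t) cone) = cone by rewrite -(flowD h) subrr (flow0 h).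
by rewrite -[LHS]cmul1r -{2}E -(flowM h) cmul1l E.
Qed.

End BoundedExamples.

Lemma bd_act_continuous (R : realType) (Gam : groupType) (mu : Gam -> R)
  (W : martin_compactification mu) (g : Gam) : continuous (@bd_act R Gam mu W g).
Proof.
apply: continuous_comp_initial => x.
apply: (@continuous_comp _ _ _ (@bd_val R Gam mu W) (mc_act g)).
  exact: bd_val_continuous.
exact: mc_act_continuous.
Qed.

(** * Traces and KMS states *)

Section TraceKms.
Variables (R : realType) (A B : cstarAlgType R).
Local Notation normc := ComplexField.Normc.normc.

(* z |-> tau (phi (b F(z))) is entire and constant on the real line. *)
Lemma kms_of_trace (phi : A -> B) (alpha : R -> A -> A) (beta : R)
    (tau : {ptws B -> R[i]^o}) :
  star_hom phi -> (forall t a, phi (alpha t a) = phi a) ->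
  tracial_states tau -> kms_states alpha beta (fun a => tau (phi a)).
Proof.
move=> hphi inv [htau tr]; have hs := state_comp hphi htau; split=> // a b F [F1 F2] _.
pose c := tau (phi b ** phi a).
pose H z := tau (phi (b ** F z)) - c.
have H0 (t : R) : H t%:C = 0 by rewrite /H F1 (shM hphi) inv subrr.
have dH z : exists l, cdiff H z l.
  have [l dF] := (vdiff_derivable F z).1 (F2 z).
  exists (tau (phi (b ** l))) => e e0.
  have n0 : 0 < nrm b + 1 by rewrite ltr_wpDl// nrm_ge0.
  have [del d0 Hd] := dF _ (divr_gt0 e0 n0).
  exists del => // w wd; rewrite /H opprB addrA subrK.
  have -> : tau (phi (b ** F w)) - tau (phi (b ** F z)) - tau (phi (b ** l)) * (w - z) =
      tau (phi (b ** (F w - F z - (w - z) *: l))).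
    rewrite [in RHS]cmulBr cmulZr [b ** (_ - _)]cmulBr.
    by rewrite !(stB hs) (stZ hs) mulrC.
  apply: le_trans (state_contraction hs _) _; apply: le_trans (nrmM _ _) _.
  apply: (@le_trans _ _ ((nrm b + 1) * (e / (nrm b + 1) * normc (w - z)))).
    by apply: ler_pM; rewrite ?nrm_ge0 ?lerDl//; exact: Hd.
  by rewrite mulrA mulrCA mulfV ?gt_eqF// mulr1.
have /subr0_eq E := entire_zero dH H0 (0 +i* beta).
by rewrite E /c (shM hphi) tr.
Qed.

End TraceKms.

Lemma cmul_bounded_l (R : realType) (A : cstarAlgType R) (c : A) :
  bounded_linear (fun x => c ** x).
Proof.
split=> [a b|z a|]; [exact: cmulDr|exact: cmulZr|].
by exists (nrm c); [exact: nrm_ge0|move=> a; exact: nrmM].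
Qed.

Lemma cmul_bounded_r (R : realType) (A : cstarAlgType R) (c : A) :
  bounded_linear (fun x => x ** c).
Proof.
split=> [a b|z a|]; [exact: cmulDl|exact: cmulZl|].
by exists (nrm c); [exact: nrm_ge0|move=> a; rewrite mulrC; exact: nrmM].
Qed.

(** One variable at a time: both sides are bounded and linear in each. *)
Lemma tracial_of_generators (R : realType) (Gam : groupType) (B : cstarAlgType R)
    (u : Gam -> B) (tau : B -> R[i]^o) : reduced_group_algebra u -> is_state tau ->
  (forall g h, tau (u g ** u h) = tau (u h ** u g)) ->
  forall a b, tau (a ** b) = tau (b ** a).
Proof.
move=> hB hs H.
have bl c := bounded_linear_comp (state_bounded hs) (cmul_bounded_l c).
have br c := bounded_linear_comp (state_bounded hs) (cmul_bounded_r c).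
have H1 h a : tau (a ** u h) = tau (u h ** a).
  have E := group_algebra_ext hB (br (u h)) (bl (u h)) (fun g => H g h).
  exact: (congr1 (fun f => f a) E).
move=> a b.
have E := group_algebra_ext hB (bl a) (br a) (fun g => H1 g a).
exact: (congr1 (fun f => f b) E).
Qed.

(** The bijection and its inverse are both precompositions, so this gives weak* continuity in both
    directions. *)
Lemma ptws_precomp_continuous (S T : topologicalType) (V : uniformType) (k : T -> S) :
  continuous ((fun (f : {ptws S -> V}) (t : T) => f (k t)) :
    {ptws S -> V} -> {ptws T -> V}).
Proof.
move=> f; set Phi := (X in continuous_at f X).
have FF : Filter (Phi @ nbhs f) by exact: fmap_filter.
apply: ((@pointwise_cvgP T V (Phi @ nbhs f) (Phi f) FF).2) => t.
have FN : Filter (nbhs f) by exact: nbhs_filter.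
exact: ((@pointwise_cvgP S V (nbhs f) f FN).1 (fun x => id) (k t)).
Qed.

Lemma tracial_of_kms (R : realType) (Gam : groupType) (mu : Gam -> R)
    (S : seq Gam) (d : Gam -> Gam -> nat) (C : R)
    (W : martin_compactification mu) (A : cstarAlgType R)
    (pi : (boundary W -> R[i]^o) -> A) (U : Gam -> A) (alpha : R -> A -> A)
    (B : cstarAlgType R) (u : Gam -> B) (iota : B -> A)
    (beta : R) (omega : {ptws A -> R[i]^o}) (xi0 : boundary W) :
  random_walk mu -> transient mu -> is_word_metric S d -> 0 < C ->
  harnack mu d C -> moment_condition mu d C ->
  reduced_crossed_product (@bd_act R Gam mu W) pi U -> is_martin_flow pi U alpha ->
  reduced_group_algebra u -> star_hom iota -> (forall g, iota (u g) = U g) ->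
  beta != 0 -> kms_states alpha beta omega ->
  (forall g, bd_kernel g xi0 = 1) -> minimal_boundary xi0 ->
  tracial_states (fun b => omega (iota b)).
Proof.
move=> hmu htrans hd hC hh hm hA halpha hB hiota iotaE b0 homega K1 hxi0.
have hs := state_comp hiota homega.1; split => //.
apply: (tracial_of_generators hB hs) => g h; rewrite !(shM hiota) !iotaE.
have one := @continuous_one R Gam mu W.
have := kms_monomial hmu htrans hC hh hA halpha homega g h one one.
rewrite (cp_pi1 hA) !cmul1l => ->.
set k := rfun _; have ck : continuous k.
  by apply: continuous_rfun; exact: (continuous_kernel_pow hmu htrans hC hh).
(* The KMS condition leaves the factor [K^beta] to the right of the unitaries; covariance carries it
   to the left, where concentration evaluates it at the fixed point [xi0], at which it is 1. *)
rewrite cmulA -(cp_UM hA) (pi_U_swap hA _ ck).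
rewrite (kms_concentrated hmu htrans hd hC hh hm hA halpha b0 homega K1 hxi0); last first.
  exact: (@continuous_act_comp _ _ _ _ (@bd_act_continuous _ _ _ W) _ _ ck).
rewrite (act_of_kernel_one hmu htrans K1) /k /rfun /kernel_pow K1 ln1 mulr0 expR0.
by rewrite mul1r.
Qed.

Theorem theorem6p3 (R : realType) (Gam : groupType) (mu : Gam -> R)
    (hmu : random_walk mu) (htrans : transient mu)
    (S : seq Gam) (d : Gam -> Gam -> nat) (hd : is_word_metric S d)
    (C : R) (hC : 0 < C) (hharnack : harnack mu d C)
    (hmoment : moment_condition mu d C)
    (W : martin_compactification mu)
    (nu : set (boundary W) -> \bar R) (hnu : is_harmonic_measure nu)
    (xi0 : boundary W) (hxi0 : minimal_boundary xi0)
    (htrivial : nu [set xi0] = 1%E)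
    (A : cstarAlgType R) (pi : (boundary W -> R[i]^o) -> A) (U : Gam -> A)
    (hA : reduced_crossed_product (@bd_act R Gam mu W) pi U)
    (alpha : R -> A -> A) (halpha : is_martin_flow pi U alpha)
    (B : cstarAlgType R) (u : Gam -> B) (hB : reduced_group_algebra u)
    (beta : R) (hbeta : beta != 0) :
  exists omega : {ptws B -> R[i]^o} -> {ptws A -> R[i]^o},
    affine_homeomorphism (tracial_states (A := B)) (kms_states alpha beta) omega
    /\ forall (tau : {ptws B -> R[i]^o}), tracial_states tau ->
       forall (f : boundary W -> R[i]^o) (g : Gam), continuous f ->
         omega tau (pi f ** U g) = f xi0 * tau (u g).
Proof.
have K1 := kernel_harmonic_point hmu htrans hC hharnack hnu htrivial.
have fix0 := act_of_kernel_one hmu htrans K1.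
have act_cont := @bd_act_continuous R Gam mu W.
have [phi [hphi phiE]] := evaluation_hom act_cont hA hB fix0.
have [iota [hiota iotaE]] := inclusion_hom hA hB.
have one := @continuous_one R Gam mu W.
(* The flow multiplies a monomial by a power of the kernel, of which [phi] retains only the value at
   [xi0], namely 1. *)
have phi_flow t a : phi (alpha t a) = phi a.
  have hat := flow_star_hom t halpha.1.
  have bl := bounded_linear_comp (star_hom_bounded hphi) (star_hom_bounded hat).
  suff E : phi \o alpha t = phi by exact: (congr1 (fun h => h a) E).
  apply: (crossed_product_ext hA bl (star_hom_bounded hphi)) => f g cf /=.
  rewrite halpha.2// (shM hphi); set q := fun x => pow_Nit _ t.
  have cq : continuous (q : boundary W -> R[i]^o).
    have -> : q = fun x => cexp (t%:C * (0 -i* ln (bd_kernel g^-1%g x))).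
      apply/funext => x; rewrite /q /pow_Nit /cexp /=.
      by rewrite !mulr0 mul0r subr0 addr0 expR0 !mul1r mulrN cosN sinN.
    apply: continuous_cexp; apply: continuous_zmul.
    exact: (continuous_ln_kernel hmu htrans hC hharnack).
  have -> : phi (pi q) = cone.
    rewrite -[pi q]cmul1r -(cp_U1 hA) (phiE _ _ cq) (rg_u1 hB) /q K1 /pow_Nit.
    by rewrite ln1 mulr0 cos0 sin0 oppr0 scale1r.
  by rewrite cmul1r.
have phi_iota b : phi (iota b) = b.
  have bl := bounded_linear_comp (star_hom_bounded hphi) (star_hom_bounded hiota).
  have bi : bounded_linear (@id B).
    by split=> //; exists 1 => // a; rewrite mul1r.
  suff E : phi \o iota = id by exact: (congr1 (fun h => h b) E).
  apply: (group_algebra_ext hB bl bi) => g /=.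
  by rewrite iotaE -[U g]cmul1l -(cp_pi1 hA) (phiE _ _ one) scale1r.
exists (fun tau a => tau (phi a)); split; last first.
  move=> tau [htau _] f g cf.
  by rewrite (phiE _ _ cf) (stZ htau).
split.
- split.
  + by move=> tau htau; exact: (kms_of_trace beta hphi phi_flow htau).
  + move=> tau1 tau2 _ _ E; apply/funext => b.
    by rewrite -(phi_iota b); exact: (congr1 (fun h => h (iota b)) E).
  (* Surjectivity: on [f U_g] the given state and the one built from its trace both equal
     [f(xi0) omega(U_g)], and monomials determine a state. *)
  + move=> omega homega; exists (fun b => omega (iota b)).
      exact: (tracial_of_kms hmu htrans hd hC hharnack hmoment hA halpha hB hiota iotaE
        hbeta homega K1 hxi0).
    have bo := state_bounded homega.1.
    have bl := bounded_linear_comp (bounded_linear_comp bo (star_hom_bounded hiota))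
      (star_hom_bounded hphi).
    apply: (crossed_product_ext hA bl bo) => f g cf /=.
    rewrite (phiE _ _ cf) (shZ hiota) iotaE (stZ homega.1).
    by rewrite (kms_concentrated hmu htrans hd hC hharnack hmoment hA halpha hbeta homega K1 hxi0).
- by [].
- apply: continuous_subspaceT; exact: ptws_precomp_continuous.
exists (fun omega b => omega (iota b)); split.
  by move=> tau _; apply/funext => b; rewrite phi_iota.
apply: continuous_subspaceT; exact: ptws_precomp_continuous.
Qed.
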